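(* The Drinfeld double $D=D(\mathcal K^{\mathrm{cop}})$ is of tame representation type.
   Context: $\Bbbk$ is an algebraically closed field of characteristic zero, $\xi\in\Bbbk$ is a fixed primitive $4$-th root of unity and $\sqrt2$ a fixed square root of $2$. $\mathcal K$ is the $8$-dimensional Hopf algebra generated as an algebra by $a,b,c,d$ with relations $ab=\xi ba$, $ac=\xi ca$, $cb=bc=0$, $cd=\xi dc$, $bd=\xi db$, $ad=da$, $ad=1$, $b^2=c^2=0$, $a^2c=b$, $a^4=1$, and coproduct $\Delta(a)=a\otimes a+b\otimes c$, $\Delta(b)=a\otimes b+b\otimes d$, $\Delta(c)=c\otimes a+d\otimes c$, $\Delta(d)=c\otimes b+d\otimes d$. $D=D(\mathcal K^{\mathrm{cop}})$ is the Drinfeld double of $\mathcal K^{\mathrm{cop}}$; it has dimension $64$. As an algebra it is presented by generators $a,b,c,d,x,g$ subject to: the relations $ab=\xi ba$, $ac=\xi ca$, $cb=bc=0$, $cd=\xi dc$, $bd=\xi db$, $ad=da$, $ad=1$, $b^2=c^2=0$, $a^2c=b$, $a^4=1$ of $\mathcal K$ for $a,b,c,d$; $g^4=1$, $x^2=g^2-1$, $gx=-xg$; and $ag=ga$, $bg=-gb$, $cg=-gc$, $dg=gd$, $ax+\xi xa=\sqrt2\xi(b+gc)$, $bx-\xi xb=\sqrt2\xi(a-gd)$, $cx+\xi xc=\sqrt2\xi(d-ga)$, $dx-\xi xd=\sqrt2\xi(c+gb)$. Representation type refers to the category of finite-dimensional left $D$-modules, in the usual sense (tame: not of finite representation type,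 and the indecomposables of each dimension are, up to finitely many, contained in finitely many one-parameter families). *)

(* Defs.v *)
From HB Require Import structures.
From mathcomp Require Import all_boot all_order all_algebra all_field.

Set Implicit Arguments.
Unset Strict Implicit.
Unset Printing Implicit Defensive.

Import GRing.Theory.
Local Open Scope ring_scope.

(******************************************************************************)
(* An element of V (x) V is represented by a finite formal sum of pure        *)
(* tensors, i.e. a sequence of pairs; [:: (u1, v1); (u2, v2)] stands for      *)
(* u1 (x) v1 + u2 (x) v2.  Since V is finite dimensional over a field, two    *)
(* formal sums denote the same tensor iff all products p (x) q of linear      *)
(* functionals agree on them.  With this encoding the Sweedler sum            *)
(* F(h_(1), h_(2)) is \sum_(t <- comul h) F t.1 t.2, for F bilinear.          *)
(******************************************************************************)

Section Tensors.
Variables (k : fieldType) (V : vectType k).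
Implicit Types p q r : 'Hom(V, k^o).

Definition tensor2_eq (s t : seq (V * V)) : Prop :=
  forall p q, \sum_(x <- s) p x.1 * q x.2 = \sum_(x <- t) p x.1 * q x.2.

Definition tensor3_eq (s t : seq (V * V * V)) : Prop :=
  forall p q r, \sum_(x <- s) p x.1.1 * q x.1.2 * r x.2
              = \sum_(x <- t) p x.1.1 * q x.1.2 * r x.2.

End Tensors.

Section HopfAlgebras.
Variable k : fieldType.

Record hopf_data (H : falgType k) := HopfData {
  comul : H -> seq (H * H);
  counit : 'Hom(H, k^o);
  antipode : 'End(H);
  antipode_inv : 'End(H)
}.

(* (h_(1), h_(2), h_(3)) *)
Definition comul3 (H : falgType k) (hd : hopf_data H) (h : H) : seq (H * H * H) :=
  [seq (t.1, r.1, r.2) | t <- comul hd h, r <- comul hd t.2].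

(* Finite-dimensional Hopf algebras; the antipode is then always bijective,   *)
(* and its inverse is kept as part of the data.                               *)
Record is_hopf (H : falgType k) (hd : hopf_data H) : Prop := IsHopf {
  comul_linear : forall (s : k) (g h : H),
    tensor2_eq (comul hd (s *: g + h))
               ([seq (s *: t.1, t.2) | t <- comul hd g] ++ comul hd h);
  comul1 : tensor2_eq (comul hd 1) [:: (1, 1)];
  comulM : forall g h : H,
    tensor2_eq (comul hd (g * h))
      [seq (t.1 * r.1, t.2 * r.2) | t <- comul hd g, r <- comul hd h];
  counit1 : counit hd 1 = 1;
  counitM : forall g h : H, counit hd (g * h) = counit hd g * counit hd h;
  comulA : forall h : H,
    tensor3_eq (comul3 hd h)
      [seq (r.1, r.2, t.2) | t <- comul hd h, r <- comul hd t.1];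
  comul_counitl : forall h : H, \sum_(t <- comul hd h) counit hd t.1 *: t.2 = h;
  comul_counitr : forall h : H, \sum_(t <- comul hd h) counit hd t.2 *: t.1 = h;
  antipodel : forall h : H,
    \sum_(t <- comul hd h) antipode hd t.1 * t.2 = counit hd h *: 1;
  antipoder : forall h : H,
    \sum_(t <- comul hd h) t.1 * antipode hd t.2 = counit hd h *: 1;
  antipodeK : cancel (antipode hd) (antipode_inv hd);
  antipode_invK : cancel (antipode_inv hd) (antipode hd)
}.

(* H^cop: same algebra, opposite coproduct; its antipode is S^-1. *)
Definition cop (H : falgType k) (hd : hopf_data H) : hopf_data H := {|
  comul := fun h => [seq (t.2, t.1) | t <- comul hd h];
  counit := counit hd;
  antipode := antipode_inv hd;
  antipode_inv := antipode hd
|}.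

(* The product of H^*: (p * q)(h) = p(h_(1)) q(h_(2)); see convE. *)
Definition conv (H : falgType k) (hd : hopf_data H) (p q : 'Hom(H, k^o)) :
    'Hom(H, k^o) :=
  linfun (fun h : H => \sum_(t <- comul hd h) p t.1 * q t.2 : k^o).

Lemma convE (H : falgType k) (hd : hopf_data H) (hdP : is_hopf hd)
    (p q : 'Hom(H, k^o)) (h : H) :
  conv hd p q h = \sum_(t <- comul hd h) p t.1 * q t.2.
Proof.
pose f (x : H) : k^o := \sum_(t <- comul hd x) p t.1 * q t.2.
have linf : linear f.
  move=> s u v; rewrite /f (comul_linear hdP s u v p q) big_cat big_map /=.
  by congr (_ + _); rewrite scaler_sumr; apply: eq_bigr => t _; rewrite linearZ /= -scalerAl.
pose fL := GRing.isLinear.Build k H k^o *:%R f linf.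
pose g : {linear H -> k^o} := HB.pack f fL.
by rewrite /conv -/f -[f]/(g : H -> k^o) lfunE.
Qed.

(* D is (isomorphic to) the Drinfeld double H^{*cop} |x| H as an algebra:     *)
(*  - iota embeds H and kappa embeds H^{*cop}, whose product is that of H^*   *)
(*    and whose unit is the counit of H;                                      *)
(*  - the multiplication map H^* (x) H -> D is a linear bijection;            *)
(*  - h p = p(S^-1(h_(3)) ? h_(1)) h_(2)  for h in H and p in H^*.            *)
(* These data determine the product of D completely:                          *)
(* (p (x) h) (q (x) l) = p q(S^-1(h_(3)) ? h_(1)) (x) h_(2) l.                *)
Definition is_drinfeld_double (H : falgType k) (hd : hopf_data H)
    (D : falgType k) : Prop :=
  exists (iota : {lrmorphism H -> D}) (kappa : {linear 'Hom(H, k^o) -> D}),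
  [/\ kappa (counit hd) = 1,
      forall p q, kappa (conv hd p q) = kappa p * kappa q,
      forall (X : seq 'Hom(H, k^o)) (Y : seq H),
        basis_of fullv X -> basis_of fullv Y ->
        basis_of (fullv : {vspace D}) [seq kappa p * iota h | p <- X, h <- Y]
    & forall (h : H) (p : 'Hom(H, k^o)),
        iota h * kappa p =
        \sum_(t <- comul3 hd h)
           kappa (p \o amull (antipode_inv hd t.2) \o amulr t.1.1)%VF
           * iota t.1.2].

End HopfAlgebras.

Section AlgebraK.
Variables (k : fieldType) (xi : k).

Record K_relations (A : algType k) (a b c d : A) : Prop := KRelations {
  K_ab : a * b = xi *: (b * a);
  K_ac : a * c = xi *: (c * a);
  K_cb : c * b = 0;
  K_bc : b * c = 0;
  K_cd : c * d = xi *: (d * c);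
  K_bd : b * d = xi *: (d * b);
  K_ad_da : a * d = d * a;
  K_ad : a * d = 1;
  K_b2 : b ^+ 2 = 0;
  K_c2 : c ^+ 2 = 0;
  K_a2c : a ^+ 2 * c = b;
  K_a4 : a ^+ 4 = 1
}.

(* A is the algebra presented by generators a, b, c, d and K_relations. *)
Definition K_presentation (A : algType k) (a b c d : A) : Prop :=
  [/\ K_relations a b c d,
      forall (B : algType k) (a' b' c' d' : B), K_relations a' b' c' d' ->
        exists f : {lrmorphism A -> B},
          [/\ f a = a', f b = b', f c = c' & f d = d']
    & forall (B : algType k) (f g : {lrmorphism A -> B}),
        f a = g a -> f b = g b -> f c = g c -> f d = g d -> f =1 g].

(* The coproduct on the generators determines it, the counit and the antipode *)
(* on K.  With H = K^cop and r a square root of 2, the Drinfeld double is      *)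
(* generated by K and the functionals g, x given, for i = 0,...,3, by          *)
(* g(a^i) = xi^-i, g(a^i c) = 0, x(a^i) = 0, x(a^i c) = xi r.  They satisfy    *)
(* g^4 = 1, x^2 = g^2 - 1, gx = -xg, ag = ga, bg = -gb, cg = -gc, dg = gd,     *)
(* ax + xi xa = r xi (b + gc), bx - xi xb = r xi (a - gd),                     *)
(* cx + xi xc = r xi (d - ga), dx - xi xd = r xi (c + gb).                     *)
Record is_hopf_K (K : falgType k) (hd : hopf_data K) (a b c d : K) : Prop :=
  IsHopfK {
  K_hopf : is_hopf hd;
  K_dim : \dim {: K} = 8%N;
  K_pres : K_presentation a b c d;
  K_comul_a : tensor2_eq (comul hd a) [:: (a, a); (b, c)];
  K_comul_b : tensor2_eq (comul hd b) [:: (a, b); (b, d)];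
  K_comul_c : tensor2_eq (comul hd c) [:: (c, a); (d, c)];
  K_comul_d : tensor2_eq (comul hd d) [:: (c, b); (d, d)]
}.

End AlgebraK.

Section RepresentationType.
Variables (k : fieldType) (A : algType k).

(* A representation of the k-algebra A on R^n (column vectors), R being a     *)
(* commutative k-algebra with structure map nu.                               *)
Definition is_repr (R : comNzRingType) (nu : {rmorphism k -> R}) (n : nat)
    (rho : A -> 'M[R]_n) : Prop :=
  [/\ forall (s : k) (u v : A), rho (s *: u + v) = nu s *: rho u + rho v,
      rho 1 = 1%:M
    & forall u v : A, rho (u * v) = rho u *m rho v].

(* A finite-dimensional left A-module, with underlying space k^n. *)
Record fdmod := FdMod {
  mdim : nat;
  mact : A -> 'M[k]_mdim;
  mactP : is_repr idfun mact
}.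

Definition fdmod_iso (M N : fdmod) : Prop :=
  exists (P : 'M[k]_(mdim N, mdim M)) (Q : 'M[k]_(mdim M, mdim N)),
  [/\ Q *m P = 1%:M, P *m Q = 1%:M
    & forall u : A, P *m mact M u = mact N u *m P].

Definition submodule (M : fdmod) (U : {vspace 'cV[k]_(mdim M)}) : Prop :=
  forall (u : A) (v : 'cV[k]_(mdim M)), v \in U -> mact M u *m v \in U.

Definition indecomposable (M : fdmod) : Prop :=
  (0 < mdim M)%N /\
  forall U W : {vspace 'cV[k]_(mdim M)}, submodule U -> submodule W ->
    (U + W)%VS = fullv -> (U :&: W)%VS = 0%VS -> U = 0%VS \/ W = 0%VS.

Definition finite_repr_type : Prop :=
  exists (p : nat) (E : 'I_p -> fdmod),
  forall M : fdmod, indecomposable M -> exists i : 'I_p, fdmod_iso M (E i).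

(* A one-parameter family: an A-k[t]-bimodule that is free of rank n over     *)
(* k[t]; its member at z in k is the A-module obtained by applying            *)
(* - (x)_{k[t]} k[t]/(t - z), i.e. by evaluating the matrices at t = z.       *)
Record family := Family {
  fdim : nat;
  fact : A -> 'M[{poly k}]_fdim;
  factP : is_repr (@polyC k) fact
}.

Lemma family_memberP (T : family) (z : k) :
  is_repr idfun (fun u : A => map_mx (horner_eval z) (fact T u)).
Proof.
have [lin one mul] := factP T; split=> [s u v | | u v].
- by rewrite lin map_mxD map_mxZ /= horner_evalE hornerC.
- by rewrite one map_mx1.
- by rewrite mul map_mxM.
Qed.

Definition family_member (T : family) (z : k) : fdmod :=
  FdMod (family_memberP T z).

Definition tame : Prop :=
  ~ finite_repr_type /\
  forall n : nat, exists (p q : nat) (E : 'I_p -> fdmod) (T : 'I_q -> family),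
  forall M : fdmod, indecomposable M -> mdim M = n ->
    (exists i : 'I_p, fdmod_iso M (E i)) \/
    (exists (i : 'I_q) (z : k), fdmod_iso M (family_member (T i) z)).

End RepresentationType.

(* Main.v *)
Require Import Defs.
From HB Require Import structures.
From mathcomp Require Import all_boot all_order all_algebra all_field.
From mathcomp Require Import ring zify.
From Stdlib Require Import Classical_Prop.

Set Implicit Arguments.
Unset Strict Implicit.
Unset Printing Implicit Defensive.

Import GRing.Theory.
Local Open Scope ring_scope.

(** Write q for the fourth root of unity xi.

    The double is first given convenient generators.  Let A and C be the images
    of a and c, and g and x the images of a character and of a skew derivation of
    K that generate the dual of K.  Then a := A, g, u := A^3 C and
    y := x - (q / 2) C (A + g A^3) satisfy
      a^4 = g^4 = 1,  ag = ga,  au = q ua,  ay = - q ya,  gu = - ug,  gy = - yg,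
      u^2 = y^2 = 0,  yu - uy = g - a^2,
    see [straighten] and [double_generators].  The 64 words {1, u, y, uy} a^i g^j
    span any algebra generated in this way, so in D, of dimension 64, they form a
    basis and these relations present D ([pbw_basis], [double_presentation]).

    Let M be a finite-dimensional module.  The element h := g - a^2 commutes with
    a and g and anticommutes with u and y, and M is the direct sum of the
    submodules ker h and im h ([linking_split]).  So if M is indecomposable, h is
    injective or zero on it.
    - If h is injective, then yu - uy = h and y^2 = 0 give
      M = ker y (+) u (ker y), and a joint eigenbasis of a and g on ker y yields a
      basis of M that every generator maps to multiples of its elements, with
      scalars from a fixed finite set ([typical_monomial]).
    - If h = 0, then g = a^2, the operators u and y commute, and M is a module over
      k[u, y] / (u^2, y^2) with a grading by the eigenvalues of a.  When uy is not
      zero on M, a vector w with uyw != 0 generates a four-dimensional summand,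
      which is all of M and has the basis w, uw, yw, uyw ([projective_monomial]).
    - If h = 0 and uy = 0, put S := im u + im y and choose an a-stable complement T.
      The module is a pair of maps u, y : T -> S, a graded version of a pencil of
      matrices.  It has a decomposition into strings, on which u and y are partial
      bijections between homogeneous bases, and a part on which both u and y are
      isomorphisms ([string_band_decomposition]).  A string module has a basis as
      in the first case.  On the other part y^-1 u multiplies weights by -1, its
      square acts on a weight space of T, and indecomposability forces this
      square to be a single Jordan block ([band_structure]).
    So an indecomposable module is determined by a finite combinatorial datum or by
    its dimension 4b, a fourth root of unity and the eigenvalue of a Jordan block
    ([indecomposable_shape]).  There are finitely many data in each dimension, and
    the band modules for fixed b and fixed root of unity form a family with
    polynomial entries, given by matrices over k[t] that satisfy the relations
    ([tame_families]).  For b = 1 the eigenvalue is an invariant of the module, and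
    k is infinite; so the representation type is not finite
    ([short_band_parameter], [infinite_repr_type]). *)

(** * Tensors, functionals and convolution *)

Section TensorTests.
Variables (k : fieldType) (V : vectType k).

Definition coordf (i : 'I_(\dim (fullv : {vspace V}))) : 'Hom(V, k^o) :=
  linfun (fun v : V => coord (vbasis fullv) i v : k^o).

Lemma coordfE i v : coordf i v = coord (vbasis fullv) i v.
Proof.
pose f : {linear V -> k^o} := coord (vbasis (fullv : {vspace V})) i.
by rewrite /coordf -[LHS]/(linfun f v) lfunE.
Qed.

Lemma eq_functionals (v w : V) :
  (forall r : 'Hom(V, k^o), r v = r w) -> v = w.
Proof.
move=> rE; apply/eqP; rewrite -subr_eq0; apply/eqP.
have /coord_basis : basis_of fullv (vbasis (fullv : {vspace V})) by exact: vbasisP.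
move=> /(_ (v - w) (memvf _)) ->; apply: big1 => i _.
have := rE (coordf i); rewrite !coordfE linearB /= => ->.
by rewrite subrr scale0r.
Qed.

(** Two formal sums with the same values on products of functionals are equal
    as tensors: expanding the second components in a basis leaves, for each
    basis vector, one vector of first components, and functionals separate
    vectors. *)
Lemma tensor2_eq_bilin (A : algType k) (s t : seq (V * V)) (F G : {linear V -> A}) :
  tensor2_eq s t ->
  \sum_(x <- s) F x.1 * G x.2 = \sum_(x <- t) F x.1 * G x.2.
Proof.
move=> st.
pose b := vbasis (fullv : {vspace V}).
have expand r : \sum_(x <- r) F x.1 * G x.2 =
    \sum_i F (\sum_(x <- r) coord b i x.2 *: x.1) * G b`_i.
  under [RHS]eq_bigr do rewrite linear_sum /= mulr_suml.
  rewrite exchange_big /=; apply: eq_bigr => x _.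
  rewrite {1}(coord_basis (vbasisP _) (memvf x.2)) linear_sum /= mulr_sumr.
  by apply: eq_bigr => i _; rewrite !linearZ /= -scalerAr -scalerAl.
rewrite !expand; apply: eq_bigr => i _; congr (F _ * _).
apply: eq_functionals => r.
rewrite !linear_sum /=.
have E (q : seq (V * V)) : \sum_(x <- q) r (coord b i x.2 *: x.1) =
   \sum_(x <- q) r x.1 * coordf i x.2.
  by apply: eq_bigr => x _; rewrite linearZ /= coordfE mulrC.
by rewrite !E st.
Qed.

End TensorTests.

Lemma tensor2_eqM (k : fieldType) (A : falgType k) (s s' t t' : seq (A * A)) :
  tensor2_eq s s' -> tensor2_eq t t' ->
  tensor2_eq [seq (x.1 * y.1, x.2 * y.2) | x <- s, y <- t]
             [seq (x.1 * y.1, x.2 * y.2) | x <- s', y <- t'].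
Proof.
move=> ss' tt' p q; rewrite !big_allpairs_dep /=.
transitivity (\sum_(x <- s') \sum_(y <- t) p (x.1 * y.1) * q (x.2 * y.2)).
  rewrite exchange_big [RHS]exchange_big /=; apply: eq_bigr => y _.
  have E z : \sum_(x <- z) p (x.1 * y.1) * q (x.2 * y.2) =
      \sum_(x <- z) (p \o amulr y.1)%VF x.1 * (q \o amulr y.2)%VF x.2.
    by apply: eq_bigr => x _; rewrite !comp_lfunE !lfunE.
  by rewrite !E ss'.
apply: eq_bigr => x _.
have E z : \sum_(y <- z) p (x.1 * y.1) * q (x.2 * y.2) =
    \sum_(y <- z) (p \o amull x.1)%VF y.1 * (q \o amull x.2)%VF y.2.
  by apply: eq_bigr => y _; rewrite !comp_lfunE !lfunE.
by rewrite !E tt'.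
Qed.

Lemma tensor2_eq_trans (k : fieldType) (V : vectType k) (s t r : seq (V * V)) :
  tensor2_eq s t -> tensor2_eq t r -> tensor2_eq s r.
Proof. by move=> st tr p q; rewrite st tr. Qed.

Section HopfGeneral.
Variables (k : fieldType) (H : falgType k) (hd : hopf_data H).
Hypothesis hdP : is_hopf hd.
Implicit Types p q r : 'Hom(H, k^o).

Lemma conv_cop p q : conv (cop hd) p q = conv hd q p.
Proof.
rewrite /conv unlock /linfun_def; congr Hom; apply/matrixP => i j; rewrite !mxE /=.
by congr (v2r _ _ _); rewrite big_map; apply: eq_bigr => t _; rewrite mulrC.
Qed.

Lemma conv_tensor p q h s :
  tensor2_eq (comul hd h) s -> conv hd p q h = \sum_(x <- s) p x.1 * q x.2.
Proof. by move=> hs; rewrite convE. Qed.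

(** A functional of the middle factor of the iterated coproduct, with scalars
    from the outer factors, is a double convolution.  This reduces the
    computation of iterated coproducts to products of functionals. *)
Lemma comul3_cop_sum (phi psi r : 'Hom(H, k^o)) h :
  \sum_(t <- comul3 (cop hd) h) phi t.2 * psi t.1.1 * r t.1.2 =
  conv hd (conv hd phi r) psi h.
Proof.
rewrite (convE hdP) /comul3 /= big_allpairs_dep /= big_map.
apply: eq_bigr => t _ /=; rewrite (convE hdP) mulr_suml big_map.
by apply: eq_bigr => s _ /=; rewrite mulrAC.
Qed.

End HopfGeneral.

(** * The algebra K *)

Lemma primitive4_sqr (k : fieldType) (xi : k) : 4.-primitive_root xi -> xi * xi = -1.
Proof.
move=> hxi; have x4 : (xi ^+ 2 - 1) * (xi ^+ 2 + 1) = 0.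
  by rewrite -subr_sqr_1 -exprM (prim_expr_order hxi) subrr.
move/eqP: x4; rewrite mulf_eq0 => /orP[|].
  rewrite subr_eq0 => /eqP x2; have := prim_order_dvd hxi 2.
  by rewrite x2 eqxx.
by rewrite addr_eq0 expr2 => /eqP.
Qed.

(** Two algebra maps out of a presented algebra that agree on the generators
    are equal; applied to the identity and to the retraction onto the subalgebra
    spanned by words, this turns the universal property into generation. *)
Lemma K_presentation_generated (k : fieldType) (xi : k) (A : falgType k) (a b c d : A) :
  K_presentation xi a b c d -> agenv <<[:: a; b; c; d]>>%VS = fullv.
Proof.
case=> rel ex uniq.
pose U := <<(<<[:: a; b; c; d]>>%VS)>>%AS.
have U1 : algid U = 1.
  apply/eqP; rewrite algid_eq1.
  by have := sub1_agenv <<[:: a; b; c; d]>>%VS; rewrite -memvE.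
have inU z : z \in [:: a; b; c; d] -> z \in U.
  by move=> zin; apply: (subvP (sub_agenv _)); apply: memv_span.
have [a1 a2 a3 a4] : [/\ a \in U, b \in U, c \in U & d \in U].
  by split; apply: inU; rewrite !inE eqxx ?orbT.
pose B : falgType k := subvs_of U.
have relB : K_relations xi (Subvs a1 : B) (Subvs a2) (Subvs a3) (Subvs a4).
  case: rel => *; split; apply/val_inj => //=; rewrite ?U1 //.
have [f [fa fb fc fd]] := ex B _ _ _ _ relB.
pose g (x : A) : A := vsval (f x).
have gL : linear g by move=> s u v; rewrite /g linearP.
have gM : monoid_morphism g.
  by split=> [|u v]; rewrite /g ?rmorph1 ?rmorphM //=.
pose gl := GRing.isLinear.Build k A A *:%R g gL.
pose gm := GRing.isMonoidMorphism.Build A A g gM.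
pose G : {lrmorphism A -> A} := HB.pack g gl gm.
have E : G =1 (idfun : {lrmorphism A -> A}).
  by apply: uniq; rewrite /= /g ?fa ?fb ?fc ?fd.
apply/eqP; rewrite eqEsubv subvf; apply/subvP => v _.
by rewrite -[v](E v); apply: subvsP.
Qed.

Section AlgebraK.
Variables (k : fieldType) (xi : k).
Hypothesis xi2 : xi * xi = -1.

Section Relations.
Variables (A : algType k) (a b c d : A).
Hypothesis rel : K_relations xi a b c d.

Lemma K_a4E : a * a * a * a = 1.
Proof. by have := K_a4 rel; rewrite 3!exprSr expr1. Qed.
Lemma K_dE : d = a * a * a.
Proof. by rewrite -[RHS]mulr1 -(K_ad rel) mulrA K_a4E mul1r. Qed.
Lemma K_bE : b = a * a * c.
Proof. by rewrite -expr2 (K_a2c rel). Qed.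
Lemma K_ca : c * a = - xi *: (a * c).
Proof. by rewrite (K_ac rel) scalerA mulNr xi2 opprK scale1r. Qed.
Lemma K_ba : b * a = - xi *: (a * b).
Proof. by rewrite (K_ab rel) scalerA mulNr xi2 opprK scale1r. Qed.

End Relations.

Section Structure.
Variables (K : falgType k) (a b c d : K).
Hypothesis pres : K_presentation xi a b c d.
Hypothesis dimK : \dim {:K} = 8%N.
Let rel : K_relations xi a b c d.
Proof. by case: pres. Qed.

(** The words that remain after d = a^3 and b = a^2 c are eliminated and c is
    moved to the right of a. *)
Definition K_monomials : seq K :=
  [:: 1; a; a * a; a * a * a; c; a * c; a * a * c; a * a * a * c].

Lemma K_span : <<K_monomials>>%VS = fullv.
Proof.
apply/eqP; rewrite eqEsubv subvf -(K_presentation_generated pres).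
have a4 := K_a4E rel.
set L := <<K_monomials>>%VS.
have mL v : v \in K_monomials -> v \in L by exact: memv_span.
have cc : c * c = 0 by rewrite -expr2 (K_c2 rel).
have ca := K_ca rel.
have xcc x : x * c * c = 0 by rewrite -mulrA cc mulr0.
have xca x : x * c * a = - xi *: (x * a * c) by rewrite -mulrA ca -scalerAr mulrA.
have sA (s : k) (x y : K) : (s *: x) * y = s *: (x * y) by rewrite -scalerAl.
have stepL v : v \in L -> (a * v \in L) && (c * v \in L).
  move=> vL; apply/andP; split.
    have : (amull a @: L <= L)%VS.
      rewrite limg_span; apply/span_subvP => _ /mapP[w wm ->].
      rewrite lfunE /=; move: wm; rewrite !inE.
      by do 7?[case/orP] => /eqP->; rewrite ?mulr1 ?mulrA ?a4 ?mul1r;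
        apply: mL; rewrite !inE eqxx ?orbT.
    by move/subvP => /(_ _ (memv_img _ vL)); rewrite lfunE.
  have : (amull c @: L <= L)%VS.
    rewrite limg_span; apply/span_subvP => _ /mapP[w wm ->].
    rewrite lfunE /=; move: wm; rewrite !inE.
    by do 7?[case/orP] => /eqP->; rewrite ?mulr1 ?mulrA;
      rewrite ?(ca, xca, sA, cc, xcc, mul0r, scaler0, mem0v) //;
      do ?apply: rpredZ; apply: mL; rewrite !inE eqxx ?orbT.
  by move/subvP => /(_ _ (memv_img _ vL)); rewrite lfunE.
apply: agenv_sub_modl; first by rewrite -memvE; apply: mL; rewrite inE eqxx.
apply/prodvP => z v zin vL.
have : (amulr v @: <<[:: a; b; c; d]>> <= L)%VS.
  rewrite limg_span; apply/span_subvP => _ /mapP[w wm ->]; rewrite lfunE /=.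
  have [Av Cv] := andP (stepL v vL).
  have [AAv _] := andP (stepL _ Av).
  have [AAAv _] := andP (stepL _ AAv).
  have [ACv _] := andP (stepL _ Cv).
  have [AACv _] := andP (stepL _ ACv).
  move: wm; rewrite !inE => /or4P[]/eqP-> //.
    by rewrite (K_bE rel) -!mulrA.
  by rewrite (K_dE rel) -!mulrA.
by move/subvP => /(_ _ (memv_img _ zin)); rewrite lfunE.
Qed.

Lemma K_basis : basis_of fullv K_monomials.
Proof. by rewrite basisEdim K_span dimK subvv. Qed.

Lemma K_functional_eq (p q : 'Hom(K, k^o)) :
  {in K_monomials, p =1 q} -> p = q.
Proof.
by move=> pq; apply/(fullv_lfunP _ _ K_span).
Qed.

End Structure.
End AlgebraK.

(** * Counit, antipode and two functionals of K *)

Section UpperTriangular.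
Variable k : fieldType.

Definition utmx (p q r : k) : 'M[k]_2 :=
  \matrix_(i, j) if i == 0 then (if j == 0 then p else q)
                 else (if j == 0 then 0 else r).

Lemma utmxM p q r p' q' r' :
  utmx p q r * utmx p' q' r' = utmx (p * p') (p * q' + q * r') (r * r').
Proof.
apply/matrixP => i j; rewrite !mxE big_ord_recl big_ord1 !mxE /=.
by case: (i == 0); case: (j == 0) => /=; rewrite ?mul0r ?mulr0 ?add0r ?addr0.
Qed.

Lemma utmxZ s p q r : s *: utmx p q r = utmx (s * p) (s * q) (s * r).
Proof.
apply/matrixP => i j; rewrite !mxE.
by case: (i == 0); case: (j == 0); rewrite ?mulr0.
Qed.

Lemma utmx1 : 1 = utmx 1 0 1.
Proof.
apply/matrixP => i j; rewrite !mxE.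
by case: i => [[|[|//]] hi]; case: j => [[|[|//]] hj].
Qed.

Lemma utmx0 : 0 = utmx 0 0 0.
Proof. by apply/matrixP => i j; rewrite !mxE; case: (i == 0); case: (j == 0). Qed.

End UpperTriangular.

Section HopfK.
Variables (k : fieldType) (xi : k).
Hypothesis xi2 : xi * xi = -1.
Variables (K : falgType k) (hK : hopf_data K) (a b c d : K).
Hypothesis hKP : is_hopf_K xi hK a b c d.
Let pres := K_pres hKP.
Let hP := K_hopf hKP.
Let rel : K_relations xi a b c d.
Proof. by case: pres. Qed.
Local Notation eps := (counit hK).
Local Notation S := (antipode hK).

(** Enough independence to read the counit off the coproducts of a and c. *)
Lemma K_free2 s t : s *: a + t *: c = 0 -> (s = 0) /\ (t = 0).
Proof.
have /basis_free fr := K_basis xi2 pres (K_dim hKP).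
have : free [:: a; c].
  have : perm_eq (K_monomials a c) ([:: a; c] ++ [:: 1; a * a; a * a * a; a * c; a * a * c; a * a * a * c]).
    rewrite /K_monomials /= -[X in perm_eq X _]/([:: 1] ++ [:: a; a * a; a * a * a; c; a * c; a * a * c; a * a * a * c]).
    rewrite perm_catC /= perm_cons -cat1s.
    rewrite -[X in perm_eq X _]/([:: a * a; a * a * a] ++ [:: c; a * c; a * a * c; a * a * a * c; 1]).
    rewrite perm_catC /= perm_cons.
    rewrite -[X in perm_eq X _]/([:: a * c; a * a * c; a * a * a * c] ++ [:: 1; a * a; a * a * a]).
    by rewrite perm_catC.
  by move=> pe; move: fr; rewrite (perm_free pe) cat_free => /andP[].
move=> /(freeP (X := [tuple a; c])) H st.
have E : \sum_(i < 2) (nth 0 [:: s; t] i) *: [tuple a; c]`_i = 0.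
  by rewrite big_ord_recl big_ord1.
by split; [apply: (H _ E 0) | apply: (H _ E 1)].
Qed.

(** Contracting the coproducts of a and c with the counit gives
    a = eps(a) a + eps(b) c and c = eps(c) a + eps(d) c. *)
Lemma counit_gens : [/\ eps a = 1, eps b = 0, eps c = 0 & eps d = 1].
Proof.
pose E1 : {linear K -> K} := idfun.
have sumE h s : tensor2_eq (comul hK h) s -> \sum_(t <- s) (eps t.1) *: t.2 = h.
  move=> hs; apply: eq_functionals => r.
  rewrite -[in RHS](comul_counitl hP h) !linear_sum /=.
  have L z : \sum_(i <- z) r (eps i.1 *: i.2) = \sum_(i <- z) eps i.1 * r i.2.
    by apply: eq_bigr => x _; rewrite linearZ.
  by rewrite !L hs.
have := sumE _ _ (K_comul_a hKP); have := sumE _ _ (K_comul_c hKP).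
rewrite !big_cons !big_nil /= !addr0 => Ec Ea.
have [ea eb] : eps a - 1 = 0 /\ eps b = 0.
  by apply: K_free2; rewrite scalerBl scale1r addrAC Ea subrr.
have [ec ed] : eps c = 0 /\ eps d - 1 = 0.
  by apply: K_free2; rewrite scalerBl scale1r addrA Ec subrr.
by split=> //; apply/eqP; rewrite -subr_eq0 ?ea ?ed.
Qed.

(** The assignment of diag(1, - xi) to a and of the matrix unit E_12 to c extends
    to a representation of K by upper triangular matrices.  The diagonal entries
    of such a representation are characters, here the counit and G, and the
    corner is a skew derivation X relative to them.  G is the group-like
    element g of the usual presentation of the double, and X is its generator x
    divided by xi times the square root of 2, so that no square root occurs. *)
Lemma K_functionals : exists G X : 'Hom(K, k^o),
  [/\ G 1 = 1 /\ X 1 = 0,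
      forall u v, G (u * v) = G u * G v,
      forall u v, X (u * v) = eps u * X v + X u * G v,
      [/\ G a = - xi, G b = 0, G c = 0 & G d = xi]
    & [/\ X a = 0, X b = 1, X c = 1 & X d = 0]].
Proof.
have [_ ex _] := pres.
have xi4 : xi * xi * xi * xi = 1 by ring: xi2.
have relT : K_relations xi (utmx 1 0 (- xi)) (utmx 0 1 0) (utmx 0 1 0) (utmx 1 0 xi).
  split; rewrite ?exprS ?expr0 ?mulr1 ?utmxM ?utmxZ ?utmx1 ?utmx0 //; congr utmx;
  by ring: xi2.
have [f [fa fb fc fd]] := ex _ _ _ _ _ relT.
pose entry i j : 'Hom(K, k^o) := linfun (fun v : K => f v i j : k^o).
have entryE i j v : entry i j v = f v i j.
  pose e (u : K) : k^o := f u i j.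
  have eL : linear e by move=> s u w; rewrite /e linearP !mxE.
  pose eb := GRing.isLinear.Build k K k^o *:%R e eL.
  pose el : {linear K -> k^o} := HB.pack e eb.
  by rewrite /entry -[LHS]/(linfun el v) lfunE.
have fM i j u v : f (u * v) i j = f u i 0 * f v 0 j + f u i 1 * f v 1 j.
  by rewrite rmorphM mxE big_ord_recl big_ord1; congr (_ + f u i _ * f v _ j); apply/val_inj.
have f1 i j : f 1 i j = (i == j)%:R by rewrite rmorph1 mxE.
have e10 v : f v 1 0 = 0.
  have : entry 1 0 = 0.
    apply: (K_functional_eq xi2 pres) => u; rewrite !inE zero_lfunE entryE.
    by do 7?[case/orP] => /eqP->; rewrite ?f1 // ?fM ?fa ?fc ?mxE /=; ring.
  by move=> /lfunP/(_ v); rewrite entryE zero_lfunE.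
have e00 v : f v 0 0 = eps v.
  have [ea _ ec _] := counit_gens.
  rewrite -(entryE 0 0); apply: (congr1 (fun h : 'Hom(K, k^o) => h v)).
  apply: (K_functional_eq xi2 pres) => u; rewrite !inE entryE.
  by do 7?[case/orP] => /eqP->; rewrite ?(counitM hP, counit1 hP, ea, ec) ?f1 ?fM ?fa ?fc ?mxE /=; ring.
exists (entry 1 1), (entry 0 1); rewrite !entryE !f1 ?fa ?fb ?fc ?fd !mxE.
split=> //=; first by move=> u v; rewrite !entryE fM e10; ring.
by move=> u v; rewrite !entryE fM e00.
Qed.

(** The four antipode identities for the generators are linear in the unknown
    values; cb = bc = 0 kills the mixed terms. *)
Lemma antipode_gens : [/\ S a = d, S b = - (d * b * a), S c = - (a * c * d) & S d = a].
Proof.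
have [ea eb ec ed] := counit_gens.
have sumE h s : tensor2_eq (comul hK h) s -> \sum_(t <- s) S t.1 * t.2 = eps h *: 1.
  move=> hs; rewrite -(antipodel hP h).
  by rewrite -(@tensor2_eq_bilin _ _ K _ _ S idfun hs).
have := sumE _ _ (K_comul_a hKP); have := sumE _ _ (K_comul_b hKP).
have := sumE _ _ (K_comul_c hKP); have := sumE _ _ (K_comul_d hKP).
rewrite !big_cons !big_nil /= !addr0 ea eb ec ed scale1r !scale0r => Ed Ec Eb Ea.
have ad := K_ad rel; have da : d * a = 1 by rewrite -(K_ad_da rel).
have Sb : S b = - (S a * b * a).
  have : (S a * b + S b * d) * a = 0 by rewrite Eb mul0r.
  by rewrite mulrDl -(mulrA _ d) da mulr1 => /eqP; rewrite addrC addr_eq0 => /eqP.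
have Sc : S c = - (S d * c * d).
  have : (S c * a + S d * c) * d = 0 by rewrite Ec mul0r.
  by rewrite mulrDl -(mulrA _ a) ad mulr1 => /eqP; rewrite addr_eq0 => /eqP.
have Sa1 : S a * a = 1.
  move: Ea; rewrite Sb mulNr -!mulrA (K_ac rel) -scalerAr [b * (c * _)]mulrA (K_bc rel).
  by rewrite mul0r scaler0 mulr0 subr0.
have Sd1 : S d * d = 1.
  have db : d * b = - xi *: (b * d).
    by rewrite (K_bd rel) scalerA mulNr xi2 opprK scale1r.
  move: Ed; rewrite Sc mulNr -!mulrA db -scalerAr [c * (b * _)]mulrA (K_cb rel).
  by rewrite mul0r scaler0 mulr0 oppr0 add0r.
have Sa : S a = d by rewrite -[LHS]mulr1 -ad mulrA Sa1 mul1r.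
have Sd : S d = a by rewrite -[LHS]mulr1 -da mulrA Sd1 mul1r.
by rewrite Sb Sc Sa Sd.
Qed.

End HopfK.

(** * The dual of K *)

Section DoubleK.
Variables (k : fieldType) (xi : k).
Hypothesis xi2 : xi * xi = -1.
Hypothesis two_neq0 : 2 != 0 :> k.
Variables (K : falgType k) (hK : hopf_data K) (a b c d : K).
Hypothesis hKP : is_hopf_K xi hK a b c d.
Let pres := K_pres hKP.
Let hP := K_hopf hKP.
Let rel : K_relations xi a b c d.
Proof. by case: pres. Qed.
Local Notation eps := (counit hK).
Local Notation S := (antipode hK).

Lemma conv_gens (p q : 'Hom(K, k^o)) :
  [/\ conv hK p q a = p a * q a + p b * q c,
      conv hK p q b = p a * q b + p b * q d,
      conv hK p q c = p c * q a + p d * q c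
    & conv hK p q d = p c * q b + p d * q d].
Proof.
split; [have H := K_comul_a hKP | have H := K_comul_b hKP
  | have H := K_comul_c hKP | have H := K_comul_d hKP];
by rewrite (conv_tensor hP p q H) !big_cons big_nil /= addr0.
Qed.

Lemma conv_monomials (p q : 'Hom(K, k^o)) :
  [/\ conv hK p q 1 = p 1 * q 1,
      conv hK p q (a * a) = p (a * a) * q (a * a),
      conv hK p q (a * c) = p (a * c) * q (a * a) + p 1 * q (a * c)
    & conv hK p q (a * a * a * c) =
        p (a * a * a * c) * q 1 + p (a * a) * q (a * a * a * c)].
Proof.
have M h h' s s' (hs : tensor2_eq (comul hK h) s) (hs' : tensor2_eq (comul hK h') s') :=
  tensor2_eq_trans (comulM hP h h') (tensor2_eqM hs hs').
have Da := K_comul_a hKP; have Dc := K_comul_c hKP; have Dd := K_comul_d hKP.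
have ad := K_ad rel; have da : d * a = 1 by rewrite -(K_ad_da rel).
have dE := K_dE rel; have a4 := K_a4E rel.
have b2 : b * b = 0 by rewrite -expr2 (K_b2 rel).
have c2 : c * c = 0 by rewrite -expr2 (K_c2 rel).
split.
- by rewrite (conv_tensor hP p q (comul1 hP)) big_cons big_nil addr0.
- rewrite (conv_tensor hP p q (M _ _ _ _ Da Da)) !big_cons big_nil /= addr0.
  rewrite (K_ba xi2 rel) (K_ca xi2 rel) b2 c2 !linearZ /= !linear0 /GRing.scale /=.
  by ring: xi2.
- rewrite (conv_tensor hP p q (M _ _ _ _ Da Dc)) !big_cons big_nil /= addr0.
  by rewrite ad c2 (K_bc rel) !linear0 mul0r mulr0 addr0 addr0.
- rewrite -dE (conv_tensor hP p q (M _ _ _ _ Dd Dc)) !big_cons big_nil /= addr0.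
  rewrite da c2 (K_bc rel) !linear0 mul0r mulr0 !add0r.
  suff -> : d * d = a * a by [].
  by rewrite dE !mulrA a4 mul1r.
Qed.

(** The contraction phi(h_(1)) h_(2) psi(h_(3)) in K, read off the iterated coproduct of
    K^cop.  When p(v h w) is a sum of products of functionals of v, h and w, the
    cross relation of the double expresses h p through such contractions. *)
Definition coadjoint (phi psi : 'Hom(K, k^o)) (h : K) : K :=
  \sum_(t <- comul3 (cop hK) h) (phi t.2 * psi t.1.1) *: t.1.2.

Lemma coadjoint_gens phi psi :
  [/\ coadjoint phi psi a = (phi a * psi a) *: a + (phi a * psi c) *: b
                          + (phi b * psi a) *: c + (phi b * psi c) *: d
    & coadjoint phi psi c = (phi c * psi a) *: a + (phi c * psi c) *: b
                          + (phi d * psi a) *: c + (phi d * psi c) *: d].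
Proof.
have E (r : 'Hom(K, k^o)) h : r (coadjoint phi psi h) = conv hK (conv hK phi r) psi h.
  rewrite -(comul3_cop_sum hP) linear_sum; apply: eq_bigr => t _.
  by rewrite linearZ.
split; apply: eq_functionals => r; rewrite E;
have [Ea Eb Ec Ed] := conv_gens (conv hK phi r) psi; rewrite ?Ea ?Ec;
have [Fa Fb Fc Fd] := conv_gens phi r; rewrite ?Fa ?Fb ?Fc ?Fd;
rewrite !linearD !linearZ /= /GRing.scale /=; ring.
Qed.

Variables (G X : 'Hom(K, k^o)).
Hypothesis GX1 : G 1 = 1 /\ X 1 = 0.
Hypothesis GM : forall u v : K, G (u * v) = G u * G v.
Hypothesis XM : forall u v : K, X (u * v) = eps u * X v + X u * G v.
Hypothesis Ggens : [/\ G a = - xi, G b = 0, G c = 0 & G d = xi].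
Hypothesis Xgens : [/\ X a = 0, X b = 1, X c = 1 & X d = 0].

Local Notation "p ** q" := (conv (cop hK) p q) (at level 40, left associativity).

Lemma conv_cop_monomials p q :
 (((p ** q) 1 = q 1 * p 1)%R
  * ((p ** q) a = q a * p a + q (a * a * c) * p c)%R
  * ((p ** q) (a * a) = q (a * a) * p (a * a))%R
  * ((p ** q) (a * a * a) = q c * p (a * a * c) + q (a * a * a) * p (a * a * a))%R
  * ((p ** q) c = q c * p a + q (a * a * a) * p c)%R
  * ((p ** q) (a * c) = q (a * c) * p (a * a) + q 1 * p (a * c))%R
  * ((p ** q) (a * a * c) = q a * p (a * a * c) + q (a * a * c) * p (a * a * a))%R
  * ((p ** q) (a * a * a * c) =
     q (a * a * a * c) * p 1 + q (a * a) * p (a * a * a * c))%R)%type.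
Proof.
have [E1 E2 E3 E4] := conv_monomials q p.
have [F1 F2 F3 F4] := conv_gens q p.
have bE := K_bE rel; have dE := K_dE rel.
rewrite !(conv_cop hK); rewrite -bE -dE.
by do !split=> //; rewrite -?dE in E4 *.
Qed.

Let epsE := counit_gens xi2 hKP.

Lemma functional_eq8 (p q : 'Hom(K, k^o)) :
  [/\ p 1 = q 1, p a = q a, p (a * a) = q (a * a) & p (a * a * a) = q (a * a * a)] ->
  [/\ p c = q c, p (a * c) = q (a * c), p (a * a * c) = q (a * a * c)
    & p (a * a * a * c) = q (a * a * a * c)] -> p = q.
Proof.
move=> [? ? ? ?] [? ? ? ?]; apply: (K_functional_eq xi2 pres) => v.
by rewrite !inE; do 7?[case/orP] => /eqP->.
Qed.

Lemma eps_values :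
  (((eps 1 = 1)%R * (eps a = 1)%R * (eps c = 0)%R) *
   ((G 1 = 1)%R * (X 1 = 0)%R * (G a = - xi)%R * (G c = 0)%R) *
   ((X a = 0)%R * (X c = 1)%R))%type.
Proof.
have [ea eb ec ed] := epsE; have [G1 X1] := GX1.
have [Ga _ Gc _] := Ggens; have [Xa _ Xc _] := Xgens.
by do !split => //; apply: counit1.
Qed.

Let evalE := (add_lfunE, opp_lfunE, scale_lfunE, conv_cop_monomials, GM, XM,
              counitM hP, eps_values).

(** Two functionals are compared on the eight words, where products of functionals
    are evaluated by the coproduct. *)
Ltac eval8 := apply: functional_eq8; split;
  rewrite /GRing.scale /= ?evalE /GRing.scale /= ?evalE.

Lemma dual_GX : G ** X = - (X ** G).
Proof. eval8; by ring: xi2. Qed.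

Lemma dual_X2 : X ** X = 2^-1 *: (eps - G ** G).
Proof. eval8; by field: xi2. Qed.

Lemma dual_G4 : (G ** G) ** (G ** G) = eps.
Proof. eval8; by ring: xi2. Qed.

(** On the words without c the powers of G are the characters of a cyclic group of
    order 4 and the products G^i X vanish; on the words with c it is the other
    way round.  So the coefficients are given by the inverse discrete Fourier
    transform. *)
Lemma dual_span p : exists l m : k * k * k * k,
  p = l.1.1.1 *: eps + l.1.1.2 *: G + l.1.2 *: (G ** G) + l.2 *: ((G ** G) ** G)
    + (m.1.1.1 *: X + m.1.1.2 *: (G ** X) + m.1.2 *: ((G ** G) ** X)
    + m.2 *: ((G ** G) ** (G ** X))).
Proof.
(* the words with c are listed in the order that makes the products G^i X
characters *)
pose F (p0 p1 p2 p3 : k) := ((p0 + p1 + p2 + p3) / 4%:R, (p0 + xi * p1 - p2 - xi * p3) / 4%:R,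
  (p0 - p1 + p2 - p3) / 4%:R, (p0 - xi * p1 - p2 + xi * p3) / 4%:R).
exists (F (p 1) (p a) (p (a * a)) (p (a * a * a))).
exists (F (p (a * a * a * c)) (p c) (p (a * c)) (p (a * a * c))).
have four : 4%:R != 0 :> k by rewrite (natrM _ 2 2) mulf_neq0.
rewrite /F; eval8; by field: xi2.
Qed.

End DoubleK.

(** * Generators and relations of the double *)

Section DoubleRelations.
Variables (k : fieldType) (xi : k).
Hypothesis xi2 : xi * xi = -1.
Hypothesis two_neq0 : 2 != 0 :> k.
Variables (K : falgType k) (hK : hopf_data K) (a b c d : K).
Hypothesis hKP : is_hopf_K xi hK a b c d.
Variable D : falgType k.
Hypothesis hD : is_drinfeld_double (cop hK) D.

(** The relations among the functionals hold in the dual of K.  The cross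
    relations follow from the shape of the functionals: since G is multiplicative
    and X is a skew derivation, the functional p(S^-1(h_(3)) ? h_(1)) is a
    multiple of G for p = G, and a combination of the unit, X and G for p = X. *)
Lemma double_relations : exists A C g x : D,
  [/\ [/\ A * A * A * A = 1, C * C = 0 & A * C = xi *: (C * A)],
      [/\ g * g * g * g = 1, x * x = 2^-1 *: (1 - g * g) & g * x = - (x * g)],
      A * g = g * A /\ C * g = - (g * C),
      A * x = - xi *: (x * A) + A * A * C + g * C /\
      C * x = - xi *: (x * C) + A * A * A - g * A
    & \dim {:D} = 64%N /\
      forall L : {vspace D}, 1 \in L ->
        (forall v, v \in L -> [/\ A * v \in L, C * v \in L, g * v \in L & x * v \in L]) ->
      L = fullv].
Proof.
have pres := K_pres hKP; have hP := K_hopf hKP.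
have rel : K_relations xi a b c d by case: pres.
have [iota [kappa [k1 kM basis cross]]] := hD.
have [G [X [GX1 GM XM Ggens Xgens]]] := K_functionals xi2 hKP.
have [Sa Sb Sc Sd] := antipode_gens xi2 hKP.
have [ea eb ec ed] := counit_gens xi2 hKP.
have {Sb} Sb : antipode hK b = xi *: b.
  rewrite Sb -mulrA (K_ba xi2 rel) -scalerAr mulrA -(K_ad_da rel) (K_ad rel) mul1r.
  by rewrite scaleNr opprK.
have {Sc} Sc : antipode hK c = - xi *: c.
  by rewrite Sc -mulrA (K_cd rel) -scalerAr mulrA (K_ad rel) mul1r scaleNr.
have [G1 X1] := GX1; have [Ga Gb Gc Gd] := Ggens; have [Xa Xb Xc Xd] := Xgens.
have bE := K_bE rel; have dE := K_dE rel; have a4 := K_a4E rel.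
have coadj := coadjoint_gens hKP.
have crossG h : iota h * kappa G =
    kappa G * iota (coadjoint hK (G \o antipode hK)%VF G h).
  rewrite cross /coadjoint linear_sum mulr_sumr; apply: eq_bigr => t _ /=.
  rewrite [X in kappa X](_ : _ = ((G \o antipode hK)%VF t.2 * G t.1.1) *: G).
    by rewrite !linearZ /= -scalerAl -scalerAr.
  by apply/lfunP => v; rewrite scale_lfunE !comp_lfunE !lfunE /= !GM /GRing.scale /=; ring.
have crossX h : iota h * kappa X =
    iota (coadjoint hK (counit hK \o antipode hK)%VF X h)
    + kappa X * iota (coadjoint hK (counit hK \o antipode hK)%VF G h)
    + kappa G * iota (coadjoint hK (X \o antipode hK)%VF G h).
  rewrite cross /coadjoint !linear_sum !mulr_sumr -!big_split; apply: eq_bigr => t _ /=.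
  rewrite [Y in kappa Y](_ : _ =
      ((counit hK \o antipode hK)%VF t.2 * X t.1.1) *: counit hK
    + ((counit hK \o antipode hK)%VF t.2 * G t.1.1) *: X
    + ((X \o antipode hK)%VF t.2 * G t.1.1) *: G).
    by rewrite !linearD !linearZ /= k1 !mulrDl -!scalerAl -!scalerAr mul1r.
  apply/lfunP => v; rewrite !add_lfunE !scale_lfunE !comp_lfunE !lfunE /= !XM !GM.
  by rewrite /GRing.scale /=; ring.
have hZ (h : 'Hom(K, k^o)) s v : h (s *: v) = s * h v by rewrite linearZ.
have iZ s v : iota (s *: v) = s *: iota v by rewrite linearZ.
have GS : (((G \o antipode hK)%VF a = xi) * ((G \o antipode hK)%VF b = 0)
  * ((G \o antipode hK)%VF c = 0) * ((G \o antipode hK)%VF d = - xi))%type.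
  by rewrite !comp_lfunE Sa Sb Sc Sd !hZ Gd Gb Gc Ga ?mulr0.
have XS : (((X \o antipode hK)%VF a = 0) * ((X \o antipode hK)%VF b = xi)
  * ((X \o antipode hK)%VF c = - xi) * ((X \o antipode hK)%VF d = 0))%type.
  by rewrite !comp_lfunE Sa Sb Sc Sd !hZ Xd Xb Xc Xa ?mulr1.
have ES : (((counit hK \o antipode hK)%VF a = 1) * ((counit hK \o antipode hK)%VF b = 0)
  * ((counit hK \o antipode hK)%VF c = 0) * ((counit hK \o antipode hK)%VF d = 1))%type.
  rewrite !comp_lfunE Sa Sb Sc Sd !hZ.
  by rewrite ed eb ec ea ?mulr0.
exists (iota a), (iota c), (kappa G), (kappa X); split; try split.
- by rewrite -!rmorphM a4 rmorph1.
- by rewrite -rmorphM -expr2 (K_c2 rel) rmorph0.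
- by rewrite -!rmorphM (K_ac rel) /= linearZ.
- by rewrite -mulrA -!kM (dual_G4 xi2 hKP GX1 GM Ggens Xgens) k1.
- by rewrite -!kM (dual_X2 xi2 two_neq0 hKP GX1 GM XM Ggens Xgens) linearZ linearB /= k1.
- by rewrite -!kM (dual_GX xi2 hKP GX1 GM XM Ggens Xgens) linearN.
- by rewrite crossG (coadj _ _).1 !GS Ga Gc !(mulr0, mul0r, scaler0, scale0r, addr0, add0r, mul1r, mulr1, scale1r,
    mulrN, mulNr, xi2, opprK).
- by rewrite crossG (coadj _ _).2 !GS Ga Gc !(mulr0, mul0r, scaler0, scale0r, addr0, add0r, mul1r, mulr1, scale1r,
    mulrN, mulNr, xi2, opprK) scaleN1r linearN mulrN.
- rewrite crossX !(coadj _ _).1 !ES !XS Xa Xc Ga Gc !(mulr0, mul0r, scaler0, scale0r, addr0, add0r, mul1r, mulr1, scale1r,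
    mulrN, mulNr, xi2, opprK) bE iZ -scalerAr !rmorphM.
  by congr (_ + _); rewrite addrC.
- rewrite crossX !(coadj _ _).2 !ES !XS Xa Xc Ga Gc !(mulr0, mul0r, scaler0, scale0r, addr0, add0r, mul1r, mulr1, scale1r,
    mulrN, mulNr, xi2, opprK) dE iZ -scalerAr !rmorphM.
 by rewrite !scaleN1r linearN mulrN; congr (_ + _); rewrite addrC.
- have := basis _ _ (vbasisP fullv) (vbasisP fullv).
  move=> /(@size_basis _ _ _ _ (in_tuple _)) ->; rewrite size_allpairs !size_tuple.
  rewrite (K_dim hKP); have -> : \dim {:'Hom(K, k^o)} = 8%N; last by [].
  by rewrite dimvf /dim /= -dimvf (K_dim hKP) muln1.
move=> L L1 Lst.
(* the elements whose left multiplication preserves L form a subalgebra; it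
contains K and its dual, and together these span D *)
pose T (v : D) := forall w, w \in L -> v * w \in L.
have TZ s v : T v -> T (s *: v) by move=> Tv w /Tv; rewrite -scalerAl; apply: rpredZ.
have TD u v : T u -> T v -> T (u + v).
  by move=> Tu Tv w wL; rewrite mulrDl rpredD ?Tu ?Tv.
have TM u v : T u -> T v -> T (u * v) by move=> Tu Tv w wL; rewrite -mulrA; apply/Tu/Tv.
have T1 : T 1 by move=> w; rewrite mul1r.
have [TA TC Tg Tx] : [/\ T (iota a), T (iota c), T (kappa G) & T (kappa X)].
  by split=> w /Lst[].
have Tout v : T v -> v \in L by move/(_ _ L1); rewrite mulr1.
clearbody T.
have Tiota h : T (iota h).
  have := memvf h; rewrite -(K_span xi2 pres) => /(@coord_span _ _ _ (in_tuple _)) ->.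
  rewrite (linear_sum iota).
  apply: (big_ind T) => [|u v|i _]; [by rewrite -(scale0r 1); apply: TZ | exact: TD|].
  rewrite linearZ /=; apply: TZ.
  have : (K_monomials a c)`_i \in K_monomials a c by rewrite mem_nth.
  have TA2 := TM _ _ TA TA; have TA3 := TM _ _ TA2 TA.
  rewrite !inE; do 7?[case/orP] => /eqP->; rewrite ?rmorph1 ?rmorphM;
  by first [exact: TM _ _ TA3 TC | exact: TM _ _ TA2 TC | exact: TM _ _ TA TC | done].
have Tkappa p : T (kappa p).
  have [l [m ->]] := dual_span xi2 two_neq0 hKP GX1 GM XM Ggens Xgens p.
  rewrite !linearD !linearZ /= !kM k1.
  have Tg2 := TM _ _ Tg Tg.
  by repeat apply: (TD); apply: (TZ) => //; repeat apply: (TM).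
apply/eqP; rewrite eqEsubv subvf.
have := basis _ _ (vbasisP fullv) (vbasisP fullv); move/span_basis <-.
apply/span_subvP => _ /allpairsP[[p h] /= [_ _ ->]].
by apply/Tout/TM.
Qed.

End DoubleRelations.

(** Vectors are compared through their values under functionals, which turns a
    linear identity between vectors into an identity of scalars.  The functional
    appears as a plain additive function, so that only its own laws are used to
    expand these values. *)
Lemma eq_scalar_tests (k : fieldType) (V : vectType k) (v w : V) :
  (forall r : V -> k, (forall s t, r (s + t) = r s + r t) ->
     (forall s, r (- s) = - r s) -> (forall (e : k) s, r (e *: s) = e * r s) ->
     r 0 = 0 -> r v = r w) -> v = w.
Proof.
move=> H; apply: eq_functionals => r.
by apply: H => [s t|s|e s|]; rewrite ?linearD ?linearN ?linearZ ?linear0.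
Qed.

(** The scalar of order 4 is a ring element q, so that the same relations make
    sense in D and in matrices over an extension of the scalars. *)
Record double_rel (R : pzRingType) (q a g u y : R) : Prop := DoubleRel {
  dr_a4 : a * a * a * a = 1;
  dr_g4 : g * g * g * g = 1;
  dr_ag : a * g = g * a;
  dr_au : a * u = q * (u * a);
  dr_ay : a * y = - (q * (y * a));
  dr_gu : g * u = - (u * g);
  dr_gy : g * y = - (y * g);
  dr_uu : u * u = 0;
  dr_yy : y * y = 0;
  dr_yu : y * u = u * y + (g - a * a)
}.

(** The square of x is (1 - g^2) / 2 and not zero, but A x + xi x A and C x + xi x C
    contain only words without x; hence a suitable multiple of C (A + g A^3),
    subtracted from x, makes the square vanish.  All identities are checked by
    moving the letters into the order g, A, C, then x or y. *)
Lemma straighten (k : fieldType) (xi : k) (xi2 : xi * xi = -1) (two_neq0 : 2 != 0 :> k)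
    (D : falgType k) (A C g x : D) :
  A * A * A * A = 1 -> C * C = 0 -> A * C = xi *: (C * A) ->
  g * g * g * g = 1 -> x * x = 2^-1 *: (1 - g * g) -> g * x = - (x * g) ->
  A * g = g * A -> C * g = - (g * C) ->
  A * x = - xi *: (x * A) + A * A * C + g * C ->
  C * x = - xi *: (x * C) + A * A * A - g * A ->
  double_rel xi%:A A g (A * A * A * C) (x - (xi / 2) *: (C * (A + g * A * A * A))).
Proof.
move=> A4 CC AC g4 xx gx Ag Cg Ax Cx.
have sA (s : k) (v w : D) : (s *: v) * w = s *: (v * w) by rewrite -scalerAl.
have As (s : k) (v w : D) : v * (s *: w) = s *: (v * w) by rewrite -scalerAr.
have CA : C * A = - xi *: (A * C) by rewrite AC scalerA mulNr xi2 opprK scale1r.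
have xg : x * g = - (g * x) by rewrite gx opprK.
have xA : x * A = xi *: (A * x) - xi *: (A * A * C) - xi *: (g * C).
  by apply: eq_scalar_tests => r rD rN rZ r0; rewrite Ax !(rD, rN, rZ); ring: xi2.
have xC : x * C = xi *: (C * x) - xi *: (A * A * A) + xi *: (g * A).
  by apply: eq_scalar_tests => r rD rN rZ r0; rewrite Cx !(rD, rN, rZ); ring: xi2.
(* each rewriting rule is also needed behind a prefix, since products
associate to the left *)
have pre (u v w : D) : u * v = w -> forall p, p * u * v = p * w.
  by move=> uv p; rewrite -mulrA uv.
have pAg := pre _ _ _ Ag; have pCg := pre _ _ _ Cg; have pCA := pre _ _ _ CA.
have pxg := pre _ _ _ xg; have pxA := pre _ _ _ xA; have pxC := pre _ _ _ xC.
have pxx := pre _ _ _ xx; have pCC := pre _ _ _ CC.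
have pA4 p : p * A * A * A * A = p by rewrite -!mulrA [A * _]mulrA [A * A * _]mulrA A4 mulr1.
have pg4 p : p * g * g * g * g = p by rewrite -!mulrA [g * _]mulrA [g * g * _]mulrA g4 mulr1.
have norm := (@mulrDl D, @mulrDr D, @mulNr D, @mulrN D, sA, As, @mul1r D, @mulr1 D,
  @mulrA D, @mulr0 D, @mul0r D).
have rules := (A4, pA4, g4, pg4, Ag, pAg, Cg, pCg, CA, pCA, CC, pCC).
set y := x - _.
have yA : y * A = xi *: (A * y).
  apply: eq_scalar_tests => r rD rN rZ r0; rewrite /y !norm !(xA, rules, norm).
  by rewrite ?(rD, rN, rZ, r0); field: xi2.
have yg : y * g = - (g * y).
  apply: eq_scalar_tests => r rD rN rZ r0; rewrite /y !norm !(xg, rules, norm).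
  by rewrite ?(rD, rN, rZ, r0); field: xi2.
have yC : y * C = xi *: (C * y) - xi *: (A * A * A) + xi *: (g * A).
  apply: eq_scalar_tests => r rD rN rZ r0; rewrite /y !norm !(xC, rules, norm).
  by rewrite ?(rD, rN, rZ, r0); field: xi2.
have pyA := pre _ _ _ yA; have pyg := pre _ _ _ yg; have pyC := pre _ _ _ yC.
have rules2 := (yA, pyA, yg, pyg, yC, pyC).
have yy : y * y = 0.
  rewrite {2}/y mulrBr As !norm.
  apply: eq_scalar_tests => r rD rN rZ r0.
  rewrite ?(rules2, rules, norm).
  rewrite /y ?norm ?(xA, pxA, xC, pxC, xg, pxg, xx, rules, norm).
  by rewrite ?(rD, rN, rZ, r0); field: xi2.
clearbody y.
split=> //.
all: apply: eq_scalar_tests => r rD rN rZ r0.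
all: rewrite ?norm ?(rules2, rules, norm).
all: by rewrite ?(rD, rN, rZ, r0); ring: xi2.
Qed.

Section DoubleAlgebra.
Variables (k : fieldType) (xi : k).
Hypothesis xi2 : xi * xi = -1.
Hypothesis two_neq0 : 2 != 0 :> k.
Variables (K : falgType k) (hK : hopf_data K) (a b c d : K).
Hypothesis hKP : is_hopf_K xi hK a b c d.
Variable D : falgType k.
Hypothesis hD : is_drinfeld_double (cop hK) D.

Lemma double_generators : exists a g u y : D,
  [/\ double_rel xi%:A a g u y, \dim {:D} = 64%N
    & forall L : {vspace D}, 1 \in L ->
        (forall v, v \in L -> [/\ a * v \in L, g * v \in L, u * v \in L & y * v \in L]) ->
      L = fullv].
Proof.
have [A [C [g [x [[A4 CC AC] [g4 xx gx] [Ag Cg] [Ax Cx] [dimD gen]]]]]] :=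
  double_relations xi2 two_neq0 hKP hD.
have rel := straighten xi2 two_neq0 A4 CC AC g4 xx gx Ag Cg Ax Cx.
exists A, g, (A * A * A * C), (x - (xi / 2) *: (C * (A + g * A * A * A))).
split=> // L L1 st; apply: gen => // v vL.
have AL w : w \in L -> A * w \in L by move=> /st[].
have gL w : w \in L -> g * w \in L by move=> /st[].
have CL w : w \in L -> C * w \in L.
  by move=> /st[_ _ + _] => /AL; rewrite !mulrA A4 mul1r.
split; [exact: AL | exact: CL | exact: gL |].
have [_ _ _] := st v vL; rewrite mulrBl -scalerAl => yv.
rewrite -[x * v](subrK ((xi / 2) *: (C * (A + g * A * A * A) * v))).
apply: rpredD => //; apply: rpredZ; rewrite -mulrA; apply: CL; rewrite mulrDl -!mulrA.
apply: rpredD; first exact: AL.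
by apply: gL; do 3!apply: (AL).
Qed.

End DoubleAlgebra.

(** * The monomial basis and the presentation of the double *)

Section PBWWords.
Variables (R : pzRingType) (q a g u y : R).
Hypothesis qC : forall v, q * v = v * q.
Hypothesis q2 : q * q = -1.
Hypothesis rel : double_rel q a g u y.

Definition pbw (s i j : nat) : R := [:: 1; u; y; u * y]`_s * a ^+ i * g ^+ j.

Lemma pbwE i j :
  ((pbw 0 i j = 1 * a ^+ i * g ^+ j)%R * (pbw 1 i j = u * a ^+ i * g ^+ j)%R
  * (pbw 2 i j = y * a ^+ i * g ^+ j)%R * (pbw 3 i j = u * y * a ^+ i * g ^+ j)%R)%type.
Proof. by []. Qed.

(** The scalar by which a, respectively g, passes the factor 1, u, y or uy. *)
Definition pbw_a s : R := [:: 1; q; - q; 1]`_s.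
Definition pbw_g s : R := [:: 1; -1; -1; 1]`_s.

Lemma pbw_mod s i j : pbw s (i %% 4) (j %% 4) = pbw s i j.
Proof.
have E4 z n : z * z * z * z = 1 -> z ^+ (n %% 4) = z ^+ n :> R.
  move=> z4; rewrite [in RHS](divn_eq n 4) exprD mulnC exprM.
  by rewrite (_ : z ^+ 4 = 1) ?expr1n ?mul1r // !exprS expr0 mulr1 !mulrA.
by rewrite /pbw !E4 ?(dr_a4 rel) ?(dr_g4 rel).
Qed.

Lemma pbw_a2y : a * a * y = - (y * a * a).
Proof.
rewrite -mulrA (dr_ay rel) mulrN mulrA -qC -mulrA [a * (y * a)]mulrA (dr_ay rel).
by rewrite mulNr mulrN opprK -!mulrA [q * (q * _)]mulrA q2 mulN1r !mulrA.
Qed.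

Lemma pbw_gj i j : g * (a ^+ i * g ^+ j) = a ^+ i * g ^+ j.+1.
Proof.
have /commrX C : GRing.comm g a by rewrite /GRing.comm (dr_ag rel).
by rewrite mulrA C -mulrA -exprS.
Qed.

Lemma pbw_mul_a s i j : (s < 4)%N -> a * pbw s i j = pbw_a s * pbw s i.+1 j.
Proof.
have E (w : R) r : a * w = r * (w * a) -> a * (w * a ^+ i * g ^+ j) = r * (w * a ^+ i.+1 * g ^+ j).
  by move=> aw; rewrite exprS !mulrA aw !mulrA.
rewrite /pbw /pbw_a; case: s => [|[|[|[|//]]]] _ /=; apply: E.
- by rewrite mulr1 !mul1r.
- exact: dr_au rel.
- by rewrite (dr_ay rel) mulNr.
- rewrite mul1r mulrA (dr_au rel) -!mulrA (dr_ay rel) !mulrN (mulrA u q) -qC -mulrA.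
  by rewrite (mulrA q q) q2 mulN1r opprK.
Qed.

Lemma pbw_mul_g s i j : (s < 4)%N -> g * pbw s i j = pbw_g s * pbw s i j.+1.
Proof.
have E (w : R) r : g * w = r * (w * g) -> g * (w * a ^+ i * g ^+ j) = r * (w * a ^+ i * g ^+ j.+1).
  by move=> gw; rewrite -!mulrA -pbw_gj !mulrA gw !mulrA.
rewrite /pbw /pbw_g; case: s => [|[|[|[|//]]]] _ /=; apply: E.
- by rewrite mulr1 !mul1r.
- by rewrite (dr_gu rel) mulN1r.
- by rewrite (dr_gy rel) mulN1r.
- by rewrite mul1r mulrA (dr_gu rel) mulNr -mulrA (dr_gy rel) mulrN opprK mulrA.
Qed.

Lemma pbw_mul_u i j :
  [/\ u * pbw 0 i j = pbw 1 i j, u * pbw 1 i j = 0,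
      u * pbw 2 i j = pbw 3 i j & u * pbw 3 i j = 0].
Proof. by rewrite /pbw /= !mulrA mulr1 (dr_uu rel) !mul0r. Qed.

Lemma pbw_mul_y i j :
  [/\ y * pbw 0 i j = pbw 2 i j,
      y * pbw 1 i j = pbw 3 i j + (pbw 0 i j.+1 - pbw 0 i.+2 j),
      y * pbw 2 i j = 0
    & y * pbw 3 i j = pbw 2 i.+2 j - pbw 2 i j.+1].
Proof.
have a2 : a ^+ i.+2 = a * a * a ^+ i by rewrite !exprS mulrA.
rewrite !pbwE a2 !mulrA mulr1 (dr_yy rel) !mul0r !mul1r; split=> //.
  by rewrite (dr_yu rel) !mulrDl !mulNr -(mulrA g) pbw_gj.
rewrite (dr_yu rel) !mulrDl -(mulrA u) (dr_yy rel) mulr0 !mul0r add0r !mulNr.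
rewrite (dr_gy rel) pbw_a2y !mulNr opprK addrC.
by rewrite -(mulrA (y * g)) -(mulrA y g) pbw_gj !mulrA.
Qed.

End PBWWords.

Lemma basis_coordinates (k : fieldType) (V : vectType k) (I : finType) (e : I -> V) :
  basis_of fullv (codom e) ->
  exists cf : I -> V -> k,
    [/\ forall t s v w, cf t (s *: v + w) = s * cf t v + cf t w,
        forall t t', cf t (e t') = (t == t')%:R
      & forall v, v = \sum_t cf t v *: e t].
Proof.
move=> eb; pose X := codom_tuple e.
have Xe (t : I) : X`_(enum_rank t) = e t by rewrite /X /= nth_codom enum_rankK.
exists (fun t v => coord X (enum_rank t) v); split.
- by move=> t s v w; rewrite linearP.
- move=> t t'; rewrite -Xe coord_free ?(basis_free eb) //.
  by rewrite (inj_eq enum_rank_inj) eq_sym.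
- move=> v; rewrite {1}(coord_basis (X := X) eb (memvf v)).
  rewrite (reindex (@enum_rank I)) /=; last exact/onW_bij/enum_rank_bij.
  by apply: eq_bigr => t _; rewrite Xe.
Qed.

Section Presentation.
Variables (k : fieldType) (xi : k).
Hypothesis xi2 : xi * xi = -1.
Variables (D : falgType k) (a g u y : D).
Hypothesis rel : double_rel xi%:A a g u y.
Hypothesis dimD : \dim {:D} = 64%N.
Hypothesis gen : forall L : {vspace D}, 1 \in L ->
  (forall v, v \in L -> [/\ a * v \in L, g * v \in L, u * v \in L & y * v \in L]) ->
  L = fullv.

Local Notation E := (pbw a g u y).
Let I := ('I_4 * 'I_4 * 'I_4)%type.
Let e (t : I) : D := E t.1.1 t.1.2 t.2.

Let qC (v : D) : xi%:A * v = v * xi%:A.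
Proof. by rewrite -scalerAl -scalerAr mul1r mulr1. Qed.
Let q2 : xi%:A * xi%:A = -1 :> D.
Proof. by rewrite -scalerAl mul1r scalerA xi2 scaleN1r. Qed.

Let E_span s i j : (s < 4)%N -> exists t : I, E s i j = e t.
Proof.
move=> s4; have lt n : (n %% 4 < 4)%N by rewrite ltn_mod.
by exists (Ordinal s4, Ordinal (lt i), Ordinal (lt j)); rewrite /e /= (pbw_mod rel).
Qed.

(** The span of the 64 words contains 1 and is stable under left multiplication
    by the generators, hence is D; as D has dimension 64, the words are
    independent. *)
Lemma pbw_basis : basis_of fullv (codom e).
Proof.
suff sp : <<codom e>>%VS = fullv.
  by rewrite basisEdim sp subvv dimD size_codom !card_prod !card_ord.
have mE s i j : (s < 4)%N -> E s i j \in <<codom e>>%VS.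
  by move=> /(E_span i j)[t ->]; apply/memv_span/codom_f.
apply: gen.
  by have := mE 0%N 0%N 0%N isT; rewrite /pbw /= !mulr1.
have stab z : (forall s i j, (s < 4)%N -> z * E s i j \in <<codom e>>%VS) ->
    forall v, v \in <<codom e>>%VS -> z * v \in <<codom e>>%VS.
  move=> H v /(memv_img (amull z)); rewrite lfunE; apply: subvP.
  rewrite limg_span; apply/span_subvP => _ /mapP[_ /codomP[t ->] ->].
  by rewrite lfunE; apply: H.
have scal (s : nat) : exists r r' : k, pbw_a (xi%:A : D) s = r%:A /\ pbw_g D s = r'%:A.
  rewrite /pbw_a /pbw_g; case: s => [|[|[|[|s]]]] /=.
  - by exists 1, 1; rewrite !scale1r.
  - by exists xi, (-1); rewrite scaleN1r.
  - by exists (- xi), (-1); rewrite scaleN1r scaleNr.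
  - by exists 1, 1; rewrite !scale1r.
  - by exists 0, 0; rewrite !scale0r !nth_nil.
move=> v vL; split; apply: stab vL => s i j s4.
- rewrite (pbw_mul_a qC q2 rel) //; have [r [_ [-> _]]] := scal s.
  by rewrite -scalerAl mul1r rpredZ ?mE.
- rewrite (pbw_mul_g rel) //; have [_ [r [_ ->]]] := scal s.
  by rewrite -scalerAl mul1r rpredZ ?mE.
- have [E0 E1 E2 E3] := pbw_mul_u rel i j.
  by case: s s4 => [|[|[|[|//]]]] _; rewrite ?(E0, E1, E2, E3) ?mem0v ?mE.
- have [E0 E1 E2 E3] := pbw_mul_y qC q2 rel i j.
  case: s s4 => [|[|[|[|//]]]] _; rewrite ?(E0, E1, E2, E3).
  + exact: mE.
  + by apply: rpredD; [|apply: rpredB]; apply: (mE).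
  + exact: mem0v.
  + by apply: rpredB; apply: (mE).
Qed.

(** Generation of D as an induction principle; it reduces statements about
    submodules and module maps to the four generators. *)
Lemma double_ind (P : D -> Prop) :
  P 1 -> (forall s v w, P v -> P w -> P (s *: v + w)) ->
  (forall v w, P v -> P w -> P (v * w)) ->
  P a -> P g -> P u -> P y -> forall v, P v.
Proof.
move=> P1 PL PM Pa Pg Pu Py v.
have P0 : P 0 by have := PL (-1) 1 1 P1 P1; rewrite scaleN1r addNr.
have PX z n : P z -> P (z ^+ n).
  by move=> Pz; elim: n => [|n IH]; rewrite ?expr0 // exprS; apply: PM.
have [cf [_ _ cfS]] := basis_coordinates pbw_basis; rewrite (cfS v).
elim: (index_enum _) => [|t r IH]; first by rewrite big_nil.
rewrite big_cons; apply: PL IH; case: t => [[s i] j]; rewrite /e /pbw /=.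
apply: (PM); last exact: PX; apply: (PM); last exact: PX.
by case: s => [[|[|[|[|//]]]] hs] //=; apply: PM.
Qed.

(** A matrix solution of the relations is extended linearly from the words to D.
    Left multiplication of words by generators is given by the same formulas on
    both sides, because these formulas use the relations only; this gives
    multiplicativity for a generator on the left, and then in general. *)
Lemma double_presentation (R : comNzRingType) (nu : {rmorphism k -> R}) (n : nat)
    (A G U Y : 'M[R]_n) :
  double_rel ((nu xi)%:M : 'M[R]_n) A G U Y ->
  exists rho : D -> 'M[R]_n, is_repr nu rho /\
    [/\ rho a = A, rho g = G, rho u = U & rho y = Y].
Proof.
move=> relM; have [cf [cfL cfE cfS]] := basis_coordinates pbw_basis.
pose F := pbw A G U Y.
have QC (v : 'M[R]_n) : (nu xi)%:M * v = v * (nu xi)%:M.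
  by rewrite -!mulmxE scalar_mxC.
have Q2 : (nu xi)%:M * (nu xi)%:M = -1 :> 'M[R]_n.
  by rewrite -mulmxE -scalar_mxM -rmorphM xi2 rmorphN1 raddfN.
pose rho (v : D) : 'M[R]_n := \sum_t nu (cf t v) *: F t.1.1 t.1.2 t.2.
have rhoL s v w : rho (s *: v + w) = nu s *: rho v + rho w.
  rewrite /rho scaler_sumr -big_split /=; apply: eq_bigr => t _.
  by rewrite cfL rmorphD rmorphM scalerDl scalerA.
have rhoe t : rho (e t) = F t.1.1 t.1.2 t.2.
  rewrite /rho (bigD1 t) //= cfE eqxx rmorph1 scale1r big1 ?addr0 // => t' tt'.
  by rewrite cfE (negbTE tt') rmorph0 scale0r.
have rhoE s i j : (s < 4)%N -> rho (E s i j) = F s i j.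
  move=> s4; have lt m : (m %% 4 < 4)%N by rewrite ltn_mod.
  have := rhoe (Ordinal s4, Ordinal (lt i), Ordinal (lt j)).
  by rewrite /e /= (pbw_mod rel) /F (pbw_mod relM).
have rho0 : rho 0 = 0.
  by have := rhoL (-1) 1 1; rewrite scaleN1r addNr rmorphN1 scaleN1r addNr.
have rhoD v w : rho (v + w) = rho v + rho w.
  by have := rhoL 1 v w; rewrite rmorph1 !scale1r.
have rhoZ s v : rho (s *: v) = nu s *: rho v.
  by have := rhoL s v 0; rewrite rho0 !addr0.
have rhoN v : rho (- v) = - rho v by rewrite -scaleN1r rhoZ rmorphN1 scaleN1r.
have rho1 : rho 1 = 1.
  by have := rhoE 0%N 0%N 0%N isT; rewrite /F /pbw /= !mulr1.
have rhoa : rho a = A.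
  by have := rhoE 0%N 1%N 0%N isT; rewrite /F /pbw /= !mulr1 !mul1r.
have rhog : rho g = G.
  by have := rhoE 0%N 0%N 1%N isT; rewrite /F /pbw /= !mulr1 !mul1r.
have rhou : rho u = U.
  by have := rhoE 1%N 0%N 0%N isT; rewrite /F /pbw /= !mulr1.
have rhoy : rho y = Y.
  by have := rhoE 2%N 0%N 0%N isT; rewrite /F /pbw /= !mulr1.
have onbasis z : (forall s i j, (s < 4)%N -> rho (z * E s i j) = rho z * F s i j) ->
    forall v, rho (z * v) = rho z * rho v.
  move=> H v; rewrite (cfS v) mulr_sumr.
  rewrite !(big_morph rho rhoD rho0) mulr_sumr; apply: eq_bigr => t _.
  by rewrite -scalerAr !rhoZ H // rhoe -mulmxE -scalemxAr.
have rhoM v : forall w, rho (v * w) = rho v * rho w.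
  elim/double_ind: v => [w|s v v' Pv Pv' w|v v' Pv Pv' w||||].
  - by rewrite rho1 !mul1r.
  - by rewrite mulrDl -scalerAl !rhoL Pv Pv' mulrDl -!mulmxE -scalemxAl.
  - by rewrite -mulrA !Pv Pv' mulrA.
  - apply: onbasis => s i j s4; rewrite (pbw_mul_a qC q2 rel) // rhoa.
    rewrite (pbw_mul_a QC Q2 relM) // /pbw_a.
    case: s s4 => [|[|[|[|//]]]] s4 /=.
    + by rewrite !mul1r rhoE.
    + by rewrite -scalerAl mul1r rhoZ rhoE // -mulmxE mul_scalar_mx.
    + by rewrite !mulNr -scalerAl mul1r rhoN rhoZ rhoE // -mulmxE mul_scalar_mx.
    + by rewrite !mul1r rhoE.
  - apply: onbasis => s i j s4; rewrite (pbw_mul_g rel) // rhog.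
    rewrite (pbw_mul_g relM) // /pbw_g.
    by case: s s4 => [|[|[|[|//]]]] s4 /=; rewrite ?mulN1r ?mul1r ?rhoN rhoE.
  - apply: onbasis => s i j s4; rewrite rhou.
    have [E0 E1 E2 E3] := pbw_mul_u rel i j; have [F0 F1 F2 F3] := pbw_mul_u relM i j.
    by case: s s4 => [|[|[|[|//]]]] s4; rewrite ?(E0, E1, E2, E3) ?(F0, F1, F2, F3) ?rho0 ?rhoE.
  - apply: onbasis => s i j s4; rewrite rhoy.
    have [E0 E1 E2 E3] := pbw_mul_y qC q2 rel i j.
    have [F0 F1 F2 F3] := pbw_mul_y QC Q2 relM i j.
    by case: s s4 => [|[|[|[|//]]]] s4; rewrite ?(E0, E1, E2, E3) ?(F0, F1, F2, F3);
       rewrite ?rhoD ?rhoN ?rho0 ?rhoE.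
by exists rho; split.
Qed.

End Presentation.

(** * Bases and operators with fourth power one *)

Section FreeFamilies.
Variables (k : fieldType) (V : vectType k).
Implicit Types (X Y Z : seq V) (U W : {vspace V}).

Lemma free_map_inj (W : vectType k) (f : 'Hom(V, W)) Z :
  free (map f Z) -> forall v, v \in <<Z>>%VS -> f v = 0 -> v = 0.
Proof.
move=> fr v vZ fv.
have : \dim (<<Z>> :&: lker f) == 0%N.
  have := limg_ker_dim f <<Z>>%VS; rewrite limg_span.
  move: fr; rewrite /free size_map => /eqP -> E.
  have := dim_span Z; rewrite -E => /(fun H => H).
  by rewrite -{2}[size Z]add0n leq_add2r leqn0.
rewrite dimv_eq0 => /eqP Z0; apply/eqP; rewrite -memv0 -Z0 memv_cap vZ memv_ker.
exact/eqP.
Qed.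

Lemma free_of_map (W : vectType k) (f : 'Hom(V, W)) Z : free (map f Z) -> free Z.
Proof.
rewrite /free size_map -limg_span => /eqP E; rewrite eqn_leq dim_span -E /=.
by have := limg_ker_dim f <<Z>>%VS => <-; apply: leq_addl.
Qed.

Lemma map_free (W : vectType k) (f : 'Hom(V, W)) Z :
  free Z -> (forall v, v \in <<Z>>%VS -> f v = 0 -> v = 0) -> free (map f Z).
Proof.
move=> fr inj; have : basis_of <<Z>> Z by rewrite /basis_of eqxx.
move/(limg_basis_of (f := f)) => H; apply: basis_free (H _).
apply/eqP; rewrite -subv0; apply/subvP => v; rewrite memv_cap memv_ker => /andP[vZ /eqP fv].
by rewrite (inj v vZ fv) mem0v.
Qed.

Lemma capv0P U W : (U :&: W = 0)%VS <-> (forall v, v \in U -> v \in W -> v = 0).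
Proof.
split=> [UW v vU vW|H]; first by apply/eqP; rewrite -memv0 -UW memv_cap vU.
apply/eqP; rewrite -subv0; apply/subvP => v; rewrite memv_cap => /andP[vU vW].
by rewrite (H v) ?mem0v.
Qed.

Lemma catP_free X Y :
  free (X ++ Y) <->
  [/\ free X, free Y & forall v, v \in <<X>>%VS -> v \in <<Y>>%VS -> v = 0].
Proof.
rewrite cat_free; split=> [/and3P[-> -> /directv_addP/capv0P]|[-> -> /capv0P H]] //=.
exact/directv_addP.
Qed.

Lemma free_exchange X Z : free X ->
  exists Z', [/\ {subset Z' <= Z}, free (X ++ Z') & <<X ++ Z'>>%VS = <<X ++ Z>>%VS].
Proof.
elim: Z X => [|z Z IH] X fX; first by exists [::]; split=> //; rewrite cats0.
have [zX|zX] := boolP (z \in <<X>>%VS).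
  have [Z' [sub fr sp]] := IH X fX; exists Z'; split=> //.
    by move=> x /sub xZ; rewrite inE xZ orbT.
  rewrite sp !span_cat span_cons addvA; congr (_ + _)%VS; apply/esym/addv_idPl.
  by rewrite -memvE.
have frz : free (X ++ [:: z]).
  rewrite (perm_free (_ : perm_eq _ (z :: X))) ?free_cons ?zX //.
  by rewrite perm_catC.
have [Z' [sub fr sp]] := IH _ frz; exists (z :: Z'); rewrite -!cat_rcons -!cats1.
by split=> // x; rewrite !inE => /orP[-> //|/sub ->]; rewrite orbT.
Qed.

Lemma choice_on (P : V -> V -> Prop) Z :
  (forall s, s \in Z -> exists t, P s t) -> exists g : V -> V, forall s, s \in Z -> P s (g s).
Proof.
elim: Z => [|z Z IH] H; first by exists id.
have [t Pt] := H z (mem_head _ _).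
have [s sZ|g gP] := IH; first by apply: H; rewrite inE sZ orbT.
exists (fun x => if x == z then t else g x) => s.
by rewrite inE; case: eqP => [->|_] //= /gP.
Qed.

End FreeFamilies.

Section Graded.
Variables (k : fieldType) (xi : k).
Hypothesis xi2 : xi * xi = -1.
Hypothesis two_neq0 : 2 != 0 :> k.
Variables (V : vectType k) (a : 'End(V)).
Hypothesis a4 : forall v, a (a (a (a v))) = v.
Implicit Types (X Y Z : seq V) (U W : {vspace V}) (f : 'End(V)) (l m z : k).

Definition homogeneous v := exists2 l, l ^+ 4 = 1 & a v = l *: v.
Definition stable W := forall w, w \in W -> a w \in W.

(** The projection onto the eigenspace of a for the fourth root of unity l. *)
Definition wproj l : 'End(V) :=
  4%:R^-1 *: (\1 + l ^+ 3 *: a + l ^+ 2 *: (a \o a) + l *: (a \o (a \o a)))%VF.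

Lemma wprojE l v : wproj l v =
  4%:R^-1 *: (v + l ^+ 3 *: a v + l ^+ 2 *: a (a v) + l *: a (a (a v))).
Proof. by rewrite scale_lfunE !add_lfunE !scale_lfunE !comp_lfunE id_lfunE. Qed.

Let four_neq0 : 4%:R != 0 :> k.
Proof. by rewrite (natrM _ 2 2) mulf_neq0. Qed.

Lemma root4_neq0 l : l ^+ 4 = 1 -> l != 0.
Proof. by move=> l4; apply/eqP => l0; move/eqP: l4; rewrite l0 expr0n eq_sym oner_eq0. Qed.

Lemma root4V l : l ^+ 4 = 1 -> l^-1 ^+ 4 = 1.
Proof. by move=> l4; rewrite exprVn l4 invr1. Qed.

Lemma root4M l m : l ^+ 4 = 1 -> m ^+ 4 = 1 -> (l * m) ^+ 4 = 1.
Proof. by move=> l4 m4; rewrite exprMn l4 m4 mul1r. Qed.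

Lemma root4P l : l ^+ 4 = 1 -> l \in [:: 1; xi; -1; - xi].
Proof.
move=> l4; have : (l - 1) * (l - xi) * ((l + 1) * (l + xi)) = 0.
  have -> : (l - 1) * (l - xi) * ((l + 1) * (l + xi)) = l ^+ 4 - 1 by ring: xi2.
  by rewrite l4 subrr.
move/eqP; rewrite !mulf_eq0 !subr_eq0 !addr_eq0 !inE => /orP[/orP[]|/orP[]] ->;
by rewrite ?orbT.
Qed.

Lemma wproj_weight l v : l ^+ 4 = 1 -> a (wproj l v) = l *: wproj l v.
Proof.
move=> l4; rewrite wprojE linearZ /= !linearD !linearZ /= a4.
apply: eq_scalar_tests => r rD rN rZ _; rewrite !(rD, rZ).
by ring: l4.
Qed.

Lemma wproj_id l v : l ^+ 4 = 1 -> a v = l *: v -> wproj l v = v.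
Proof.
move=> l4 av; rewrite wprojE !av !linearZ /= !av !linearZ /= !av.
apply: eq_scalar_tests => r rD rN rZ _; rewrite !(rD, rZ).
by field: l4.
Qed.

Lemma wproj_other l m v :
  l ^+ 4 = 1 -> m ^+ 4 = 1 -> l != m -> a v = m *: v -> wproj l v = 0.
Proof.
move=> l4 m4 lm av; have := wproj_weight v l4.
suff -> : a (wproj l v) = m *: wproj l v.
  by move/eqP; rewrite eq_sym -subr_eq0 -scalerBl scaler_eq0 subr_eq0 (negbTE lm) /= => /eqP.
rewrite wprojE !linearZ /= !linearD !linearZ /= !av !linearZ /= !av !linearZ /= !av.
by rewrite !linearZ /= !av; apply: eq_scalar_tests => r rD rN rZ _; rewrite !(rD, rZ); ring.
Qed.

Lemma wproj_sum v : v = wproj 1 v + wproj xi v + wproj (-1) v + wproj (- xi) v.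
Proof.
rewrite !wprojE; apply: eq_scalar_tests => r rD rN rZ _; rewrite !(rD, rZ).
by field: xi2.
Qed.

Lemma wproj_stable l W : stable W -> forall w, w \in W -> wproj l w \in W.
Proof.
move=> sW w wW; rewrite wprojE; apply: rpredZ.
by do 3?[apply: rpredD]; rewrite ?rpredZ ?sW // !sW.
Qed.

Definition equivariant z f W := forall w, w \in W -> a (f w) = z *: f (a w).

(** An operator that commutes with a up to the scalar z shifts weights by z. *)
Lemma wproj_equivariant z f W l w : z ^+ 4 = 1 -> equivariant z f W -> stable W ->
  w \in W -> f (wproj l w) = wproj (z * l) (f w).
Proof.
move=> z4 fz sW wW; rewrite !wprojE linearZ /= !linearD !linearZ /=.
rewrite fz // !linearZ /= fz ?sW // !linearZ /= fz ?sW //.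
apply: eq_scalar_tests => r rD rN rZ _; rewrite !(rD, rZ).
by ring: z4.
Qed.

Lemma homogeneous_wproj l v : l ^+ 4 = 1 -> homogeneous (wproj l v).
Proof. by move=> l4; exists l => //; apply: wproj_weight. Qed.

Lemma homogeneous_equivariant z f W w : z ^+ 4 = 1 -> equivariant z f W ->
  w \in W -> homogeneous w -> homogeneous (f w).
Proof.
move=> z4 fz wW [l l4 aw]; exists (z * l); first exact: root4M.
by rewrite fz // aw linearZ scalerA.
Qed.

Lemma span_stable X : (forall x, x \in X -> homogeneous x) -> stable <<X>>%VS.
Proof.
move=> hX w /(memv_img a); apply: subvP; rewrite limg_span.
apply/span_subvP => _ /mapP[x xX ->]; have [l _ ->] := hX x xX.
by rewrite rpredZ // memv_span.
Qed.

Lemma stable_span W : stable W ->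
  exists X, (forall x, x \in X -> homogeneous x) /\ <<X>>%VS = W.
Proof.
move=> sW; pose R := [:: 1; xi; -1; - xi].
have R4 l : l \in R -> l ^+ 4 = 1.
  by rewrite !inE => /or4P[]/eqP->; ring: xi2.
exists [seq wproj l w | l <- R, w <- vbasis W]; split.
  by move=> _ /allpairsP[[l w] /= [lR _ ->]]; apply/homogeneous_wproj/R4.
apply/eqP; rewrite eqEsubv; apply/andP; split.
  apply/span_subvP => _ /allpairsP[[l w] /= [_ wW ->]].
  by apply: wproj_stable => //; apply: vbasis_mem.
rewrite -{1}(span_basis (vbasisP W)); apply/span_subvP => w wW.
have wp l : l \in R -> wproj l w \in <<[seq wproj l w | l <- R, w <- vbasis W]>>%VS.
  by move=> lR; apply: memv_span; apply/allpairsP; exists (l, w).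
by rewrite (wproj_sum w) !rpredD // wp // !inE eqxx ?orbT.
Qed.

(** A free family can be completed by homogeneous vectors of a graded subspace:
    a graded subspace is spanned by homogeneous vectors and the exchange
    lemma selects the completion among them. *)
Lemma homogeneous_extension X W : free X -> stable W ->
  exists Z, [/\ forall x, x \in Z -> homogeneous x, forall x, x \in Z -> x \in W
    & basis_of (<<X>> + W)%VS (X ++ Z)].
Proof.
move=> fX /stable_span[Y [hY spY]].
have [Z [sub fr sp]] := free_exchange Y fX; exists Z; split.
- by move=> z /sub/hY.
- by move=> z /sub zY; rewrite -spY memv_span.
- by rewrite /basis_of fr sp span_cat spY eqxx.
Qed.

Lemma stable_complement U W : stable U -> stable W -> (U <= W)%VS ->
  exists C, [/\ stable C, (C + U = W)%VS & (C :&: U = 0)%VS].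
Proof.
move=> sU sW UW; have [Y [hY spY]] := stable_span sU.
have [X [sX fX spX]] := @free_exchange _ _ [::] Y (nil_free _).
have {}spX : <<X>>%VS = U by rewrite -spY.
have [Z [hZ _ bZ]] := homogeneous_extension fX sW.
exists <<Z>>%VS; split; first exact: span_stable.
  have /span_basis := bZ; rewrite span_cat spX addvC => ->.
  exact/addv_idPr.
have /basis_free/catP_free[_ _ H] := bZ; rewrite spX in H.
by apply/capv0P => v vZ vU; apply: H.
Qed.

(** An arbitrary preimage is replaced by its component of the weight that
    corresponds to m. *)
Lemma homogeneous_lift z f W s m : z ^+ 4 = 1 -> equivariant z f W -> stable W ->
  s \in (f @: W)%VS -> m ^+ 4 = 1 -> a s = m *: s ->
  exists w, [/\ w \in W, f w = s & a w = (z^-1 * m) *: w].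
Proof.
move=> z4 fz sW /memv_imgP[w wW sE] m4 as_; exists (wproj (z^-1 * m) w).
have zm : (z^-1 * m) ^+ 4 = 1 by apply: root4M => //; apply: root4V.
split; [exact: wproj_stable | | exact: wproj_weight].
by rewrite (wproj_equivariant _ z4 fz) // mulVKf ?root4_neq0 // -sE wproj_id.
Qed.

End Graded.

(** * Graded pencils: strings and bands *)

Section StringsAndBands.
Variables (k : fieldType) (xi : k).
Hypothesis xi2 : xi * xi = -1.
Hypothesis two_neq0 : 2 != 0 :> k.
Variables (V : vectType k) (a : 'End(V)).
Hypothesis a4 : forall v, a (a (a (a v))) = v.
Implicit Types (X Y Z BT BS L : seq V) (U W T S : {vspace V}) (f u y : 'End(V)).
Local Notation homog := (homogeneous a).
Local Notation stab := (stable a).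
Local Notation equiv := (equivariant a).

Definition partial_injection f BT BS :=
  (forall t, t \in BT -> f t = 0 \/ f t \in BS) /\
  (forall t t', t \in BT -> t' \in BT -> f t = f t' -> f t != 0 -> t = t').

(** BT and BS are the upper and lower vertices of the strings: u and y map each
    vertex of BT to zero or to a vertex of BS, and no vertex of BS is hit twice
    by the same operator.  The family L spans the upper half of the part on which
    both u and y are isomorphisms onto the span of [map y L]. *)
Definition string_band u y T S := exists BT BS L,
  [/\ forall t, t \in BT ++ L -> homog t, forall s, s \in BS -> homog s,
      basis_of T (BT ++ L) /\ basis_of S (BS ++ map y L),
      <<map u L>>%VS = <<map y L>>%VS
    & partial_injection u BT BS /\ partial_injection y BT BS].

Lemma string_bandC u y T S : string_band u y T S -> string_band y u T S.
Proof.
move=> [BT [BS [L [hT hS [bT bS] uy [gu gy]]]]].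
exists BT, BS, L; split=> //; split=> //.
rewrite basisEdim span_cat uy -span_cat (span_basis bS) subvv /=.
by move: bS; rewrite basisEdim !size_cat !size_map => /andP[].
Qed.

Section SubobjectStep.
Variables (zu zy : k) (u y : 'End(V)) (T S : {vspace V}).
Hypotheses (zu4 : zu ^+ 4 = 1) (zy4 : zy ^+ 4 = 1).
Hypotheses (uE : equiv zu u T) (yE : equiv zy y T) (sT : stab T) (sS : stab S).
Hypotheses (uTS : (u @: T <= S)%VS) (yTS : (y @: T <= S)%VS).

(** The largest subspace of T that both operators map into the image of y. *)
Definition subobject_top := (T :&: (u @^-1: (y @: T)))%VS.

Lemma subobject_topP t : t \in subobject_top = (t \in T) && (u t \in (y @: T)%VS).
Proof. by rewrite memv_cap memv_preim. Qed.

(** Passing from (T, S) to the subpencil with lower space S' := y T.  Lower vertices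
    that are not hit by y in the subpencil are values of y on T; homogeneous
    preimages of them, completed by vectors of the kernel of y, are the new upper
    vertices N.  No combination of N is mapped into S' by u, so the images u N are
    independent of S' and are new lower vertices, which y does not hit. *)
Lemma string_band_subobject :
  string_band u y subobject_top (y @: T)%VS -> string_band u y T S.
Proof.
move=> [BT [BS [L [hTL hBS [bT bS] uy [[u1 u2] [y1 y2]]]]]].
set S' := (y @: T)%VS in bS *.
have memX t : t \in BT ++ L -> t \in T /\ u t \in S'.
  by move=> /memv_span; rewrite (span_basis bT) subobject_topP => /andP[].
pose hit := [seq s <- BS | s \in map y BT].
pose unhit := [seq s <- BS | s \notin map y BT].
have pe : perm_eq (BS ++ map y L) (unhit ++ (hit ++ map y L)).
  by rewrite catA perm_cat2r perm_sym perm_catC perm_filterC.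
have [fU fH UH0] : [/\ free unhit, free (hit ++ map y L) &
    forall v, v \in <<unhit>>%VS -> v \in <<hit ++ map y L>>%VS -> v = 0].
  by apply/catP_free; rewrite -(perm_free pe); apply: basis_free bS.
(* g chooses homogeneous preimages under y of the lower vertices that y misses *)
have [g gP] : exists g : V -> V, forall s, s \in unhit -> [/\ g s \in T, y (g s) = s & homog (g s)].
  apply: (choice_on (P := fun s t => [/\ t \in T, y t = s & homog t])) => s.
  rewrite mem_filter => /andP[_ sBS].
  have [l l4 as_] := hBS s sBS.
  have sS' : s \in S' by rewrite -(span_basis bS) memv_span // mem_cat sBS.
  have [t [tT yt at_]] := homogeneous_lift two_neq0 a4 zy4 yE sT sS' l4 as_.
  exists t; split=> //; exists (zy^-1 * l) => //.
  by apply: root4M => //; apply: root4V.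
pose lifts := map g unhit.
have ylifts : map y lifts = unhit.
  by rewrite -map_comp map_id_in // => s /gP[].
have yX : (<<map y (BT ++ L)>> <= <<hit ++ map y L>>)%VS.
  apply/span_subvP => _ /mapP[t tX ->]; move: tX; rewrite mem_cat => /orP[tB|tL].
    have [-> | yB] := y1 t tB; first exact: mem0v.
    by apply: memv_span; rewrite mem_cat mem_filter map_f ?yB.
  by apply: memv_span; rewrite mem_cat map_f ?orbT.
have fXl : free ((BT ++ L) ++ lifts).
  apply/catP_free; split; first exact: basis_free bT.
    by apply: (@free_of_map _ _ _ y); rewrite ylifts.
  move=> v vX vl; apply: (@free_map_inj _ _ _ y lifts); rewrite ?ylifts //.
  apply: UH0; first by rewrite -ylifts -limg_span memv_img.
  by apply: (subvP yX); rewrite -limg_span memv_img.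
have sK : stab (T :&: lker y)%VS.
  move=> w; rewrite !memv_cap !memv_ker => /andP[wT /eqP yw]; rewrite sT //=.
  have := yE wT; rewrite yw linear0 => /esym/eqP.
  by rewrite scaler_eq0 (negbTE (root4_neq0 zy4)).
have [Z [hZ ZK bZ]] := homogeneous_extension xi2 two_neq0 a4 fXl sK.
have liftsT s : s \in lifts -> s \in T by move=> /mapP[x /gP[? _ _] ->].
have defT : (<<(BT ++ L) ++ lifts>> + (T :&: lker y) = T)%VS.
  apply/eqP; rewrite eqEsubv; apply/andP; split.
    rewrite subv_add capvSl andbT; apply/span_subvP => t.
    by rewrite mem_cat => /orP[/memX[] //|/liftsT].
  apply/subvP => t tT.
  have : y t \in (y @: <<(BT ++ L) ++ lifts>>)%VS.
    have := memv_img y tT; rewrite -/S' -(span_basis bS); apply: subvP.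
    apply/span_subvP => s; rewrite mem_cat limg_span => /orP[sB|/mapP[l lL ->]]; last first.
      by apply/memv_span/map_f; rewrite !mem_cat lL orbT.
    apply: memv_span; have [|sU] := boolP (s \in map y BT).
      by move=> /mapP[t' t'B ->]; apply: map_f; rewrite !mem_cat t'B.
    by rewrite map_cat mem_cat ylifts mem_filter sU sB orbT.
  move=> /memv_imgP[t' t'X yt]; rewrite -[t](subrKC t'); apply: memv_add => //.
  rewrite memv_cap memv_ker linearB /= yt subrr eqxx andbT rpredB //.
  move: t' t'X {yt}; apply/subvP/span_subvP => t'.
  by rewrite mem_cat => /orP[/memX[] //|/liftsT].
rewrite defT -catA in bZ; pose N := lifts ++ Z.
have NT n : n \in N -> n \in T.
  by rewrite mem_cat => /orP[/liftsT //|/ZK]; rewrite memv_cap => /andP[].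
have hN n : n \in N -> homog n.
  by rewrite mem_cat => /orP[/mapP[s /gP[_ _ h] ->] //|/hZ].
have /basis_free/catP_free[fX fN XN0] := bZ.
have NS' v : v \in <<N>>%VS -> u v \in S' -> v = 0.
  move=> vN uv; apply: XN0 => //; rewrite (span_basis bT) subobject_topP uv andbT.
  by move: v vN {uv}; apply/subvP/span_subvP.
have fS : free ((BS ++ map y L) ++ map u N).
  apply/catP_free; split; first exact: basis_free bS.
    by apply: map_free => // v vN uv; apply: NS' => //; rewrite uv mem0v.
  move=> w; rewrite (span_basis bS) -limg_span => wS /memv_imgP[v vN E].
  by rewrite E (NS' v vN) ?linear0 // -E.
have [Z2 [hZ2 _ bZ2]] := homogeneous_extension xi2 two_neq0 a4 fS sS.
have defS : (<<(BS ++ map y L) ++ map u N>> + S = S)%VS.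
  apply/addv_idPr; rewrite span_cat subv_add (span_basis bS) yTS /=.
  apply: subv_trans uTS; rewrite -limg_span; apply: limgS; exact/span_subvP.
rewrite defS in bZ2.
exists (BT ++ N), (BS ++ map u N ++ Z2), L; split.
- move=> t; rewrite !mem_cat => /orP[/orP[tB|tN]|tL].
  + by apply: hTL; rewrite mem_cat tB.
  + by apply: hN; rewrite mem_cat.
  + by apply: hTL; rewrite mem_cat tL orbT.
- move=> s; rewrite !mem_cat => /or3P[/hBS //|/mapP[n nN ->]|/hZ2 //].
  by apply: (homogeneous_equivariant zu4 uE); [apply: NT | apply: hN].
- have pT : perm_eq ((BT ++ N) ++ L) ((BT ++ L) ++ N).
    by rewrite -(catA BT N) -(catA BT L) perm_cat2l perm_catC.
  have pS : perm_eq ((BS ++ map u N ++ Z2) ++ map y L) (((BS ++ map y L) ++ map u N) ++ Z2).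
    by rewrite -(catA BS) -2!(catA BS) perm_cat2l perm_catC -!catA perm_cat2l.
  by rewrite (perm_basis _ pT) (perm_basis _ pS).
- by [].
split; split.
- move=> t; rewrite mem_cat => /orP[/u1[->|uB]|tN]; [by left| |]; right.
    by rewrite mem_cat uB.
  by rewrite !mem_cat map_f ?orbT.
- have uB t : t \in BT -> u t \in S' by move=> tB; have [] := memX t; rewrite // mem_cat tB.
  move=> t t'; rewrite ![_ \in BT ++ N]mem_cat => /orP[tB|tN] /orP[t'B|t'N] E nz.
  + exact: u2.
  + by move: nz; rewrite E (NS' t') ?linear0 ?eqxx ?memv_span // -E uB.
  + by move: nz; rewrite (NS' t) ?linear0 ?eqxx ?memv_span // E uB.
  + apply/eqP; rewrite -subr_eq0; apply/eqP/NS'; first by rewrite rpredB ?memv_span.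
    by rewrite linearB /= E subrr mem0v.
- move=> t; rewrite !mem_cat => /or3P[/y1[->|yB]|/mapP[s sU ->]|/ZK]; first by left.
  + by right; rewrite yB.
  + by have [_ -> _] := gP s sU; right; move: sU; rewrite mem_filter => /andP[_ ->].
  + by rewrite memv_cap memv_ker => /andP[_ /eqP->]; left.
have y0 t : t \in Z -> y t = 0.
  by move=> /ZK; rewrite memv_cap memv_ker => /andP[_ /eqP].
move=> t t'; rewrite !mem_cat => /or3P[tB|/mapP[s sU ->]|/y0->]; last by rewrite eqxx.
- move=> /or3P[t'B|/mapP[s sU ->]|/y0->]; [exact: y2 | | by move=> ->; rewrite eqxx].
  have [_ -> _] := gP s sU; move=> E; move: sU.
  by rewrite mem_filter -E map_f.
- have [_ E _] := gP s sU; rewrite E => /or3P[t'B sE|/mapP[s' s'U ->]|/y0->].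
  + by move: sU; rewrite mem_filter sE map_f.
  + by have [_ -> _] := gP s' s'U; move=> ->.
  + by move=> ->; rewrite eqxx.
Qed.

End SubobjectStep.

Section QuotientStep.
Variables (zu zy : k) (u y : 'End(V)) (T S C E : {vspace V}).
Hypotheses (zu4 : zu ^+ 4 = 1) (zy4 : zy ^+ 4 = 1).
Hypotheses (uE : equiv zu u T) (yE : equiv zy y T) (sT : stab T) (sS : stab S).
Hypotheses (uTS : (u @: T <= S)%VS) (yTS : (y @: T <= S)%VS).
Let K := (T :&: lker y)%VS.
Let W := (u @: K)%VS.
Hypotheses (sC : stab C) (CK : (C + K = T)%VS) (CK0 : (C :&: K = 0)%VS).
Hypotheses (sE : stab E) (EW : (E + W = S)%VS) (EW0 : (E :&: W = 0)%VS).
Let p := daddv_pi E W.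

Lemma quotient_proj_id e : e \in E -> p e = e.
Proof. exact: daddv_pi_id. Qed.

Lemma quotient_proj_mem s : p s \in E.
Proof. exact: memv_pi. Qed.

Lemma quotient_proj_sub s : s \in S -> s - p s \in W.
Proof.
rewrite -EW => sEW; rewrite -{1}(daddv_pi_add EW0 sEW) addrAC subrr add0r.
exact: memv_pi.
Qed.

Lemma quotient_WS w : w \in W -> w \in S.
Proof. by move=> wW; rewrite -EW; apply: (subvP (addvSr E W)). Qed.

Lemma quotient_ES e : e \in E -> e \in S.
Proof. by move=> eE; rewrite -EW; apply: (subvP (addvSl E W)). Qed.

Lemma quotient_proj0 w : w \in W -> p w = 0.
Proof.
move=> wW; have /capv0P := EW0; apply; first exact: quotient_proj_mem.
rewrite -[p w](subKr w) rpredB //.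
exact/quotient_proj_sub/quotient_WS.
Qed.

Lemma quotient_proj_eq0 s : s \in S -> p s = 0 -> s \in W.
Proof. by move=> sSS ps; have := quotient_proj_sub sSS; rewrite ps subr0. Qed.

Lemma quotient_kernel t : t \in K -> t \in T /\ y t = 0.
Proof. by rewrite memv_cap memv_ker => /andP[-> /eqP->]. Qed.

Lemma quotient_CT t : t \in C -> t \in T.
Proof. by move=> tC; rewrite -CK; apply: (subvP (addvSl C K)). Qed.

Lemma quotient_stableK : stab K.
Proof.
move=> w /quotient_kernel[wT yw]; rewrite memv_cap sT // memv_ker.
have := yE wT; rewrite yw linear0 => /esym/eqP.
by rewrite scaler_eq0 (negbTE (root4_neq0 zy4)).
Qed.

Lemma quotient_stableW : stab W.
Proof.
move=> _ /memv_imgP[w wK ->]; have [wT _] := quotient_kernel wK.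
by rewrite uE //; apply: rpredZ; apply: memv_img; apply: quotient_stableK.
Qed.

Lemma quotient_proj_comm s : s \in S -> a (p s) = p (a s).
Proof.
move=> sSS; have sW := quotient_proj_sub sSS.
have -> : a s = a (p s) + a (s - p s) by rewrite -linearD /= subrKC.
rewrite linearD /= (quotient_proj_id (e := a (p s))); last exact/sE/quotient_proj_mem.
by rewrite (quotient_proj0 (w := a (s - p s))) ?addr0 //; apply: quotient_stableW.
Qed.

Lemma quotient_equivariant z f : equiv z f T -> (f @: T <= S)%VS ->
  equiv z (p \o f)%VF C.
Proof.
move=> fE fTS t /quotient_CT tT; rewrite !comp_lfunE quotient_proj_comm.
  by rewrite fE // linearZ.
by apply: (subvP fTS); apply: memv_img.
Qed.

Lemma quotient_y_inj t : t \in C -> y t = 0 -> t = 0.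
Proof.
move=> tC yt; have /capv0P := CK0; apply=> //.
by rewrite memv_cap memv_ker yt eqxx quotient_CT.
Qed.

(** A vector of C whose image under u is known modulo W = u K can be corrected by a
    vector of K, that is without changing its image under y, so that the image
    under u becomes exactly the prescribed vector. *)
Lemma quotient_adjust t l tau : t \in C -> l ^+ 4 = 1 -> a t = l *: t ->
  tau \in S -> a tau = (zu * l) *: tau -> p tau = p (u t) ->
  exists t', [/\ t - t' \in K, homog t' & u t' = tau].
Proof.
move=> tC l4 at_ tauS atau ptau; have tT := quotient_CT tC.
have utS : u t \in S by apply: (subvP uTS); apply: memv_img.
have dW : u t - tau \in W.
  by apply: quotient_proj_eq0; rewrite ?rpredB // linearB /= ptau subrr.
have uK : equiv zu u K by move=> w /quotient_kernel[wT _]; apply: uE.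
have ad : a (u t - tau) = (zu * l) *: (u t - tau).
  by rewrite linearB /= uE // at_ linearZ scalerA atau -scalerBr.
have [r [rK ur ar]] := homogeneous_lift two_neq0 a4 zu4 uK quotient_stableK dW (root4M zu4 l4) ad.
exists (t - r); rewrite opprB addrC subrK; split=> //; last by rewrite linearB /= ur opprB addrC subrK.
exists l => //; rewrite linearB /= at_ ar mulrA mulVf ?(root4_neq0 zu4) // mul1r.
by rewrite -scalerBr.
Qed.

(** Passing from (T, S) to the quotient by K, the kernel of y in T, and W := u K; the
    quotient is realised on complements C and E, with p the projection onto E.
    The basis of the quotient is lifted so that the incidences hold on the nose.
    A lower vertex hit by y is replaced by the actual value of y; an upper
    vertex is corrected by K so that its u-image is a lifted lower vertex or
    zero; the values of y that vanish in the quotient lie in W and become lower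
    vertices.  Each basis vector of W receives a preimage in K under u, and these
    preimages are killed by y. *)
Lemma string_band_quotient :
  string_band (p \o u)%VF (p \o y)%VF C E -> string_band u y T S.
Proof.
move=> [BT [BS [L [hTL hBS [bT bS] uy [[u1 u2] [y1 y2]]]]]].
have yS t : t \in T -> y t \in S by move=> tT; apply: (subvP yTS); apply: memv_img.
have uS t : t \in T -> u t \in S by move=> tT; apply: (subvP uTS); apply: memv_img.
have memC t : t \in BT ++ L -> t \in C by move=> /memv_span; rewrite (span_basis bT).
have memBT t : t \in BT -> t \in C by move=> tB; apply: memC; rewrite mem_cat tB.
have memL t : t \in L -> t \in C by move=> tB; apply: memC; rewrite mem_cat tB orbT.
have memBS e : e \in BS -> e \in E.
  by move=> eB; rewrite -(span_basis bS) memv_span // mem_cat eB.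
have BS0 e : e \in BS -> e != 0.
  by move=> eB; apply: (free_not0 (basis_free bS)); rewrite mem_cat eB.
(* used for values e of p y on BT only, so the default 0 does not occur *)
pose preim e := nth 0 BT (index e (map (p \o y)%VF BT)).
pose lift_target e := if e \in map (p \o y)%VF BT then y (preim e) else e.
have preimP e : e \in map (p \o y)%VF BT -> preim e \in BT /\ p (y (preim e)) = e.
  move=> eB; have lt : (index e (map (p \o y)%VF BT) < size BT)%N.
    by rewrite -(size_map (p \o y)%VF) index_mem.
  split; first exact: mem_nth.
  by rewrite -comp_lfunE -(nth_map 0 0) // nth_index.
have targetS e : e \in BS -> lift_target e \in S /\ p (lift_target e) = e.
  move=> eB; rewrite /lift_target; case: ifP => [/preimP[tB ->]|_].
    by split=> //; apply/yS/quotient_CT/memBT.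
  by rewrite quotient_proj_id ?memBS //; split=> //; apply/quotient_ES/memBS.
have target_weight e l : e \in BS -> a e = l *: e -> a (lift_target e) = l *: lift_target e.
  move=> eB ae; rewrite /lift_target; case: ifP => [/preimP[tB pe]|_] //.
  have tT := quotient_CT (memBT _ tB).
  have [m m4 at_] : homog (preim e) by apply: hTL; rewrite mem_cat tB.
  have : (zy * m - l) *: e = 0.
    rewrite scalerBl -ae -pe quotient_proj_comm ?yS // yE // at_ !linearZ /= !linearZ /=.
    by rewrite scalerA scalerN (mulrC m) subrr.
  move/eqP; rewrite scaler_eq0 (negbTE (BS0 _ eB)) orbF subr_eq0 => /eqP <-.
  by rewrite yE // at_ linearZ scalerA.
have target_y t : t \in BT -> p (y t) != 0 -> lift_target (p (y t)) = y t.
  move=> tB nz; have tin : p (y t) \in map (p \o y)%VF BT.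
    by apply/mapP; exists t; rewrite ?comp_lfunE.
  rewrite /lift_target tin; have [t'B pt'] := preimP _ tin; congr (y _).
  by apply: y2 => //; rewrite !comp_lfunE pt'.
have [gB gBP] : exists g : V -> V, forall t, t \in BT -> [/\ t - g t \in K, homog (g t)
    & u (g t) = if p (u t) == 0 then 0 else lift_target (p (u t))].
  apply: (choice_on (P := fun t t' => [/\ t - t' \in K, homog t'
    & u t' = if p (u t) == 0 then 0 else lift_target (p (u t))])) => t tB.
  have tC := memBT t tB; have tT := quotient_CT tC.
  have [l l4 at_] : homog t by apply: hTL; rewrite mem_cat tB.
  apply: (quotient_adjust tC l4 at_).
  - by case: eqP => [_|pu]; rewrite ?mem0v //; have [] := u1 t tB;
       rewrite comp_lfunE // => /targetS[].
  - case: eqP => [_|pu]; first by rewrite linear0 scaler0.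
    have [] := u1 t tB; rewrite comp_lfunE // => uB; apply: target_weight => //.
    by rewrite quotient_proj_comm ?uS // uE // at_ !linearZ /= scalerA.
  - case: eqP => [->|pu]; first by rewrite linear0.
    by have [] := u1 t tB; rewrite comp_lfunE // => /targetS[].
have hL t : t \in L -> homog t by move=> tL; apply: hTL; rewrite mem_cat tL orbT.
have sL : stab <<L>>%VS by apply: (span_stable hL).
have LT t : t \in <<L>>%VS -> t \in T.
  by move: t; apply/subvP/span_subvP => t /memL/quotient_CT.
have [gL gLP] : exists g : V -> V, forall t, t \in L -> [/\ t - g t \in K, homog (g t)
    & u (g t) \in (y @: <<L>>)%VS].
  apply: (choice_on (P := fun t t' => [/\ t - t' \in K, homog t'
    & u t' \in (y @: <<L>>)%VS])) => t tL.
  have tC := memL t tL; have tT := quotient_CT tC.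
  have [l l4 at_] := hL t tL.
  have : (p \o u)%VF t \in <<map (p \o y)%VF L>>%VS.
    by rewrite -uy; apply/memv_span/map_f.
  rewrite -limg_span => /memv_imgP[l' l'L]; rewrite !comp_lfunE => E'.
  have zl4 := root4M zu4 l4.
  have yl'S : y l' \in S by apply/yS/LT.
  have m4 := root4M (root4V zy4) zl4.
  have yl'E : wproj a (zu * l) (y l') = y (wproj a (zy^-1 * (zu * l)) l').
    by rewrite (wproj_equivariant _ zy4 yE sT) ?LT // mulVKf // root4_neq0.
  have [t' [t1 t2 t3]] : exists t', [/\ t - t' \in K, homog t' & u t' = wproj a (zu * l) (y l')].
    apply: (quotient_adjust tC l4 at_); first exact: wproj_stable.
      exact: wproj_weight.
    have pE : equiv 1 p S by move=> w wS; rewrite scale1r quotient_proj_comm.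
    rewrite (wproj_equivariant _ (expr1n _ _) pE sS) // mul1r -E'.
    apply: wproj_id => //.
    by rewrite quotient_proj_comm ?uS // uE // at_ !linearZ /= scalerA.
  by exists t'; split=> //; rewrite t3 yl'E memv_img // wproj_stable.
pose Y0 := [seq y t | t <- BT & p (y t) == 0].
have fY0 : free Y0.
  apply: map_free; first exact/filter_free/(catl_free (basis_free bT)).
  move=> v vB; apply: quotient_y_inj; move: v vB; apply/subvP/span_subvP => t.
  by rewrite mem_filter => /andP[_ /memBT].
have Y0P s : s \in Y0 -> homog s /\ s \in W.
  move=> /mapP[t]; rewrite mem_filter => /andP[/eqP pt tB] ->.
  have tT := quotient_CT (memBT t tB); split.
    by apply: (homogeneous_equivariant zy4 yE) => //; apply: hTL; rewrite mem_cat tB.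
  by apply: quotient_proj_eq0; rewrite ?yS.
have [Z0 [hZ0 Z0W bW]] := homogeneous_extension xi2 two_neq0 a4 fY0 quotient_stableW.
have {}bW : basis_of W (Y0 ++ Z0).
  suff <- : (<<Y0>> + W)%VS = W by [].
  by apply/addv_idPr/span_subvP => s /Y0P[].
set BW := Y0 ++ Z0 in bW.
have BWP s : s \in BW -> homog s /\ s \in W.
  by rewrite mem_cat => /orP[/Y0P //|sZ]; split; [apply: hZ0 | apply: Z0W].
have uK : equiv zu u K by move=> w /quotient_kernel[wT _]; apply: uE.
have [h hP] : exists g : V -> V, forall s, s \in BW -> [/\ g s \in K, u (g s) = s & homog (g s)].
  apply: (choice_on (P := fun s t => [/\ t \in K, u t = s & homog t])) => s /BWP[[l l4 as_] sW].
  have [t [tK ut at_]] := homogeneous_lift two_neq0 a4 zu4 uK quotient_stableK sW l4 as_.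
  exists t; split=> //; exists (zu^-1 * l) => //.
  by apply: root4M => //; apply: root4V.
pose kl := map h BW.
have ukl : map u kl = BW by rewrite -map_comp map_id_in // => s /hP[].
have fkl : free kl by apply: (@free_of_map _ _ _ u); rewrite ukl (basis_free bW).
have sKu : stab (K :&: lker u)%VS.
  move=> w /memv_capP[wK]; rewrite memv_ker => /eqP uw; apply/memv_capP.
  split; first exact: quotient_stableK.
  rewrite memv_ker; have := uK w wK; rewrite uw linear0 => /esym/eqP.
  by rewrite scaler_eq0 (negbTE (root4_neq0 zu4)).
have [R0 [hR0 R0K bK]] := homogeneous_extension xi2 two_neq0 a4 fkl sKu.
have klK w : w \in kl -> w \in K by move=> /mapP[s /hP[? _ _] ->].
have {}bK : basis_of K (kl ++ R0).
  suff <- : (<<kl>> + (K :&: lker u) = K)%VS by [].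
  apply/eqP; rewrite eqEsubv subv_add capvSl andbT; apply/andP; split.
    by apply/span_subvP.
  apply/subvP => w wK; have : u w \in (u @: <<kl>>)%VS.
    by rewrite limg_span ukl (span_basis bW) memv_img.
  move=> /memv_imgP[w' w'k uw]; rewrite -[w](subrKC w'); apply: memv_add => //.
  apply/memv_capP; split; last by rewrite memv_ker linearB /= uw subrr.
  by rewrite rpredB //; move: w' w'k {uw}; apply/subvP/span_subvP.
have R0P w : w \in R0 -> w \in K /\ u w = 0.
  by move=> /R0K/memv_capP[? ]; rewrite memv_ker => /eqP.
have ygL t : t \in L -> y (gL t) = y t.
  move=> /gLP[/quotient_kernel[_ +] _ _]; rewrite linearB /= => /eqP.
  by rewrite subr_eq0 => /eqP.
have ygB t : t \in BT -> y (gB t) = y t.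
  move=> /gBP[/quotient_kernel[_ +] _ _]; rewrite linearB /= => /eqP.
  by rewrite subr_eq0 => /eqP.
have ymL : map y (map gL L) = map y L.
  by rewrite -map_comp; apply/eq_in_map => t /ygL.
have dimT : (\dim C + \dim K = \dim T)%N by rewrite -CK dimv_disjoint_sum.
have dimS : (\dim E + \dim W = \dim S)%N by rewrite -EW dimv_disjoint_sum.
have szT : (size BT + size L = \dim C)%N.
  by rewrite -size_cat; apply/esym; apply: (@size_basis _ _ _ _ (in_tuple _)).
have szS : (size BS + size L = \dim E)%N.
  rewrite -(size_map (p \o y)%VF L) -size_cat; apply/esym.
  exact: (@size_basis _ _ _ _ (in_tuple _)).
have szK : (size kl + size R0 = \dim K)%N.
  by rewrite -size_cat; apply/esym; apply: (@size_basis _ _ _ _ (in_tuple _)).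
have szW : (size BW = \dim W)%N by apply/esym; apply: (@size_basis _ _ _ _ (in_tuple _)).
have Y0BW s : s \in Y0 -> s \in BW by move=> sY; rewrite mem_cat sY.
clearbody BW.
exists (map gB BT ++ kl ++ R0), (map lift_target BS ++ BW), (map gL L); split.
- move=> t; rewrite !mem_cat => /orP[/or3P[/mapP[s /gBP[_ ? _] ->]|/mapP[s /hP[_ _ ?] ->]|/hR0]|
    /mapP[s /gLP[_ ? _] ->]] //.
- move=> s; rewrite mem_cat => /orP[/mapP[e eB ->]|/BWP[]//].
  have [l l4 ae] := hBS e eB; exists l => //; exact: target_weight.
- split; rewrite basisEdim; apply/andP; split.
  + rewrite -CK subv_add; apply/andP; split; last first.
      rewrite -(span_basis bK); apply: sub_span => t.
      by rewrite !mem_cat => /orP[->|->]; rewrite ?orbT.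
    have KT : (K <= <<(map gB BT ++ kl ++ R0) ++ map gL L>>)%VS.
      rewrite -(span_basis bK); apply: sub_span => t.
      by rewrite !mem_cat => /orP[->|->]; rewrite ?orbT.
    rewrite -(span_basis bT); apply/span_subvP => t; rewrite mem_cat => /orP[tB|tL].
      have [tK _ _] := gBP t tB; rewrite -[t](subrK (gB t)); apply: rpredD; first exact: (subvP KT).
      by apply: memv_span; rewrite !mem_cat map_f.
    have [tK _ _] := gLP t tL; rewrite -[t](subrK (gL t)); apply: rpredD; first exact: (subvP KT).
    by apply: memv_span; rewrite !mem_cat map_f ?orbT.
  + by rewrite !size_cat (size_map gB) (size_map gL) -dimT -szT -szK addnAC.
  + have WS : (W <= <<(map lift_target BS ++ BW) ++ map y (map gL L)>>)%VS.
      rewrite -(span_basis bW); apply: sub_span => t.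
      by rewrite !(mem_cat t) => ->; rewrite ?orbT.
    rewrite ymL in WS *; rewrite -EW subv_add WS andbT -(span_basis bS).
    apply/span_subvP => s; rewrite mem_cat => /orP[sB|/mapP[t tL ->]].
      have [tS pt] := targetS s sB; rewrite -[s](subKr (lift_target s)) rpredB //.
        by apply: memv_span; rewrite !mem_cat map_f.
      apply: (subvP WS); apply: quotient_proj_eq0; first by apply: rpredB => //; apply/quotient_ES/memBS.
      by rewrite linearB /= pt quotient_proj_id ?memBS // subrr.
    rewrite comp_lfunE -[p _](subKr (y t)) rpredB //.
      by apply: memv_span; rewrite !mem_cat (map_f y tL) ?orbT.
    by apply: (subvP WS); apply/quotient_proj_sub/yS/quotient_CT/memL.
  + by rewrite size_cat (size_cat (map lift_target BS)) ymL (size_map y) (size_map lift_target) -dimS -szS -szW addnAC.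
- rewrite ymL.
  have fuL : free (map u (map gL L)).
    apply: (@free_of_map _ _ _ p).
    have -> : map p (map u (map gL L)) = map (p \o u)%VF L.
      rewrite -!map_comp; apply/eq_in_map => t tL /=; rewrite comp_lfunE.
      have [tK _ _] := gLP t tL; have := quotient_proj0 (memv_img u tK).
      by rewrite !linearB /= => /eqP; rewrite subr_eq0 => /eqP.
    by rewrite /free uy size_map; have := catr_free (basis_free bS); rewrite /free size_map.
  apply/eqP; rewrite eqEdim; apply/andP; split.
    apply/span_subvP => _ /mapP[_ /mapP[t tL ->] ->]; rewrite -limg_span.
    by have [] := gLP t tL.
  by move: fuL; rewrite /free => /eqP ->; rewrite !size_map -(size_map y L) dim_span.
have pgB t : t \in BT -> u (gB t) != 0 -> p (u (gB t)) = p (u t) /\ p (u t) \in BS.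
  move=> tB; have [_ _ ->] := gBP t tB; case: (eqVneq (p (u t)) 0) => [_|pu _]; first by rewrite eqxx.
  have [] := u1 t tB; rewrite comp_lfunE // => uB; first by rewrite uB eqxx in pu.
  by have [_ ->] := targetS _ uB.
have pBW w : w \in BW -> p w = 0 by move=> /BWP[_ /quotient_proj0].
split; split.
- move=> t; rewrite !mem_cat => /or3P[/mapP[s sB ->]|/mapP[s sB ->]|/R0P[_ ->]]; last by left.
  + have [_ _ ->] := gBP s sB; case: eqP => [_|pu]; [by left|right].
    by have [] := u1 s sB; rewrite comp_lfunE // => uB; rewrite map_f.
  + by right; have [_ -> _] := hP s sB; rewrite sB orbT.
- move=> t t'; rewrite !mem_cat => /or3P[/mapP[s sB ->]|/mapP[s sB ->]|/R0P[_ ->]]; last by rewrite eqxx.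
  + move=> /or3P[/mapP[s' sB' ->]|/mapP[s' sB' ->]|/R0P[_ ->]].
    * move=> e nz; have [e1 i1] := pgB s sB nz.
      rewrite e in nz e1; have [e2 _] := pgB s' sB' nz.
      congr gB; apply: u2 => //; rewrite !comp_lfunE; first by rewrite -e1 e2.
      exact: BS0.
    * have [_ -> _] := hP s' sB' => e nz; have [e1 /BS0] := pgB s sB nz.
      by rewrite -e1 e pBW // eqxx.
    * by move=> ->; rewrite eqxx.
  + have [_ uh _] := hP s sB; rewrite uh => /or3P[/mapP[s' sB' ->]|/mapP[s' sB' ->]|/R0P[_ ->]].
    * move=> e nz; rewrite e in nz; have [e1 /BS0] := pgB s' sB' nz.
      by rewrite -e1 -e pBW // eqxx.
    * by have [_ -> _] := hP s' sB'; move=> ->.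
    * by move=> ->; rewrite eqxx.
- move=> t; rewrite !mem_cat => /or3P[/mapP[s sB ->]|/mapP[s sB ->]|/R0P[/quotient_kernel[_ ->] _]]; try by left.
    rewrite ygB //; right; have [pys|pys] := eqVneq (p (y s)) 0.
      by rewrite Y0BW ?orbT //; apply/mapP; exists s; rewrite // mem_filter pys eqxx.
    have [pys0|yB] := y1 s sB; first by move: pys; rewrite -comp_lfunE pys0 eqxx.
    by rewrite -(target_y _ sB pys) -comp_lfunE map_f.
  by have [/quotient_kernel[_ ->] _ _] := hP s sB; left.
- have yk t : t \in kl ++ R0 -> y t = 0.
    by rewrite mem_cat => /orP[/klK|/R0P[]] => [|+ _] => /quotient_kernel[].
  move=> t t'; rewrite 2!(mem_cat _ (map gB BT)) => /orP[/mapP[s sB ->]|/yk->]; last by rewrite eqxx.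
  move=> /orP[/mapP[s' sB' ->]|/yk->]; last by move=> ->; rewrite eqxx.
  rewrite !ygB // => e _; congr gB; apply/eqP; rewrite -subr_eq0; apply/eqP.
  apply: quotient_y_inj; first by rewrite rpredB // memBT.
  by rewrite linearB /= e subrr.
Qed.

End QuotientStep.

(** Two maps from T to S that commute with the grading operator up to fourth roots
    of unity zu and zy. *)
Definition graded_pencil zu zy u y T S :=
  [/\ zu ^+ 4 = 1 /\ zy ^+ 4 = 1, equiv zu u T /\ equiv zy y T, stab T /\ stab S
    & (u @: T <= S)%VS /\ (y @: T <= S)%VS].

Lemma stable_img z f W : equiv z f W -> stab W -> stab (f @: W)%VS.
Proof.
move=> fE sW _ /memv_imgP[w wW ->]; rewrite fE //.
by apply: rpredZ; apply: memv_img; apply: sW.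
Qed.

(** If y is not onto S, the subpencil with lower space y T is smaller; if y is
    not injective on T, the quotient by its kernel is smaller. *)
Lemma string_band_step zu zy u y T S : graded_pencil zu zy u y T S ->
  (forall u' y' T' S', (\dim T' + \dim S' < \dim T + \dim S)%N ->
     graded_pencil zu zy u' y' T' S' -> string_band u' y' T' S') ->
  (y @: T)%VS != S \/ (T :&: lker y)%VS != 0%VS -> string_band u y T S.
Proof.
move=> [[zu4 zy4] [uE yE] [sT sS] [uTS yTS]] IH [ySn|yn].
  apply: (string_band_subobject zu4 zy4) => //; apply: IH.
    rewrite -addnS leq_add ?dimvS ?capvSl // ltnNge; apply: contra ySn => le.
    by rewrite eqEdim yTS.
  have ss t : t \in subobject_top u y T -> t \in T by rewrite subobject_topP => /andP[].
  split=> //; split; try by move=> t /ss; [exact: uE || exact: yE].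
  - move=> t; rewrite !subobject_topP => /andP[tT ut]; rewrite sT //=.
    have := stable_img yE sT ut; rewrite uE // => /(rpredZ zu^-1).
    by rewrite scalerA mulVf ?scale1r ?(root4_neq0 zu4).
  - exact: stable_img yE sT.
  - by apply/subvP => _ /memv_imgP[t + ->]; rewrite subobject_topP => /andP[].
  - by apply: limgS; apply/subvP.
set K := (T :&: lker y)%VS.
have sK : stab K by apply: (quotient_stableK zy4 yE).
have [C [sC CK CK0]] := stable_complement xi2 two_neq0 a4 sK sT (capvSl _ _).
have uK : equiv zu u K by move=> w /memv_capP[wT _]; apply: uE.
have WS : (u @: K <= S)%VS by apply: subv_trans uTS; apply/limgS/capvSl.
have [E [sE EW EW0]] := stable_complement xi2 two_neq0 a4 (stable_img uK sK) sS WS.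
apply: (string_band_quotient zu4 zy4 uE yE sT sS uTS yTS CK CK0 sE EW EW0).
apply: IH.
  rewrite -addSn leq_add //; last by rewrite dimvS // -EW addvSl.
  rewrite -CK dimv_disjoint_sum // -{1}[\dim C]addn0 ltn_add2l.
  by rewrite lt0n dimv_eq0.
have img f : ((daddv_pi E (u @: K) \o f)%VF @: C <= E)%VS.
  by apply/subvP => _ /memv_imgP[t _ ->]; rewrite comp_lfunE memv_pi.
split=> //; split.
  exact: (quotient_equivariant zy4 uE yE sT CK sE EW EW0).
exact: (quotient_equivariant zy4 uE yE sT CK sE EW EW0).
Qed.

(** Induction on the total dimension: unless u and y are both bijective, one of
    the two reductions applies to y, or to u after exchanging the operators.  In
    the remaining case the whole pencil is the bijective part. *)
Theorem string_band_decomposition zu zy u y T S :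
  graded_pencil zu zy u y T S -> string_band u y T S.
Proof.
have [n] := ubnP (\dim T + \dim S); elim: n => // n IHn in zu zy u y T S *.
rewrite ltnS => le G; have [z4 [uE yE] sTS [uTS yTS]] := G.
have IH zu' zy' u' y' T' S' : (\dim T' + \dim S' < \dim T + \dim S)%N ->
    graded_pencil zu' zy' u' y' T' S' -> string_band u' y' T' S'.
  by move=> lt; apply: IHn; apply: leq_trans le.
have [yS|/eqP yS] := eqVneq (y @: T)%VS S; last first.
  by apply: string_band_step G _ _; [exact: IH | left; apply/eqP].
have [y0|y0] := eqVneq (T :&: lker y)%VS 0%VS; last first.
  by apply: string_band_step G _ _; [exact: IH | right].
have G' : graded_pencil zy zu y u T S by case: z4 => *; case: sTS.
have [uS|uS] := eqVneq (u @: T)%VS S; last first.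
  by apply/string_bandC/(string_band_step G'); [exact: IH | left].
have [u0|u0] := eqVneq (T :&: lker u)%VS 0%VS; last first.
  by apply/string_bandC/(string_band_step G'); [exact: IH | right].
have [sT sS] := sTS; have [L [hL _ bL]] := homogeneous_extension xi2 two_neq0 a4 (nil_free _) sT.
rewrite span_nil add0v /= in bL.
exists [::], [::], L; split=> //=.
- by split=> //; rewrite -yS; apply: limg_basis_of.
- by rewrite -!limg_span (span_basis bL) uS yS.
Qed.

End StringsAndBands.

(** * Complements from dual pairs, and the Fitting decomposition *)

Section LinearAlgebra.
Variables (k : fieldType) (V : vectType k).
Implicit Types (U W T : {vspace V}) (f : 'End(V)) (fs : seq 'Hom(V, k^o)).

Lemma functional_neq0 (v : V) : v != 0 -> exists r : 'Hom(V, k^o), r v != 0.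
Proof.
move=> v0; pose b := vbasis (fullv : {vspace V}).
have [i ci|c0] := pickP (fun i => coord b i v != 0).
  by exists (coordf i); rewrite coordfE.
move: v0; rewrite (coord_vbasis (memvf v)) big1 ?eqxx // => i _.
by have /negbFE/eqP -> := c0 i; rewrite scale0r.
Qed.

Definition common_kernel T (fs : seq 'Hom(V, k^o)) : {vspace V} :=
  foldr (fun r U => U :&: lker r)%VS T fs.

Lemma common_kernelP T fs v :
  reflect (v \in T /\ forall r, r \in fs -> r v = 0) (v \in common_kernel T fs).
Proof.
apply: (iffP idP) => [|[vT]].
  elim: fs => [|r fs IH] /=; first by split.
  move=> /memv_capP[/IH[vT H]]; rewrite memv_ker => /eqP rv; split=> // r'.
  by rewrite inE => /orP[/eqP->|/H].
elim: fs => [|r fs IH] //= H; apply/memv_capP; split.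
  by apply: IH => r' r'fs; apply: H; rewrite inE r'fs orbT.
by rewrite memv_ker H ?mem_head.
Qed.

Lemma dim_common_kernel T fs : (\dim T <= \dim (common_kernel T fs) + size fs)%N.
Proof.
elim: fs => [|r fs IH] /=; first by rewrite addn0.
apply: leq_trans IH _; rewrite -(limg_ker_dim r (common_kernel T fs)) addnS -addSn.
rewrite leq_add2r -addn1 leq_add2l; apply: leq_trans (dimvS (subvf _)) _.
by rewrite dimvf.
Qed.

(** A subspace spanned by vectors on which as many functionals restrict to a
    nondegenerate pairing is complemented by the common kernel of the
    functionals. *)
Lemma dual_split T (vs : seq V) (fs : seq 'Hom(V, k^o)) :
  size fs = size vs -> (forall v, v \in vs -> v \in T) ->
  (forall c : nat -> k, (forall r, r \in fs -> r (\sum_(i < size vs) c i *: vs`_i) = 0) ->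
     forall i, (i < size vs)%N -> c i = 0) ->
  [/\ free vs, (<<vs>> + common_kernel T fs)%VS = T
    & (<<vs>> :&: common_kernel T fs)%VS = 0%VS].
Proof.
move=> sz vsT nd.
have fvs : free vs.
  suff : free (in_tuple vs) by [].
  apply/freeP => c c0 i.
  have := nd (fun j => if insub j is Some j' then c j' else 0) _ i (ltn_ord i).
  rewrite valK; apply=> r _; rewrite (_ : \sum_(j < _) _ = 0) ?linear0 // -[RHS]c0.
  by apply: eq_bigr => j _; rewrite valK.
have cap0 : (<<vs>> :&: common_kernel T fs)%VS = 0%VS.
  apply/capv0P => v /(@coord_span _ _ _ (in_tuple vs)) ->; set co := coord _.
  move=> /common_kernelP[_ H]; apply: big1 => i _.
  have := nd (fun j => if insub j is Some j' then co j' v else 0) _ i (ltn_ord i).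
  rewrite valK => -> => [|r /H <-]; first by rewrite scale0r.
  by congr (r _); apply: eq_bigr => j _; rewrite valK.
split=> //; apply/eqP; rewrite eqEdim; apply/andP; split.
  rewrite subv_add; apply/andP; split; first exact/span_subvP.
  by apply/subvP => v /common_kernelP[].
rewrite dimv_disjoint_sum //; move: fvs; rewrite /free => /eqP ->.
by rewrite addnC -sz dim_common_kernel.
Qed.

Definition iterl f d : 'End(V) := iter d (fun h => f \o h)%VF \1%VF.

Lemma iterlE f d v : iterl f d v = iter d f v.
Proof. by elim: d => [|d IH]; rewrite ?id_lfunE //= comp_lfunE IH. Qed.

Lemma iterl_limg f d T : (iterl f d.+1 @: T = f @: (iterl f d @: T))%VS.
Proof. by rewrite -limg_comp. Qed.

Lemma iterl_sub f d T : (f @: T <= T)%VS -> (iterl f d @: T <= T)%VS.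
Proof.
move=> fT; elim: d => [|d IH]; first by rewrite lim1g.
by rewrite iterl_limg; apply: subv_trans fT; apply: limgS.
Qed.

Lemma fitting f T : (f @: T <= T)%VS -> exists d,
  [/\ (0 < d)%N, ((T :&: lker (iterl f d)) + iterl f d @: T = T)%VS
    & ((T :&: lker (iterl f d)) :&: iterl f d @: T = 0)%VS].
Proof.
move=> fT.
have dec d : (iterl f d.+1 @: T <= iterl f d @: T)%VS.
  elim: d => [|d IH]; first by rewrite iterl_limg lim1g.
  by rewrite iterl_limg [X in (_ <= X)%VS]iterl_limg limgS.
have [d d0 dE] : exists2 d, (0 < d)%N & (iterl f d.+1 @: T = iterl f d @: T)%VS.
  suff H n : (exists2 d, (0 < d)%N & (\dim (iterl f d @: T) <= n)%N) ->
      exists2 d, (0 < d)%N & (iterl f d.+1 @: T = iterl f d @: T)%VS.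
    by apply: (H (\dim (iterl f 1 @: T))); exists 1%N.
  elim: n => [|n IH] [d d0 le].
    by exists d => //; apply/eqP; rewrite eqEdim dec (leq_trans le).
  have [E|E] := eqVneq (iterl f d.+1 @: T)%VS (iterl f d @: T)%VS; first by exists d.
  apply: IH; exists d.+1 => //; rewrite -ltnS; apply: leq_trans le.
  by rewrite ltnNge; apply: contra E => E; rewrite eqEdim dec.
have cap0 : ((T :&: lker (iterl f d)) :&: iterl f d @: T = 0)%VS.
  set B := (iterl f d @: T)%VS in dE *.
  have finj v : v \in B -> f v = 0 -> v = 0.
    have : (B :&: lker f)%VS = 0%VS.
      apply/eqP; rewrite -dimv_eq0; have := limg_ker_dim f B.
      by rewrite -iterl_limg dE -{2}[\dim B]add0n => /addIn ->.
    by move/capv0P => H vB fv; apply: H => //; rewrite memv_ker fv.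
  have fB v : v \in B -> f v \in B.
    by move=> vB; rewrite -dE iterl_limg memv_img.
  have iinj e v : iter e f v = 0 -> v \in B -> v = 0.
    elim: e v => [|e IH] v; first by move=> /= ->.
    by rewrite iterSr => fv vB; apply: finj => //; apply: IH => //; apply: fB.
  by apply/capv0P => v /memv_capP[_]; rewrite memv_ker iterlE => /eqP; apply: iinj.
exists d; split=> //; apply/eqP; rewrite eqEdim subv_add capvSl iterl_sub //=.
by rewrite dimv_disjoint_sum // limg_ker_dim.
Qed.

End LinearAlgebra.

Lemma eigenvector_in (k : closedFieldType) (V : vectType k) (f : 'End(V)) (T : {vspace V}) :
  (f @: T <= T)%VS -> T != 0%VS ->
  exists m w, [/\ w \in T, w != 0 & f w = m *: w].
Proof.
move=> fT T0; pose X := vbasis T; pose n := \dim T.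
pose A : 'M[k]_n := \matrix_(i, j) coord X j (f X`_i).
have /closed_rootP[m] : size (char_poly A) != 1%N.
  rewrite size_char_poly eqSS -/n /n dimv_eq0 //.
rewrite -eigenvalue_root_char => /eigenvalueP[v vA v0].
have fX (i : 'I_n) : f X`_i = \sum_j A i j *: X`_j.
  have fXT : f X`_i \in T.
    by apply: (subvP fT); apply: memv_img; apply: vbasis_mem; rewrite mem_nth ?size_tuple.
  by rewrite {1}(coord_vbasis fXT); apply: eq_bigr => j _; rewrite mxE.
exists m, (\sum_i v 0 i *: X`_i); split.
- by apply: rpred_sum => i _; rewrite rpredZ // vbasis_mem // mem_nth ?size_tuple.
- apply: contra v0 => /eqP w0; apply/eqP/rowP => i; rewrite mxE.
  by have /freeP := basis_free (vbasisP T); apply.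
- rewrite linear_sum scaler_sumr /=.
  under eq_bigr do rewrite linearZ /= fX scaler_sumr.
  rewrite exchange_big; apply: eq_bigr => j _ /=.
  have := congr1 (fun M : 'rV_n => M 0 j) vA; rewrite !mxE scalerA => <-.
  by rewrite scaler_suml; apply: eq_bigr => i _; rewrite scalerA.
Qed.

(** * Indecomposable modules *)

Lemma shift_past_length b i j : (0 < b)%N -> (i < j)%N -> (b <= b.-1 - i + j)%N.
Proof. by lia. Qed.

Section DoubleModules.
Variables (k : closedFieldType) (xi : k).
Hypothesis xi2 : xi * xi = -1.
Hypothesis two_neq0 : 2 != 0 :> k.
Variables (V : vectType k) (a g u y : 'End(V)).
Implicit Types (U W T : {vspace V}) (X : seq V) (f : 'End(V)) (l m : k) (v w : V).

Record double_ops : Prop := DoubleOps {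
  do_a4 : forall v, a (a (a (a v))) = v;
  do_g4 : forall v, g (g (g (g v))) = v;
  do_ag : forall v, a (g v) = g (a v);
  do_au : forall v, a (u v) = xi *: u (a v);
  do_ay : forall v, a (y v) = - xi *: y (a v);
  do_gu : forall v, g (u v) = - u (g v);
  do_gy : forall v, g (y v) = - y (g v);
  do_uu : forall v, u (u v) = 0;
  do_yy : forall v, y (y v) = 0;
  do_yu : forall v, y (u v) = u (y v) + (g v - a (a v))
}.

Definition submod U :=
  forall v, v \in U -> [/\ a v \in U, g v \in U, u v \in U & y v \in U].

Definition indec := forall U W, submod U -> submod W ->
  (U + W)%VS = fullv -> (U :&: W)%VS = 0%VS -> U = 0%VS \/ W = 0%VS.

Definition roots4 : seq k := [:: 1; xi; -1; - xi].
(** Besides zero and the fourth roots of unity, the eigenvalues of g - a^2 occur. *)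
Definition monomial_scalars : seq k := 0 :: roots4 ++ [seq m - l | m <- roots4, l <- roots4].

Definition monomial_on X := forall x, x \in X -> forall f, f \in [:: a; g; u; y] ->
  exists2 x', x' \in X & exists2 l, l \in monomial_scalars & f x = l *: x'.

Definition monomial_basis X := basis_of fullv X /\ monomial_on X.

(** The operator y maps the span of e, f bijectively onto the span of s, r, and
    y^-1 u maps the spans of e and of f into each other.  The square of y^-1 u is
    a Jordan block of size b with eigenvalue m on each of them; the condition
    r b = 0 ends the block. *)
Definition band_basis (b : nat) l m (e f s r : nat -> V) :=
  [/\ basis_of fullv ([seq e i | i <- iota 0 b] ++ [seq f i | i <- iota 0 b]
        ++ ([seq s i | i <- iota 0 b] ++ [seq r i | i <- iota 0 b])),
      l ^+ 4 = 1 /\ r b = 0, forall v, g v = a (a v)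
    & forall i,
      [/\ [/\ a (e i) = l *: e i, a (f i) = - l *: f i,
              a (s i) = (xi * l) *: s i & a (r i) = - (xi * l) *: r i],
          [/\ u (e i) = s i, u (f i) = m *: r i + r i.+1, u (s i) = 0 & u (r i) = 0]
        & [/\ y (e i) = r i, y (f i) = s i, y (s i) = 0 & y (r i) = 0]]].

Hypothesis ops : double_ops.
Let a4 := do_a4 ops.

Lemma root4_monomial l : l ^+ 4 = 1 -> l \in monomial_scalars.
Proof. by move=> /(root4P xi2) lR; rewrite inE mem_cat lR orbT. Qed.

Lemma root4B_monomial l m : l ^+ 4 = 1 -> m ^+ 4 = 1 -> m - l \in monomial_scalars.
Proof.
move=> /(root4P xi2) lR /(root4P xi2) mR; rewrite inE mem_cat; apply/orP; right; apply/orP; right.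
by apply/allpairsP; exists (m, l).
Qed.

Lemma zero_monomial : 0 \in monomial_scalars.
Proof. exact: mem_head. Qed.

Lemma one_monomial : 1 \in monomial_scalars.
Proof. by apply: root4_monomial; rewrite expr1n. Qed.

Lemma xi4 : xi ^+ 4 = 1.
Proof. by ring: xi2. Qed.

Lemma mxi4 : (- xi) ^+ 4 = 1.
Proof. by ring: xi2. Qed.

Let uE W : equivariant a xi u W.
Proof. by move=> w _; apply: do_au. Qed.
Let yE W : equivariant a (- xi) y W.
Proof. by move=> w _; apply: do_ay. Qed.

(** An element that commutes with a and g and anticommutes with u and y, so that
    its kernel and image are submodules. *)
Definition linking : 'End(V) := g - (a \o a)%VF.

Lemma linkingE v : linking v = g v - a (a v).
Proof. by rewrite /linking add_lfunE opp_lfunE comp_lfunE. Qed.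

Let aau v : a (a (u v)) = - u (a (a v)).
Proof. by rewrite !(do_au ops) !linearZ /= !(do_au ops) scalerA xi2 scaleN1r. Qed.
Let aay v : a (a (y v)) = - y (a (a v)).
Proof. by rewrite !(do_ay ops) !linearZ /= !(do_ay ops) scalerA mulrNN xi2 scaleN1r. Qed.

Lemma linking_a v : linking (a v) = a (linking v).
Proof. by rewrite !linkingE linearB /= (do_ag ops). Qed.
Lemma linking_g v : linking (g v) = g (linking v).
Proof. by rewrite !linkingE linearB /= !(do_ag ops). Qed.
Lemma linking_u v : linking (u v) = - u (linking v).
Proof. by rewrite !linkingE linearB /= (do_gu ops) aau opprB opprK addrC. Qed.
Lemma linking_y v : linking (y v) = - y (linking v).
Proof. by rewrite !linkingE linearB /= (do_gy ops) aay opprB opprK addrC. Qed.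

(** On a vector n of the intersection, n = h v with h n = 0, the relation g^4 = 1
    gives v = g^4 v = v + 4 a^2 n, hence n = 0. *)
Lemma linking_split :
  [/\ submod (lker linking), submod (limg linking),
      (lker linking + limg linking)%VS = fullv & (lker linking :&: limg linking)%VS = 0%VS].
Proof.
have cap0 : (lker linking :&: limg linking)%VS = 0%VS.
  apply/capv0P => n; rewrite memv_ker => /eqP hn /memv_imgP[v _ nE].
  have gn : g n = a (a n) by apply/eqP; rewrite -subr_eq0 -linkingE hn.
  have gv : g v = a (a v) + n by rewrite nE linkingE addrC subrK.
  have ggv : g (g v) = v + (a (a n) + a (a n)).
    by rewrite gv linearD /= gn -!(do_ag ops) gv !linearD /= a4 addrA.
  have ggn : g (g n) = n by rewrite gn -!(do_ag ops) gn a4.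
  have ggan : g (g (a (a n))) = a (a n) by rewrite -!(do_ag ops) ggn.
  have E := do_g4 ops v; rewrite ggv !linearD /= ggan ggv in E.
  have : 4%:R *: a (a n) = 0.
    apply: (addrI v); rewrite addr0 -[RHS]E -addrA; congr (_ + _).
    by rewrite scaler_nat !mulrSr mulr0n add0r !addrA.
  move/eqP; rewrite scaler_eq0 (natrM _ 2 2) mulf_eq0 (negbTE two_neq0) /= => /eqP aan.
  by rewrite -(a4 n) aan !linear0.
split=> //.
- move=> v; rewrite !memv_ker => /eqP hv.
  by rewrite linking_a linking_g linking_u linking_y hv !linear0 ?oppr0 !eqxx.
- move=> _ /memv_imgP[v _ ->]; rewrite -linking_a -linking_g.
  rewrite -[u _]opprK -[y _]opprK -linking_u -linking_y !memvN.
  by split; apply: memv_img; apply: memvf.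
- apply/eqP; rewrite eqEdim subvf dimv_disjoint_sum //=.
  by rewrite -(limg_ker_dim linking fullv) capfv.
Qed.

(** On the kernel of y the operator u is injective, because y u w = h w there; and
    h v = y u v - u y v lies in ker y + u (ker y), because y^2 = 0. *)
Lemma typical_monomial : lker linking = 0%VS -> exists X, monomial_basis X.
Proof.
move=> hker; have hinj v : linking v = 0 -> v = 0.
  by move=> hv; apply/eqP; rewrite -memv0 -hker memv_ker hv.
have g4 := do_g4 ops.
pose K := lker y.
have Ka w : w \in K -> a w \in K.
  rewrite !memv_ker => /eqP yw; have := do_ay ops w; rewrite yw linear0 => /esym/eqP.
  by rewrite scaler_eq0 (negbTE (root4_neq0 mxi4)).
have Kg w : w \in K -> g w \in K.
  by rewrite !memv_ker => /eqP yw; rewrite -oppr_eq0 -(do_gy ops) yw linear0.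
have [Y [hY spY]] : exists Y, (forall x, x \in Y -> homogeneous a x /\ homogeneous g x) /\ <<Y>>%VS = K.
  have [Y1 [h1 sp1]] := stable_span xi2 two_neq0 a4 Ka.
  have R4 l : l \in roots4 -> l ^+ 4 = 1.
    by rewrite !inE => /or4P[]/eqP->; ring: xi2.
  exists [seq wproj g l w | l <- roots4, w <- Y1]; split.
    move=> _ /allpairsP[[l w] /= [/R4 l4 wY ->]]; split; last exact: homogeneous_wproj.
    have [m m4 aw] := h1 w wY; exists m => //.
    have ga : equivariant g 1 a fullv by move=> x _; rewrite scale1r (do_ag ops).
    rewrite (wproj_equivariant _ (expr1n _ _) ga) ?memvf // => [|x _]; last exact: memvf.
    by rewrite mul1r aw linearZ.
  apply/eqP; rewrite eqEsubv; apply/andP; split.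
    apply/span_subvP => _ /allpairsP[[l w] /= [_ wY ->]].
    by apply: (wproj_stable l Kg); rewrite -sp1 memv_span.
  rewrite -{1}sp1; apply/span_subvP => w wY.
  have wp l : l \in roots4 -> wproj g l w \in <<[seq wproj g l w | l <- roots4, w <- Y1]>>%VS.
    by move=> lR; apply: memv_span; apply/allpairsP; exists (l, w).
  by rewrite (wproj_sum xi2 two_neq0 g w) !rpredD // wp // !inE eqxx ?orbT.
have [X [sX fX spX]] := @free_exchange _ _ [::] Y (nil_free _).
have {}spX : <<X>>%VS = K by rewrite -spY.
rewrite /= in fX.
have yX x : x \in K -> y x = 0 by rewrite memv_ker => /eqP.
have uinj w : w \in K -> u w = 0 -> w = 0.
  by move=> /yX yw uw; apply: (hinj); rewrite linkingE; have := do_yu ops w;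
     rewrite uw yw !linear0 add0r.
have inK x : x \in X -> x \in K by move=> xX; rewrite -spX memv_span.
exists (X ++ map u X); split.
  have fXu : free (X ++ map u X).
    apply/catP_free; split=> //.
      by apply: map_free => // v; rewrite spX; apply: uinj.
    move=> v; rewrite spX -limg_span spX => vK /memv_imgP[w wK vE].
    apply: (hinj); have := do_yu ops w; rewrite -linkingE (yX w) // linear0 add0r -vE (yX v) //.
    by move=> /esym/hinj w0; rewrite vE w0 !linear0.
  rewrite /basis_of fXu andbT eqEsubv subvf; apply/subvP => v _.
  have : v \in limg linking by rewrite (lker0_limgf) ?memvf // hker.
  move=> /memv_imgP[w _ ->]; have -> : linking w = y (u w) - u (y w).
    by rewrite linkingE (do_yu ops) addrAC subrr add0r.
  rewrite span_cat -limg_span spX; apply: rpredB.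
    by apply: (subvP (addvSl _ _)); rewrite memv_ker (do_yy ops).
  apply: (subvP (addvSr _ _)); apply: memv_img; by rewrite memv_ker (do_yy ops).
move=> x xX f; rewrite !inE.
have hx z : z \in X -> homogeneous a z /\ homogeneous g z by move=> /sX/hY.
move: xX; rewrite mem_cat => /orP[xX|/mapP[z zX ->]].
  have [[l l4 al] [m m4 gm]] := hx x xX; have xin : x \in X ++ map u X by rewrite mem_cat xX.
  case/or4P => /eqP->.
  - by exists x => //; exists l; rewrite ?root4_monomial.
  - by exists x => //; exists m; rewrite ?root4_monomial.
  - by exists (u x); [rewrite mem_cat map_f ?orbT | exists 1; rewrite ?one_monomial ?scale1r].
  - by exists x => //; exists 0; rewrite ?zero_monomial // yX ?inK // scale0r.
have [[l l4 al] [m m4 gm]] := hx z zX.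
have zin : u z \in X ++ map u X by rewrite mem_cat map_f ?orbT.
case/or4P => /eqP->.
- exists (u z) => //; exists (xi * l); first by apply/root4_monomial/root4M => //; apply: xi4.
  by rewrite (do_au ops) al linearZ scalerA.
- exists (u z) => //; exists (- m); first by apply: root4_monomial; rewrite exprNn m4 -signr_odd expr0 mul1r.
  by rewrite (do_gu ops) gm linearZ scaleNr.
- by exists (u z) => //; exists 0; rewrite ?zero_monomial // (do_uu ops) scale0r.
- exists z; first by rewrite mem_cat zX.
  exists (m - l * l); first by apply: root4B_monomial => //; apply: root4M.
  by rewrite (do_yu ops) yX ?inK // linear0 add0r gm al linearZ /= al scalerA scalerBl.
Qed.

Lemma submod_span X :
  (forall x, x \in X -> [/\ a x \in <<X>>%VS, g x \in <<X>>%VS, u x \in <<X>>%VS & y x \in <<X>>%VS]) ->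
  submod <<X>>%VS.
Proof.
move=> H; have st f : (forall x, x \in X -> f x \in <<X>>%VS) ->
    forall v, v \in <<X>>%VS -> f v \in <<X>>%VS.
  move=> fX v /(memv_img f); apply: subvP; rewrite limg_span.
  by apply/span_subvP => _ /mapP[x /fX ? ->].
by move=> v vX; split; apply: st vX => x /H[].
Qed.

Lemma monomial_submod X : monomial_on X -> submod <<X>>%VS.
Proof.
move=> H; apply: submod_span => x xX; have {}H f : f \in [:: a; g; u; y] -> f x \in <<X>>%VS.
  by move=> /(H x xX)[x' x'X [l _ ->]]; rewrite rpredZ // memv_span.
by split; apply: H; rewrite !inE eqxx ?orbT.
Qed.

Section PrincipalBlock.
Hypothesis link0 : forall v, linking v = 0.

Lemma link0_g v : g v = a (a v).
Proof. by apply/eqP; rewrite -subr_eq0 -linkingE link0. Qed.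

Lemma link0_yu v : y (u v) = u (y v).
Proof. by rewrite (do_yu ops) -linkingE link0 addr0. Qed.

Lemma link0_ua v : u (a v) = - xi *: a (u v).
Proof. by rewrite (do_au ops) scalerA mulNr xi2 opprK scale1r. Qed.

Lemma link0_ya v : y (a v) = xi *: a (y v).
Proof. by rewrite (do_ay ops) scalerA mulrN xi2 opprK scale1r. Qed.

Lemma monomial_homogeneous X l x : x \in X -> l ^+ 4 = 1 -> a x = l *: x ->
  forall f, f \in [:: a; g] ->
  exists2 x', x' \in X & exists2 m, m \in monomial_scalars & f x = m *: x'.
Proof.
move=> xX l4 ax f; rewrite !inE => /orP[]/eqP->; exists x => //.
  by exists l => //; apply: root4_monomial.
exists (l * l); first by apply/root4_monomial/root4M.
by rewrite link0_g ax linearZ /= ax scalerA.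
Qed.

(** For a homogeneous w with uyw != 0 and a functional f of the same weight with
    f(uyw) != 0, the functionals f u y, f y, f u, f pair nondegenerately with the
    vectors w, uw, yw, uyw.  Their common kernel is a submodule, so w generates
    a direct summand. *)
Lemma projective_monomial : indec -> (exists v, u (y v) != 0) ->
  exists X, monomial_basis X.
Proof.
move=> ind [v0 uyv0].
have [l [w [l4 aw uyw]]] : exists l w, [/\ l ^+ 4 = 1, a w = l *: w & u (y w) != 0].
  have R4 l : l \in roots4 -> l ^+ 4 = 1.
    by rewrite !inE => /or4P[]/eqP->; ring: xi2.
  have [/hasP[l lR nz]|/hasPn H] := boolP (has (fun l => u (y (wproj a l v0)) != 0) roots4).
    exists l, (wproj a l v0); split=> //; first exact: R4.
    by apply: wproj_weight => //; apply: R4.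
  move: uyv0; rewrite (wproj_sum xi2 two_neq0 a v0) !linearD /=.
  have H' l : l \in roots4 -> u (y (wproj a l v0)) = 0 by move=> /H/negbNE/eqP.
  by rewrite !H' ?addr0 ?eqxx // !inE eqxx ?orbT.
have [f0 f0w] := functional_neq0 uyw.
pose f : 'Hom(V, k^o) := (f0 \o wproj a l)%VF.
have fa x : f (a x) = l * f x.
  rewrite !comp_lfunE; have aa : equivariant a 1 a fullv by move=> z _; rewrite scale1r.
  have := wproj_equivariant l (expr1n _ _) aa (fun _ _ => memvf _) (memvf x).
  by rewrite mul1r => <-; rewrite wproj_weight // linearZ.
have auyw : a (u (y w)) = l *: u (y w).
  rewrite (do_au ops) (do_ay ops) aw !linearZ /= !scalerA.
  by congr (_ *: _); ring: xi2.
have fw : f (u (y w)) != 0 by rewrite comp_lfunE wproj_id.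
clearbody f.
pose vs := [:: w; u w; y w; u (y w)].
pose fs : seq 'Hom(V, k^o) := [:: (f \o (u \o y))%VF; (f \o y)%VF; (f \o u)%VF; f].
have inX x : x \in common_kernel fullv fs <->
    [/\ f x = 0, f (u x) = 0, f (y x) = 0 & f (u (y x)) = 0].
  split=> [/common_kernelP[_ H]|[f1 f2 f3 f4]].
    have in_fs r : r \in fs -> r x = 0 by exact: H.
    split; first by apply: in_fs; rewrite !inE eqxx ?orbT.
    - by rewrite -comp_lfunE; apply: in_fs; rewrite !inE eqxx ?orbT.
    - by rewrite -comp_lfunE; apply: in_fs; rewrite !inE eqxx ?orbT.
    - by rewrite -(comp_lfunE u) -comp_lfunE; apply: in_fs; rewrite !inE eqxx ?orbT.
  apply/common_kernelP; split=> [|r]; first exact: memvf.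
  by rewrite !inE => /or4P[]/eqP->; rewrite ?comp_lfunE.
have [//|x _|c Hc|fvs sumV capV] := @dual_split _ _ fullv vs fs; first exact: memvf.
  pose x := c 0%N *: w + c 1%N *: u w + c 2%N *: y w + c 3%N *: u (y w).
  have /inX : x \in common_kernel fullv fs.
    apply/common_kernelP; split=> [|r /Hc <-]; first exact: memvf.
    by rewrite /x !big_ord_recl big_ord0 addr0 !addrA.
  have ux : u x = c 0%N *: u w + c 2%N *: u (y w).
    by rewrite /x !linearD !linearZ /= !(do_uu ops) !scaler0 !addr0.
  have yx : y x = c 0%N *: y w + c 1%N *: u (y w).
    rewrite /x !linearD !linearZ /= !link0_yu !(do_yy ops) !linear0 ?scaler0 ?addr0.
    by [].
  have uyx : u (y x) = c 0%N *: u (y w).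
    by rewrite yx linearD !linearZ /= (do_uu ops) scaler0 addr0.
  rewrite uyx yx ux /x !linearD !linearZ /=.
  move=> [e1 e2 e3 e4].
  have z t : t *: f (u (y w)) = 0 -> t = 0.
    by move/eqP; rewrite scaler_eq0 (negbTE fw) orbF => /eqP.
  have c0 := z _ e4; rewrite c0 !scale0r !add0r in e1 e2 e3.
  have c2 := z _ e2; have c1 := z _ e3; rewrite c1 c2 !scale0r !add0r in e1.
  have c3 := z _ e1.
  by case=> [|[|[|[|//]]]] _.
have mono : monomial_on vs.
  have zero x : x \in vs -> exists2 x', x' \in vs & exists2 m, m \in monomial_scalars & 0 = m *: x'.
    by move=> xv; exists x => //; exists 0; rewrite ?zero_monomial ?scale0r.
  have one x : x \in vs -> exists2 x', x' \in vs & exists2 m, m \in monomial_scalars & x = m *: x'.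
    by move=> xv; exists x => //; exists 1; rewrite ?one_monomial ?scale1r.
  have [m1 m2 m3 m4] : [/\ w \in vs, u w \in vs, y w \in vs & u (y w) \in vs].
    by rewrite !inE !eqxx ?orbT.
  have x4 := xi4; have mx4 := mxi4.
  have auw : a (u w) = (xi * l) *: u w by rewrite (do_au ops) aw linearZ scalerA.
  have ayw : a (y w) = (- xi * l) *: y w by rewrite (do_ay ops) aw linearZ scalerA.
  have split4 (h : 'End(V)) : h \in [:: a; g; u; y] -> [\/ h \in [:: a; g], h = u | h = y].
    by rewrite !inE => /or4P[]/eqP->; rewrite ?eqxx ?orbT; [constructor 1|constructor 1|constructor 2|constructor 3].
  move=> x; rewrite !inE => /or4P[] /eqP-> h /split4[hag|->|->].
  - exact: (monomial_homogeneous m1 l4 aw).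
  - exact: one.
  - exact: one.
  - exact: (monomial_homogeneous m2 (root4M x4 l4) auw).
  - by rewrite (do_uu ops); exact: (zero _ m1).
  - by rewrite link0_yu; exact: (one _ m4).
  - exact: (monomial_homogeneous m3 (root4M mx4 l4) ayw).
  - exact: one.
  - by rewrite (do_yy ops); exact: (zero _ m1).
  - exact: (monomial_homogeneous m4 l4 auyw).
  - by rewrite (do_uu ops); exact: (zero _ m1).
  - by rewrite link0_yu (do_yy ops) linear0; exact: (zero _ m1).
have subX : submod (common_kernel fullv fs).
  have aX x : x \in common_kernel fullv fs -> a x \in common_kernel fullv fs.
    move=> /inX[f1 f2 f3 f4]; apply/inX.
    rewrite link0_ua link0_ya !linearZ /= link0_ua !linearZ /= !fa f1 f2 f3 f4.
    by rewrite !mulr0 !scaler0.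
  move=> x xX; rewrite link0_g; split; [exact: aX | by apply/aX/aX | |].
    have /inX[f1 f2 f3 f4] := xX; apply/inX.
    by rewrite link0_yu !(do_uu ops) !linear0.
  have /inX[f1 f2 f3 f4] := xX; apply/inX.
  by rewrite !(do_yy ops) !linear0.
exists vs; split=> //.
have [U0|X0] := ind _ _ (monomial_submod mono) subX sumV capV.
  by move: (memv_span (mem_head w [:: u w; y w; u (y w)])); rewrite U0 memv0 => /eqP w0;
     move: uyw; rewrite w0 !linear0 eqxx.
by rewrite /basis_of fvs -sumV X0 addv0 eqxx.
Qed.

Section Band.
Let aD v w : a (v + w) = a v + a w. Proof. exact: linearD. Qed.
Let aN v : a (- v) = - a v. Proof. exact: linearN. Qed.
Let aZ l v : a (l *: v) = l *: a v. Proof. exact: linearZ. Qed.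
Variables (T S : {vspace V}).
Hypothesis sT : stable a T.
Hypotheses (TS : (T + S)%VS = fullv) (TS0 : (T :&: S)%VS = 0%VS).
Hypotheses (uT : (u @: T)%VS = S) (yT : (y @: T)%VS = S).
Hypotheses (uinj : forall t, t \in T -> u t = 0 -> t = 0).
Hypotheses (yinj : forall t, t \in T -> y t = 0 -> t = 0).
Hypotheses (uS : forall t, t \in S -> u t = 0) (yS : forall t, t \in S -> y t = 0).

(** The operator [y^-1 u] on [T]. *)
Definition monodromy : 'End(V) := (projv T \o ((y \o projv T)^-1 \o u))%VF.
Local Notation N := monodromy.

Lemma monodromyT t : N t \in T.
Proof. by rewrite comp_lfunE memv_proj. Qed.

Lemma y_monodromy t : t \in T -> y (N t) = u t.
Proof.
move=> tT; rewrite !comp_lfunE -comp_lfunE limg_lfunVK //.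
by rewrite limg_comp limg_proj yT -uT memv_img.
Qed.

Lemma monodromy_inj t : t \in T -> N t = 0 -> t = 0.
Proof. by move=> tT Nt; apply: uinj => //; rewrite -y_monodromy // Nt linear0. Qed.

Lemma yinj_eq t t' : t \in T -> t' \in T -> y t = y t' -> t = t'.
Proof.
move=> tT t'T E; apply/eqP; rewrite -subr_eq0; apply/eqP/yinj; first exact: rpredB.
by rewrite linearB /= E subrr.
Qed.

(** u and y shift weights by xi and - xi, so y^-1 u shifts them by -1. *)
Lemma a_monodromy t : t \in T -> a (N t) = - N (a t).
Proof.
move=> tT; apply: yinj_eq; rewrite ?memvN ?monodromyT ?sT ?monodromyT //.
rewrite link0_ya y_monodromy // linearN /= y_monodromy ?sT // (do_au ops).
by rewrite scalerA xi2 scaleN1r.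
Qed.

Lemma monodromy_surj t : t \in T -> exists2 t', t' \in T & t = N t'.
Proof.
move=> tT; have : (N @: T)%VS = T.
  apply/eqP; rewrite eqEdim; apply/andP; split.
    by apply/subvP => _ /memv_imgP[x _ ->]; apply: monodromyT.
  rewrite limg_dim_eq //; apply/capv0P => v vT; rewrite memv_ker => /eqP.
  exact: monodromy_inj.
by move=> NT; move: tT; rewrite -{1}NT => /memv_imgP[t' ? ?]; exists t'.
Qed.

(** The subspaces of T that, together with their images under y, are submodules. *)
Definition saturated U := forall t, t \in U -> [/\ t \in T, a t \in U & N t \in U].

Lemma saturated_submod U : saturated U -> submod (U + (y @: U)).
Proof.
move=> sU.
have aU t : t \in U -> a t \in U by move=> /sU[].
have aUy v : v \in (U + (y @: U))%VS -> a v \in (U + (y @: U))%VS.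
  move=> /memv_addP[t tU [_ /memv_imgP[t' t'U ->] ->]].
  rewrite linearD /= (do_ay ops); apply: memv_add; first exact: aU.
  by rewrite rpredZ // memv_img // aU.
have vS t : t \in U -> y t \in S by move=> /sU[tT _ _]; rewrite -yT memv_img.
move=> v vU; rewrite link0_g; split; [exact: aUy | by apply/aUy/aUy | |].
  move: vU => /memv_addP[t tU [_ /memv_imgP[t' t'U ->] ->]].
  rewrite linearD /= (uS (vS _ t'U)) addr0; have [tT _ NU] := sU t tU.
  by apply: (subvP (addvSr _ _)); rewrite -y_monodromy // memv_img.
move: vU => /memv_addP[t tU [_ /memv_imgP[t' t'U ->] ->]].
rewrite linearD /= (yS (vS _ t'U)) addr0.
by apply: (subvP (addvSr _ _)); rewrite memv_img.
Qed.

Lemma saturated_indec : indec -> forall U W, saturated U -> saturated W ->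
  (forall t, t \in T -> exists2 x, x \in U & t - x \in W) ->
  (forall t, t \in U -> t \in W -> t = 0) ->
  (forall t, t \in U -> t = 0) \/ (forall t, t \in W -> t = 0).
Proof.
move=> ind U W sU sW UW UW0.
have inT Q t : saturated Q -> t \in Q -> t \in T by move=> sQ /sQ[].
have inS Q t : saturated Q -> t \in (y @: Q)%VS -> t \in S.
  by move=> sQ /memv_imgP[x /(inT _ _ sQ) xT ->]; rewrite -yT memv_img.
have z Q : (Q + (y @: Q))%VS = 0%VS -> forall t, t \in Q -> t = 0.
  by move=> Q0 t tX; apply/eqP; rewrite -memv0 -Q0; apply: (subvP (addvSl _ _)).
have [||/z|/z] := ind _ _ (saturated_submod sU) (saturated_submod sW); [| | by left | by right].
  apply/eqP; rewrite eqEsubv subvf -TS -{1}yT.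
  have TUW : (T <= U + W)%VS.
    by apply/subvP => t /UW[x xU xW]; rewrite -(subrKC x t) memv_add.
  rewrite -addvA (addvC (y @: U)%VS) -addvA addvA -limgD (addvC W U).
  by rewrite addvS // limgS // addvC.
apply/capv0P => _ /memv_addP[t tU [s syU ->]] /memv_addP[t' t'W [s' s'W E]].
have tT := inT _ _ sU tU; have t'T := inT _ _ sW t'W.
have sS := inS _ _ sU syU; have s'S := inS _ _ sW s'W.
have d : t - t' = s' - s.
  by apply/eqP; rewrite subr_eq addrAC -subr_eq opprK E addrC.
have d0 : t - t' = 0.
  move/capv0P: TS0; apply; first exact: rpredB.
  by rewrite d rpredB.
have tt' : t = t' by apply/eqP; rewrite -subr_eq0 d0.
have ss' : s' = s by apply/eqP; rewrite -subr_eq0 -d d0.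
rewrite (UW0 t) ?tt' // -?tt' // add0r.
move: syU s'W; rewrite ss' => /memv_imgP[x xU ->] /memv_imgP[x' x'W] yE'.
have xx' : x = x' by apply: yinj_eq yE'; [exact: inT sU xU | exact: inT sW x'W].
by rewrite (UW0 x) ?linear0 // xx'.
Qed.

(** Decompositions of T into saturated subspaces are trivial.  Since a^2 commutes
    with N := y^-1 u, its eigenspaces in T are saturated, so a^2 acts on T by one
    scalar l^2, and T is the sum of the weight spaces Tl and N Tl for l and - l.
    A decomposition of Tl that is stable under N^2 extends to a saturated one,
    so Tl is indecomposable under N^2.  By the Fitting decomposition N^2 has a
    single eigenvalue m there; a vector not killed by (N^2 - m)^(b - 1), where
    b is the order of nilpotency of N^2 - m, and a functional that detects this
    split off a Jordan block of size b; hence Tl is this block. *)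
Lemma band_structure : indec -> T != 0%VS ->
  exists b l m e e' s r, band_basis b l m e e' s r.
Proof.
move=> ind T0.
have [l [t0 [l4 t0T t00 at0]]] : exists l t, [/\ l ^+ 4 = 1, t \in T, t != 0 & a t = l *: t].
  have R4 l : l \in roots4 -> l ^+ 4 = 1.
    by rewrite !inE => /or4P[]/eqP->; ring: xi2.
  have [/hasP[l lR nz]|/hasPn H] := boolP (has (fun l => wproj a l (vpick T) != 0) roots4).
    exists l, (wproj a l (vpick T)); split=> //; first exact: R4.
      by apply: wproj_stable => //; apply: memv_pick.
    by apply: wproj_weight => //; apply: R4.
  move: T0; rewrite -vpick0 (wproj_sum xi2 two_neq0 a (vpick T)).
  have H' l : l \in roots4 -> wproj a l (vpick T) = 0 by move=> /H/negbNE/eqP.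
  by rewrite !H' ?addr0 ?eqxx // !inE eqxx ?orbT.
have ll : (l * l) * (l * l) = 1 by rewrite -l4 !exprS expr0 mulr1 !mulrA.
(* the eigenspaces of a^2 for l^2 and - l^2 are saturated and decompose T *)
have a2 t : t \in T -> a (a t) = (l * l) *: t.
  pose E (c : k) : {vspace V} := (T :&: lker ((a \o a)%VF - c *: \1%VF))%VS.
  have EP c t' : t' \in E c <-> t' \in T /\ a (a t') = c *: t'.
    rewrite memv_cap memv_ker add_lfunE opp_lfunE scale_lfunE comp_lfunE id_lfunE subr_eq0.
    by split=> [/andP[-> /eqP]|[-> ->]] //; rewrite eqxx.
  have sE c : saturated (E c).
    move=> t' /EP[t'T at']; split=> //; apply/EP; rewrite ?sT ?monodromyT //; split=> //.
      by rewrite at' linearZ.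
    by rewrite a_monodromy // linearN /= a_monodromy ?sT // opprK at' linearZ.
  have [|x /EP[_ x1] /EP[_]||E0 tT] := saturated_indec ind (sE (l * l)) (sE (- (l * l))).
  - move=> x xT; exists (2^-1 *: (x + (l * l) *: a (a x))).
      apply/EP; split; first by rewrite rpredZ // rpredD // rpredZ // !sT.
      rewrite !(aD, aN, aZ) a4.
      by apply: eq_scalar_tests => r rD rN rZ _; rewrite !(rD, rN, rZ); ring: ll.
    apply/EP; split; first by rewrite rpredB // rpredZ // rpredD // rpredZ // !sT.
    have -> : x - 2^-1 *: (x + (l * l) *: a (a x)) = 2^-1 *: (x - (l * l) *: a (a x)).
      by apply: eq_scalar_tests => r rD rN rZ _; rewrite !(rD, rN, rZ); field.
    rewrite !(aD, aN, aZ) a4.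
    by apply: eq_scalar_tests => r rD rN rZ _; rewrite !(rD, rN, rZ); ring: ll.
  - rewrite x1 => /eqP; rewrite -subr_eq0 -scalerBl opprK scaler_eq0.
    rewrite -mulr2n -mulr_natl !mulf_eq0 (negbTE two_neq0) (negbTE (root4_neq0 l4)) /=.
    by move/eqP.
  - move=> E0; have : t0 = 0 by apply: E0; apply/EP; rewrite at0 linearZ /= at0 scalerA.
    by move/eqP; rewrite (negbTE t00).
  - have : t - 2^-1 *: (t + (l * l) *: a (a t)) = 0.
      apply: E0; apply/EP; split; first by rewrite rpredB // rpredZ // rpredD // rpredZ // !sT.
      have -> : t - 2^-1 *: (t + (l * l) *: a (a t)) = 2^-1 *: (t - (l * l) *: a (a t)).
        by apply: eq_scalar_tests => r rD rN rZ _; rewrite !(rD, rN, rZ); field.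
      rewrite !(aD, aN, aZ) a4.
      by apply: eq_scalar_tests => r rD rN rZ _; rewrite !(rD, rN, rZ); ring: ll.
    move=> /eqP; rewrite subr_eq0 => /eqP tE.
    have tE2 : t = (l * l) *: a (a t).
      apply: eq_scalar_tests => r rD rN rZ _; have := congr1 r tE; rewrite !(rD, rZ) => E1.
      have : 2 * r t = r t + l * l * r (a (a t)) by rewrite [in LHS]E1; field.
      by rewrite mulr_natl mulr2n => /addrI.
    by rewrite [in RHS]tE2 scalerA ll scale1r.
pose Tl : {vspace V} := (T :&: lker (a - l *: \1%VF))%VS.
have TlP t : t \in Tl <-> t \in T /\ a t = l *: t.
  rewrite memv_cap memv_ker add_lfunE opp_lfunE scale_lfunE id_lfunE subr_eq0.
  by split=> [/andP[-> /eqP]|[-> ->]] //; rewrite eqxx.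
have l3 : l * l ^+ 3 = 1 by rewrite -exprS.
have half t : t \in T -> exists p q, [/\ t = p + q, p \in Tl, q \in T & a q = - l *: q].
  move=> tT; exists (2^-1 *: (t + l ^+ 3 *: a t)), (2^-1 *: (t - l ^+ 3 *: a t)).
  have aE : l ^+ 3 *: a (a t) = l *: t.
    by rewrite a2 // scalerA; congr (_ *: _); rewrite -[RHS]mul1r -ll; ring.
  split.
  - by apply: eq_scalar_tests => r rD rN rZ _; rewrite !(rD, rN, rZ); field.
  - apply/TlP; split; first by rewrite rpredZ // rpredD // rpredZ // sT.
    rewrite !(aD, aN, aZ) aE.
    by apply: eq_scalar_tests => r rD rN rZ _; rewrite !(rD, rN, rZ); ring: l4.
  - by rewrite rpredZ // rpredB // rpredZ // sT.
  - rewrite !(aD, aN, aZ) aE.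
    by apply: eq_scalar_tests => r rD rN rZ _; rewrite !(rD, rN, rZ); ring: l4.
have weight0 t : a t = l *: t -> a t = - l *: t -> t = 0.
  move=> -> /eqP; rewrite -subr_eq0 -scalerBl opprK scaler_eq0.
  rewrite -mulr2n -mulr_natl mulf_eq0 (negbTE two_neq0) (negbTE (root4_neq0 l4)) /=.
  by move/eqP.
have NTl t : t \in Tl -> a (N t) = - l *: N t.
  by move=> /TlP[tT at']; rewrite a_monodromy // at' linearZ scaleNr.
have phiTl t : t \in Tl -> N (N t) \in Tl.
  move=> tTl; apply/TlP; split; first exact: monodromyT.
  by rewrite a_monodromy ?monodromyT // NTl // scaleNr linearN linearZ opprK.
have surj q : q \in T -> a q = - l *: q -> exists2 p, p \in Tl & q = N p.
  move=> qT aq; have [t tT qE] := monodromy_surj qT.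
  have [p [q' [tE pTl q'T aq']]] := half t tT; exists p => //.
  have Nq' : N q' = q - N p by rewrite qE tE linearD /= addrAC subrr add0r.
  suff Nq0 : N q' = 0 by rewrite qE tE linearD /= Nq0 addr0.
  apply: weight0; first by rewrite a_monodromy // aq' scaleNr linearN linearZ opprK.
  by rewrite Nq' linearB /= aq NTl // -scalerBr.
(* the weight space Tl is indecomposable under the square of N *)
have indl (X Z : {vspace V}) : (X <= Tl)%VS -> (Z <= Tl)%VS ->
    (forall x, x \in X -> N (N x) \in X) -> (forall x, x \in Z -> N (N x) \in Z) ->
    (X + Z)%VS = Tl -> (X :&: Z)%VS = 0%VS ->
    (forall x, x \in X -> x = 0) \/ (forall x, x \in Z -> x = 0).
  move=> XT ZT sX sZ XZ /capv0P XZ0.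
  have sat (Q : {vspace V}) : (Q <= Tl)%VS -> (forall x, x \in Q -> N (N x) \in Q) ->
      saturated (Q + (N @: Q))%VS.
    move=> QT sQ _ /memv_addP[x xQ [_ /memv_imgP[x' x'Q ->] ->]].
    have /TlP[xT ax] := subvP QT _ xQ; have x'T := subvP QT _ x'Q.
    split; first by rewrite rpredD ?monodromyT.
      by rewrite linearD /= ax NTl // memv_add ?rpredZ ?memv_img.
    by rewrite linearD /= addrC memv_add ?memv_img ?sQ.
  have inU (Q : {vspace V}) x : x \in Q -> x \in (Q + (N @: Q))%VS.
    by apply: subvP; apply: addvSl.
  have [|t|UX|UZ] := saturated_indec ind (sat X XT sX) (sat Z ZT sZ).
  - move=> t tT; have [p [q [tE pTl qT aq]]] := half t tT.
    have [p' p'Tl qE] := surj q qT aq.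
    move: pTl p'Tl; rewrite -XZ => /memv_addP[x xX [z zZ pE]] /memv_addP[x' x'X [z' z'Z p'E]].
    exists (x + N x'); first by rewrite memv_add ?memv_img.
    have -> : t - (x + N x') = z + N z'.
      by rewrite tE qE pE p'E linearD /= opprD addrACA [x + z]addrC addrK [N x' + _]addrC addrK.
    by rewrite memv_add ?memv_img.
  - move=> /memv_addP[x xX [_ /memv_imgP[x' x'X ->] tE]].
    move=> /memv_addP[z zZ [_ /memv_imgP[z' z'Z ->] tE']].
    have xTl := subvP XT _ xX; have x'Tl := subvP XT _ x'X.
    have zTl := subvP ZT _ zZ; have z'Tl := subvP ZT _ z'Z.
    have d : x - z = N z' - N x'.
      by apply/eqP; rewrite subr_eq addrAC -subr_eq opprK -tE tE' addrC.
    have d0 : x - z = 0.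
      apply: weight0; first by have /TlP[] : x - z \in Tl by rewrite rpredB.
      by rewrite d linearB /= !NTl // scalerBr.
    have xz : x = z by apply/eqP; rewrite -subr_eq0 d0.
    have x0 : x = 0 by apply: XZ0 => //; rewrite xz.
    have xz' : z' - x' = 0.
      apply: monodromy_inj; last by rewrite linearB /= -d d0.
      by rewrite rpredB //; [have /TlP[] := z'Tl | have /TlP[] := x'Tl].
    have x'0 : x' = 0.
      by apply: XZ0 => //; move/eqP: xz'; rewrite subr_eq0 => /eqP <-.
    by rewrite tE x0 x'0 linear0 addr0.
  - by left=> x /inU/UX.
  - by right=> x /inU/UZ.
have Tl0 : Tl != 0%VS.
  by apply: contra t00 => /eqP Tl0; rewrite -memv0 -Tl0; apply/TlP.
have phiE t : (N \o N)%VF t = N (N t) by rewrite comp_lfunE.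
have [m [w [wTl w0 mw]]] : exists m w, [/\ w \in Tl, w != 0 & (N \o N)%VF w = m *: w].
  apply: eigenvector_in => //; apply/subvP => _ /memv_imgP[x xTl ->].
  by rewrite phiE phiTl.
(* nilpotent on Tl, as the eigenvector w excludes the other Fitting component;
b is the order of nilpotency *)
pose psi : 'End(V) := ((N \o N)%VF - m *: \1%VF).
have psiE t : psi t = N (N t) - m *: t.
  by rewrite add_lfunE opp_lfunE scale_lfunE id_lfunE phiE.
have stpsi (Q : {vspace V}) : (forall x, x \in Q -> psi x \in Q) ->
    forall x, x \in Q -> N (N x) \in Q.
  by move=> sQ x xQ; rewrite -(subrK (m *: x) (N _)) -psiE rpredD ?sQ ?rpredZ.
have psiTl t : t \in Tl -> psi t \in Tl.
  by move=> tTl; rewrite psiE rpredB ?phiTl ?rpredZ.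
have psiTlS : (psi @: Tl <= Tl)%VS by apply/subvP => _ /memv_imgP[x xTl ->]; apply: psiTl.
have iterTl d t : t \in Tl -> iter d psi t \in Tl.
  by move=> tTl; elim: d => //= d IH; apply: psiTl.
have [d [d0 sumTl capTl]] := fitting psiTlS.
have nil t : t \in Tl -> iter d psi t = 0.
  move=> tTl; have [||||H|H] := indl _ _ _ _ _ _ sumTl capTl.
  - exact: capvSl.
  - exact: iterl_sub.
  - apply: stpsi => x /memv_capP[xTl]; rewrite memv_ker iterlE => /eqP xd.
    by apply/memv_capP; rewrite psiTl // memv_ker iterlE -iterSr iterS xd linear0.
  - apply: stpsi => _ /memv_imgP[x xTl ->].
    by rewrite iterlE -iterS iterSr -iterlE memv_img // psiTl.
  - suff : w = 0 by move/eqP; rewrite (negbTE w0).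
    apply: H; apply/memv_capP; split=> //; rewrite memv_ker iterlE.
    case: d d0 {sumTl capTl} => // d _; rewrite iterSr psiE -phiE mw subrr.
    by elim: d => //= d /eqP ->; rewrite linear0.
  - by rewrite -iterlE; apply: H; rewrite memv_img.
have exb : exists b, (iterl psi b @: Tl)%VS == 0%VS.
  exists d; rewrite -subv0; apply/subvP => _ /memv_imgP[x xTl ->].
  by rewrite iterlE nil // mem0v.
case: (ex_minnP exb) => b /eqP bz bmin.
have b0 : (0 < b)%N.
  by case: b bz {bmin} => // /eqP; rewrite lim1g (negbTE Tl0).
have bzero t n : t \in Tl -> (b <= n)%N -> iter n psi t = 0.
  move=> tTl /subnK <-; rewrite iterD.
  have -> : iter b psi t = 0 by apply/eqP; rewrite -iterlE -memv0 -bz memv_img.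
  by elim: (n - b)%N => //= n' ->; rewrite linear0.
have [v vTl vb] : exists2 v, v \in Tl & iter b.-1 psi v != 0.
  have : (iterl psi b.-1 @: Tl)%VS != 0%VS.
    by apply/negP => /bmin; rewrite -{1}(prednK b0) ltnn.
  rewrite -vpick0 => nz; have /memv_imgP[v vTl E] := memv_pick (iterl psi b.-1 @: Tl)%VS.
  by exists v => //; rewrite -iterlE -E.
have [f fv] := functional_neq0 vb.
(* the pairing of vs with fs is antitriangular with the nonzero entry
f (psi ^ (b - 1) v) on the antidiagonal *)
pose vs := [seq iter i psi v | i <- iota 0 b].
pose fs : seq 'Hom(V, k^o) := [seq (f \o iterl psi i)%VF | i <- iota 0 b].
have szvs : size vs = b by rewrite size_map size_iota.
have vsE i : (i < b)%N -> vs`_i = iter i psi v.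
  by move=> ib; rewrite (nth_map 0%N) ?size_iota // nth_iota.
have memfs i : (i < b)%N -> (f \o iterl psi i)%VF \in fs.
  by move=> ib; apply/mapP; exists i; rewrite // mem_iota add0n.
have vsTl x : x \in vs -> x \in Tl by move=> /mapP[i _ ->]; apply: iterTl.
have [||fvs sumX capX] := @dual_split _ _ Tl vs fs _ vsTl; first by rewrite szvs size_map size_iota.
  move=> c Hc; rewrite szvs in Hc *.
  elim/ltn_ind => i IH ib.
  have ib' : (b.-1 - i < b)%N by rewrite -[X in (_ < X)%N](prednK b0) ltnS leq_subr.
  have := Hc _ (memfs _ ib'); rewrite comp_lfunE linear_sum.
  rewrite (bigD1 (Ordinal ib)) //= big1 => [|j ji]; last first.
    rewrite linearZ /= vsE //; have [ij|ij] := ltnP j i; first by rewrite IH // scale0r.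
    rewrite iterlE -iterD bzero ?scaler0 //.
    have {}ij : (i < j)%N by rewrite ltn_neqAle ij andbT eq_sym.
    exact: shift_past_length.
  rewrite addr0 !linearZ /= vsE // iterlE -iterD.
  rewrite subnK; last by rewrite -ltnS prednK.
  by move/eqP; rewrite scaler_eq0 (negbTE fv) orbF => /eqP.
have Tlvs : basis_of Tl vs.
  rewrite /basis_of fvs andbT; apply/eqP.
  have [||||H|H] := indl _ _ _ _ _ _ sumX capX.
  - exact/span_subvP.
  - by apply/subvP => x /common_kernelP[].
  - apply: stpsi => x /(memv_img psi); apply: subvP; rewrite limg_span.
    apply/span_subvP => _ /mapP[_ /mapP[i + ->] ->]; rewrite mem_iota add0n => /andP[_ ib].
    have [ib'|ib'] := ltnP i.+1 b.
      by apply: memv_span; apply/mapP; exists i.+1; rewrite ?mem_iota ?add0n.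
    by rewrite -iterS bzero ?mem0v.
  - apply: stpsi => x /common_kernelP[xTl H]; apply/common_kernelP; split; first exact: psiTl.
    move=> _ /mapP[i + ->]; rewrite mem_iota add0n => /andP[_ ib].
    rewrite comp_lfunE iterlE -iterSr; have [ib'|ib'] := ltnP i.+1 b.
      by have := H _ (memfs _ ib'); rewrite comp_lfunE iterlE.
    by rewrite bzero ?linear0.
  - suff v0 : v = 0 by move: vb; rewrite v0 -iterlE linear0 eqxx.
    by apply: H; apply: memv_span; apply/mapP; exists 0%N; rewrite ?mem_iota.
  - rewrite -sumX; apply/esym/addv_idPl/subvP => x /H ->; exact: mem0v.
pose e i := iter i psi v.
have eTl i : e i \in Tl by apply: iterTl.
have eT i : e i \in T by have /TlP[] := eTl i.
have ae i : a (e i) = l *: e i by have /TlP[] := eTl i.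
exists b, l, m, e, (fun i => N (e i)), (fun i => u (e i)), (fun i => y (e i)).
have bT : basis_of T (vs ++ map N vs).
  have NTl0 : (Tl :&: (N @: Tl))%VS = 0%VS.
    apply/capv0P => x /TlP[_ ax] /memv_imgP[z zTl xE].
    by apply: weight0 => //; rewrite xE NTl.
  have Nk0 : (Tl :&: lker N)%VS = 0%VS.
    by apply/capv0P => x /TlP[xT _]; rewrite memv_ker => /eqP; apply: monodromy_inj.
  suff <- : (Tl + (N @: Tl))%VS = T.
    by apply: cat_basis; [exact/directv_addP | | exact: limg_basis_of].
  apply/eqP; rewrite eqEsubv subv_add capvSl /=; apply/andP; split.
    by apply/subvP => _ /memv_imgP[x _ ->]; apply: monodromyT.
  apply/subvP => t tT; have [p [q [-> pTl qT aq]]] := half t tT.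
  by have [p' p'Tl ->] := surj q qT aq; rewrite memv_add ?memv_img.
have bS : basis_of S (map y (vs ++ map N vs)).
  rewrite -yT; apply: limg_basis_of => //.
  by apply/capv0P => x xT; rewrite memv_ker => /eqP; apply: yinj.
have bV : basis_of fullv ((vs ++ map N vs) ++ map y (vs ++ map N vs)).
  by rewrite -TS; apply: cat_basis => //; apply/directv_addP.
split.
- rewrite (perm_basis _ (_ : perm_eq _ ((vs ++ map N vs) ++ map y (vs ++ map N vs)))) //.
  rewrite catA; have -> : [seq N (e i) | i <- iota 0 b] = map N vs by rewrite -map_comp.
  rewrite perm_cat2l map_cat perm_catC -!map_comp; apply: perm_cat => //.
  suff -> : [seq u (e i) | i <- iota 0 b] = [seq (y \o (N \o (fun i => iter i psi v))) i | i <- iota 0 b] by [].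
  by apply: eq_map => i /=; rewrite (y_monodromy (eT i)).
- by split=> //; rewrite /e bzero // linear0.
- exact: link0_g.
move=> i; have uSe j : u (e j) \in S by rewrite -uT memv_img.
have ySe j : y (e j) \in S by rewrite -yT memv_img.
split; split.
- exact: ae.
- exact: NTl.
- by rewrite (do_au ops) ae linearZ scalerA.
- by rewrite (do_ay ops) ae linearZ scalerA mulNr.
- by [].
- rewrite -y_monodromy ?monodromyT // -[N (N _)](subrK (m *: e i)) -psiE linearD linearZ /=.
  by rewrite addrC.
- exact: uS.
- exact: uS.
- by [].
- exact: y_monodromy.
- exact: yS.
- exact: yS.
Qed.

End Band.

(** The strings and the bijective part of the decomposition of the pencil are
    complementary submodules, so one of them is zero. *)
Lemma string_or_band : indec -> (forall v, u (y v) = 0) ->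
  (exists X, monomial_basis X) \/ (exists b l m e e' s r, band_basis b l m e e' s r).
Proof.
move=> ind uy0.
pose S := (limg u + limg y)%VS.
have uS t : t \in S -> u t = 0.
  move=> /memv_addP[_ /memv_imgP[x _ ->] [_ /memv_imgP[z _ ->] ->]].
  by rewrite linearD /= (do_uu ops) uy0 addr0.
have yS t : t \in S -> y t = 0.
  move=> /memv_addP[_ /memv_imgP[x _ ->] [_ /memv_imgP[z _ ->] ->]].
  by rewrite linearD /= (do_yy ops) link0_yu uy0 addr0.
have uIS v : u v \in S by apply: (subvP (addvSl _ _)); rewrite memv_img ?memvf.
have yIS v : y v \in S by apply: (subvP (addvSr _ _)); rewrite memv_img ?memvf.
have sS : stable a S.
  move=> _ /memv_addP[_ /memv_imgP[x _ ->] [_ /memv_imgP[z _ ->] ->]].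
  by rewrite linearD /= (do_au ops) (do_ay ops); apply: rpredD; apply: rpredZ.
have sV : stable a fullv by move=> v _; apply: memvf.
have [T [sT TS TS0]] := stable_complement xi2 two_neq0 a4 sS sV (subvf S).
have gp : graded_pencil a xi (- xi) u y T S.
  split=> //; first by split; [exact: xi4 | exact: mxi4].
  by split; apply/subvP => _ /memv_imgP[t _ ->].
have [BT [BS [L [hTL hBS [bT bS] uyL [[u1 _] [y1 _]]]]]] :=
  string_band_decomposition xi2 two_neq0 a4 gp.
have memT t : t \in BT ++ L -> t \in T by move=> /memv_span; rewrite (span_basis bT).
have memS t : t \in BS -> t \in S.
  by move=> tB; rewrite -(span_basis bS) memv_span // mem_cat tB.
have bV : basis_of fullv ((BT ++ BS) ++ (L ++ map y L)).
  have : basis_of fullv ((BT ++ L) ++ (BS ++ map y L)).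
    by rewrite -TS; apply: cat_basis => //; apply/directv_addP.
  apply: etrans; apply: perm_basis; rewrite -!catA perm_cat2l !catA perm_cat2r.
  by rewrite perm_catC.
have mono : monomial_on (BT ++ BS).
  have hom x h : x \in BT ++ BS -> h \in [:: a; g] ->
      exists2 x', x' \in BT ++ BS & exists2 l, l \in monomial_scalars & h x = l *: x'.
    move=> xB; have [l l4 ax] : homogeneous a x.
      by move: xB; rewrite mem_cat => /orP[xB|/hBS //]; apply: hTL; rewrite mem_cat xB.
    exact: (monomial_homogeneous xB l4 ax).
  have zero x h : x \in BT ++ BS -> h x = 0 ->
      exists2 x', x' \in BT ++ BS & exists2 l, l \in monomial_scalars & h x = l *: x'.
    by move=> xB ->; exists x => //; exists 0; rewrite ?zero_monomial ?scale0r.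
  have one x h : h x \in BS ->
      exists2 x', x' \in BT ++ BS & exists2 l, l \in monomial_scalars & h x = l *: x'.
    move=> hB; exists (h x); first by rewrite mem_cat hB orbT.
    by exists 1; rewrite ?one_monomial ?scale1r.
  move=> x xB h; rewrite !inE => /or4P[]/eqP->; try by apply: hom; rewrite // !inE eqxx ?orbT.
    have := xB; rewrite mem_cat => /orP[/u1[|]|/memS/uS]; [exact: zero | exact: one | exact: zero].
  have := xB; rewrite mem_cat => /orP[/y1[|]|/memS/yS]; [exact: zero | exact: one | exact: zero].
have band : submod <<L ++ map y L>>%VS.
  apply: submod_span => x; rewrite mem_cat => xL.
  have [l l4 ax] : homogeneous a x.
    case/orP: xL => [xL|/mapP[z zL ->]]; first by apply: hTL; rewrite mem_cat xL orbT.
    have zh : homogeneous a z by apply: hTL; rewrite mem_cat zL orbT.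
    by apply: (homogeneous_equivariant mxi4 (yE (W := fullv))) => //; apply: memvf.
  have xin : x \in <<L ++ map y L>>%VS by rewrite memv_span // mem_cat.
  rewrite link0_g ax linearZ /= ax !rpredZ //; split=> //.
    case/orP: xL => [xL|/mapP[z zL ->]]; last by rewrite uS ?mem0v.
    apply: (subvP (_ : <<map u L>> <= _)%VS); last by rewrite memv_span ?map_f.
    by rewrite uyL span_cat addvSr.
  case/orP: xL => [xL|/mapP[z zL ->]]; last by rewrite yS ?mem0v.
  by rewrite memv_span // mem_cat map_f ?orbT.
have /span_basis := bV; rewrite span_cat => sum.
have /basis_free/catP_free[_ fL /capv0P cap] := bV.
have [B0|L0] := ind _ _ (monomial_submod mono) band sum cap; last first.
  left; exists (BT ++ BS); split=> //.
  suff L_nil : L = [::] by move: bV; rewrite L_nil cats0.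
  have := fL; rewrite /free L0 dimv0 size_cat; case: (L) => //.
have /basis_free/catP_free[fB _ _] := bV.
have : BT ++ BS = [::] by move: fB; rewrite /free B0 dimv0; case: (BT ++ BS).
case: BT {hTL u1 y1 memT mono bV sum fB cap B0} bT => // bT; case: BS {hBS memS} bS => // bS _.
rewrite /= in bT bS.
have yT : (y @: T)%VS = S by rewrite -(span_basis bT) limg_span (span_basis bS).
have uT : (u @: T)%VS = S by rewrite -(span_basis bT) limg_span uyL (span_basis bS).
have inj (h : 'End(V)) : (h @: T)%VS = S -> forall t, t \in T -> h t = 0 -> t = 0.
  move=> hT; have : (T :&: lker h)%VS = 0%VS.
    apply/eqP; rewrite -dimv_eq0; have := limg_ker_dim h T; rewrite hT.
    have -> : \dim S = \dim T.
      have := @size_basis _ _ _ _ (in_tuple _) bS; have := @size_basis _ _ _ _ (in_tuple _) bT.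
      by rewrite size_map => -> ->.
    by rewrite -{2}[\dim T]add0n => /addIn ->.
  by move=> /capv0P H t tT ht; apply: H; rewrite ?memv_ker ?ht.
have [T0|T0] := eqVneq T 0%VS; last first.
  right; exact: (band_structure sT TS TS0 uT yT (inj u uT) (inj y yT) uS yS ind T0).
left; exists [::]; split=> //.
have S0 : S = 0%VS by rewrite -yT T0 limg0.
by rewrite -TS T0 S0 addv0 nil_basis.
Qed.

End PrincipalBlock.

Theorem indecomposable_shape : indec ->
  (exists X, monomial_basis X) \/ (exists b l m e e' s r, band_basis b l m e e' s r).
Proof.
move=> ind; have [s1 s2 sum cap] := linking_split.
have [k0|i0] := ind _ _ s1 s2 sum cap; first by left; apply: typical_monomial.
have link0 v : linking v = 0.
  by apply/eqP; rewrite -memv0 -i0 memv_img ?memvf.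
pose P := (u \o y)%VF.
have [P0|/lfunPn[v]] := eqVneq P 0.
  by apply: string_or_band => // v; rewrite -comp_lfunE -/P P0 zero_lfunE.
rewrite comp_lfunE zero_lfunE => uyv; left.
by apply: projective_monomial => //; exists v.
Qed.

End DoubleModules.

(** * One-parameter families *)

Section BandMatrices.
Variables (R : comNzRingType) (b : nat).
Implicit Types (q l t : R).

Definition jordan t : 'M[R]_b := \matrix_(i, j) (t *+ (i == j) + (i == j.+1 :> nat)%:R).
(** Matrices of the generators in the basis e, f, s, r of a band module. *)
Definition band_a q l : 'M[R]_(b + b + (b + b)) :=
  block_mx (block_mx l%:M 0 0 (- l)%:M) 0 0 (block_mx (q * l)%:M 0 0 (- (q * l))%:M).
Definition band_u t : 'M[R]_(b + b + (b + b)) :=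
  block_mx 0 0 (block_mx 1%:M 0 0 (jordan t)) 0.
Definition band_y : 'M[R]_(b + b + (b + b)) :=
  block_mx 0 0 (block_mx 0 1%:M 1%:M 0) 0.

Lemma band_rel q l t : q * q = -1 -> l ^+ 4 = 1 ->
  double_rel (q%:M : 'M[R]_(b + b + (b + b))) (band_a q l) (band_a q l * band_a q l)
    (band_u t) band_y.
Proof.
move=> q2 l4.
have aE : band_a q l * band_a q l =
    block_mx (l * l)%:M 0 0 (- (l * l))%:M.
  rewrite -mulmxE /band_a mulmx_block !mulmx0 !mul0mx !addr0 !add0r !mulmx_block.
  rewrite !mulmx0 !mul0mx !addr0 !add0r -!scalar_mxM !mulrNN.
  by rewrite mulrACA q2 mulN1r -!scalar_mx_block.
have a4 : band_a q l * band_a q l * (band_a q l * band_a q l) = 1.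
  rewrite aE -mulmxE mulmx_block !mulmx0 !mul0mx !addr0 !add0r -!scalar_mxM mulrNN.
  by rewrite (_ : l * l * (l * l) = 1) -?scalar_mx_block // -l4 !exprS expr0 mulr1 !mulrA.
have au : band_a q l * band_u t = q%:M * (band_u t * band_a q l).
  rewrite -!mulmxE /band_a /band_u mul_scalar_mx !mulmx_block ?(mulmx0, mul0mx, addr0, add0r).
  rewrite ?mulmx_block ?(mulmx0, mul0mx, addr0, add0r) !scale_block_mx !scaler0 mulmx1 mul1mx.
  rewrite !mul_scalar_mx !mul_mx_scalar scalerA mulrN scale_scalar_mx.
  by [].
have ay : band_a q l * band_y = - (q%:M * (band_y * band_a q l)).
  rewrite -!mulmxE /band_a /band_y mul_scalar_mx !mulmx_block ?(mulmx0, mul0mx, addr0, add0r).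
  rewrite ?mulmx_block ?(mulmx0, mul0mx, addr0, add0r) !scale_block_mx !scaler0 !mulmx1 !mul1mx.
  by rewrite !opp_block_mx !oppr0 !scale_scalar_mx mulrN !raddfN /= opprK.
have qC (M : 'M[R]_(b + b + (b + b))) : q%:M * M = M * q%:M.
  by rewrite -!mulmxE scalar_mxC.
have qq : q%:M * q%:M = -1 :> 'M[R]_(b + b + (b + b)).
  by rewrite -mulmxE -scalar_mxM q2 raddfN.
have uu : band_u t * band_u t = 0.
  by rewrite -mulmxE mulmx_block !mulmx0 !mul0mx !addr0 block_mx0.
have yy : band_y * band_y = 0.
  by rewrite -mulmxE mulmx_block !mulmx0 !mul0mx !addr0 block_mx0.
have uy : band_u t * band_y = 0.
  by rewrite -mulmxE mulmx_block !mulmx0 !mul0mx !addr0 block_mx0.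
have yu : band_y * band_u t = 0.
  by rewrite -mulmxE mulmx_block !mulmx0 !mul0mx !addr0 block_mx0.
move: (band_a q l) (band_u t) (band_y) a4 au ay uu yy uy yu {aE} => A U Y a4 au ay uu yy uy yu.
split=> //.
- by rewrite -mulrA.
- by rewrite a4 mul1r.
- by rewrite mulrA.
- rewrite -mulrA au (mulrA A) -qC -(mulrA q%:M) (mulrA A U) au -(mulrA q%:M (U * A)).
  by rewrite (mulrA q%:M q%:M) qq mulN1r -mulrA.
- rewrite -mulrA ay mulrN (mulrA A) -qC -(mulrA q%:M) (mulrA A Y) ay mulNr mulrN opprK.
  by rewrite -(mulrA q%:M (Y * A)) (mulrA q%:M q%:M) qq mulN1r -mulrA.
- by rewrite yu uy add0r subrr.
Qed.

End BandMatrices.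

Section MapBand.
Variables (R R' : comNzRingType) (h : {rmorphism R -> R'}) (b : nat).

Lemma map_band_a q l : map_mx h (band_a b q l) = band_a b (h q) (h l).
Proof.
by rewrite /band_a !map_block_mx !map_scalar_mx !map_mx0 /= !raddfN /= rmorphM.
Qed.

Lemma map_band_u t : map_mx h (band_u b t) = band_u b (h t).
Proof.
rewrite /band_u !map_block_mx !map_mx0 map_mx1; congr (block_mx _ _ (block_mx _ _ _ _) _).
by apply/matrixP => i j; rewrite !mxE rmorphD !rmorphMn rmorph1.
Qed.

Lemma map_band_y : map_mx h (band_y R b) = band_y R' b.
Proof. by rewrite /band_y !map_block_mx !map_mx0 map_mx1. Qed.

End MapBand.

Section Modules.
Variables (k : closedFieldType) (xi : k).
Hypothesis xi2 : xi * xi = -1.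
Hypothesis two_neq0 : 2 != 0 :> k.
Variables (D : falgType k) (a g u y : D).
Hypothesis rel : double_rel xi%:A a g u y.
Hypothesis dimD : \dim {:D} = 64%N.
Hypothesis gen : forall L : {vspace D}, 1 \in L ->
  (forall v, v \in L -> [/\ a * v \in L, g * v \in L, u * v \in L & y * v \in L]) ->
  L = fullv.

Let Dind := double_ind xi2 rel dimD gen.

Section OneModule.
Variable M : fdmod D.
Local Notation V := 'cV[k]_(mdim M).

Definition opM (z : D) : 'End(V) := linfun (mulmx (mact M z)).

Lemma opME z v : opM z v = mact M z *m v.
Proof. by rewrite lfunE. Qed.

Lemma mactM z w : mact M (z * w) = mact M z *m mact M w.
Proof. by case: (mactP M). Qed.

Lemma mact1 : mact M 1 = 1%:M.
Proof. by case: (mactP M). Qed.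

Lemma mactL s z w : mact M (s *: z + w) = s *: mact M z + mact M w.
Proof. by case: (mactP M) => H _ _; rewrite H. Qed.

Lemma mact0 : mact M 0 = 0.
Proof. by have := mactL (-1) 1 1; rewrite scaleN1r addNr scaleN1r addNr. Qed.

Lemma mactZ s z : mact M (s *: z) = s *: mact M z.
Proof. by have := mactL s z 0; rewrite mact0 !addr0. Qed.

Lemma mactN z : mact M (- z) = - mact M z.
Proof. by rewrite -scaleN1r mactZ scaleN1r. Qed.

Lemma mactD z w : mact M (z + w) = mact M z + mact M w.
Proof. by have := mactL 1 z w; rewrite !scale1r. Qed.

Lemma opM_ops : double_ops xi (opM a) (opM g) (opM u) (opM y).
Proof.
have qM z w : mact M (xi%:A * (z * w)) = xi *: (mact M z *m mact M w).
  by rewrite -scalerAl mul1r mactZ mactM.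
split=> v; rewrite !opME ?linearZ /= ?mulmxA.
- by rewrite -!mactM (dr_a4 rel) mact1 mul1mx.
- by rewrite -!mactM (dr_g4 rel) mact1 mul1mx.
- by rewrite -!mactM (dr_ag rel).
- by rewrite -mactM (dr_au rel) qM -scalemxAl.
- by rewrite -mactM (dr_ay rel) mactN qM mulNmx -scalemxAl scaleNr.
- by rewrite -mactM (dr_gu rel) mactN mactM mulNmx.
- by rewrite -mactM (dr_gy rel) mactN mactM mulNmx.
- by rewrite -mactM (dr_uu rel) mact0 mul0mx.
- by rewrite -mactM (dr_yy rel) mact0 mul0mx.
- by rewrite -mactM (dr_yu rel) !mactD mactN !mactM !mulmxDl mulNmx.
Qed.

Lemma submod_submodule U : submod (opM a) (opM g) (opM u) (opM y) U <-> submodule U.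
Proof.
split=> [sU z|sU v vU]; last by split; rewrite opME; apply: sU.
elim/Dind: z => [|s z w Hz Hw|z w Hz Hw||||] v vU.
- by rewrite mact1 mul1mx.
- by rewrite mactL mulmxDl -scalemxAl rpredD ?rpredZ ?Hz ?Hw.
- by rewrite mactM -mulmxA; apply/Hz/Hw.
all: by rewrite -opME; have [] := sU v vU.
Qed.

Lemma indecomposable_indec : indecomposable M ->
  indec (opM a) (opM g) (opM u) (opM y).
Proof.
by move=> [_ ind] U W /submod_submodule sU /submod_submodule sW; apply: ind.
Qed.

Lemma indec_indecomposable : (0 < mdim M)%N ->
  indec (opM a) (opM g) (opM u) (opM y) -> indecomposable M.
Proof.
by move=> n0 ind; split=> // U W /submod_submodule sU /submod_submodule sW; apply: ind.
Qed.

(** P is the matrix of a basis of M in which the generators act by the given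
    matrices. *)
Definition presented N (A G U Y : 'M[k]_N) : Prop :=
  exists (P : 'M[k]_(mdim M, N)) (Q : 'M[k]_(N, mdim M)),
  [/\ Q *m P = 1%:M, P *m Q = 1%:M
    & [/\ mact M a *m P = P *m A, mact M g *m P = P *m G,
          mact M u *m P = P *m U & mact M y *m P = P *m Y]].

Definition columns b (v : nat -> V) : 'M[k]_(mdim M, b) := \matrix_(i < mdim M, j < b) v j i 0.

Lemma mul_columns (z : D) b v : mact M z *m columns b v = columns b (fun j => opM z (v j)).
Proof.
by apply/matrixP => i j; rewrite !mxE opME mxE; apply: eq_bigr => l _; rewrite mxE.
Qed.

Lemma columns_inverse N (X : seq V) : size X = N -> basis_of fullv X ->
  exists Q, Q *m columns N (nth 0 X) = 1%:M /\ columns N (nth 0 X) *m Q = 1%:M.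
Proof.
move=> sX bX; pose Xt := tcast sX (in_tuple X).
have XtE j : Xt`_j = X`_j by rewrite /Xt val_tcast.
have bXt : basis_of fullv Xt by rewrite val_tcast.
exists (\matrix_(i < N, j < mdim M) coord Xt i (delta_mx j 0)); split.
  apply/matrixP => i j; rewrite !mxE.
  under eq_bigr do rewrite !mxE mulrC.
  transitivity (coord Xt i (X`_j)).
    rewrite [in RHS](matrix_sum_delta (X`_j)) !linear_sum /=; apply: eq_bigr => l _.
    by rewrite big_ord1 linearZ.
  by rewrite -XtE coord_free ?(basis_free bXt) // eq_sym.
apply/matrixP => i j; rewrite !mxE; under eq_bigr do rewrite !mxE.
have := congr1 (fun w : V => w i 0) (coord_basis bXt (memvf (delta_mx j 0 : V))).
rewrite summxE /= mxE eqxx andbT => ->; apply: eq_bigr => l _.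
by rewrite mxE XtE mulrC.
Qed.

End OneModule.

Lemma presented_iso M M' N (A G U Y : 'M[k]_N) :
  presented M A G U Y -> presented M' A G U Y -> fdmod_iso M M'.
Proof.
move=> [P [Q [QP PQ [Pa Pg Pu Py]]]] [P' [Q' [QP' PQ' [Pa' Pg' Pu' Py']]]].
exists (P' *m Q), (P *m Q'); split.
- by rewrite mulmxA -(mulmxA P) QP' mulmx1.
- by rewrite mulmxA -(mulmxA P') QP mulmx1.
have step z R : mact M z *m P = P *m R -> mact M' z *m P' = P' *m R ->
    P' *m Q *m mact M z = mact M' z *m (P' *m Q).
  move=> E E'; rewrite mulmxA E' -!mulmxA; congr (P' *m _).
  rewrite -[mact M z]mulmx1 -PQ !mulmxA; congr (_ *m Q).
  by rewrite -(mulmxA Q) E mulmxA QP mul1mx.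
move=> z; elim/Dind: z => [|s z w Hz Hw|z w Hz Hw||||].
- by rewrite !mact1 mulmx1 mul1mx.
- by rewrite !mactL mulmxDr mulmxDl -scalemxAr -scalemxAl Hz Hw.
- by rewrite !mactM mulmxA Hz -mulmxA Hw mulmxA.
- exact: step Pa Pa'.
- exact: step Pg Pg'.
- exact: step Pu Pu'.
- exact: step Py Py'.
Qed.

(** Finitely many codes, each determining its modules up to isomorphism, yield
    finitely many modules; the representatives are chosen by excluded middle. *)
Lemma finitely_many_codes (C : finType) (Q : C -> fdmod D -> Prop) :
  (forall c M M', Q c M -> Q c M' -> fdmod_iso M M') ->
  exists (p : nat) (E : 'I_p -> fdmod D),
    forall c M, Q c M -> exists i, fdmod_iso M (E i).
Proof.
move=> QE; suff [l lP] : exists l : seq (fdmod D), forall c, c \in enum C -> forall M, Q c M ->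
    exists i : 'I_(size l), fdmod_iso M (tnth (in_tuple l) i).
  by exists (size l), (tnth (in_tuple l)) => c; apply: lP; rewrite mem_enum.
elim: (enum C) => [|c s [l IH]]; first by exists [::].
have [[M0 QM0]|no] := classic (exists M, Q c M).
  exists (M0 :: l) => c'; rewrite inE => /orP[/eqP-> M QM|/IH H M /H[i iM]].
    by exists ord0; apply: QE QM QM0.
  by exists (lift ord0 i); move: iM; rewrite !(tnth_nth M0).
exists l => c'; rewrite inE => /orP[/eqP-> M QM|/IH //].
by case: no; exists M.
Qed.

Section Monomial.
Variable n : nat.
Local Notation F := (monomial_scalars xi).
(** For each generator (a, g, u, y in this order) and basis vector: the basis
    vector and the scalar of its image. *)
Definition monomial_code := {ffun 'I_4 * 'I_n -> 'I_n * 'I_(size F)}.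
Definition monomial_matrix (c : monomial_code) (z : 'I_4) : 'M[k]_n :=
  \matrix_(i, j) if i == (c (z, j)).1 then F`_(c (z, j)).2 else 0.

Lemma monomial_presented M X : mdim M = n ->
  monomial_basis xi (opM M a) (opM M g) (opM M u) (opM M y) X ->
  exists c : monomial_code, presented M (monomial_matrix c 0) (monomial_matrix c 1)
    (monomial_matrix c 2%R) (monomial_matrix c 3%R).
Proof.
move=> Mn [bX mono].
have sX : size X = n.
  have := @size_basis _ _ _ _ (in_tuple X) bX.
  rewrite dimvf dim_matrix => <-; rewrite -Mn; exact: muln1.
pose ops : seq 'End('cV[k]_(mdim M)) := [:: opM M a; opM M g; opM M u; opM M y].
have ex (zj : 'I_4 * 'I_n) : exists p : 'I_n * 'I_(size F),
    ops`_zj.1 X`_zj.2 = F`_p.2 *: X`_p.1.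
  have Xj : X`_zj.2 \in X by rewrite mem_nth // sX.
  have [x' x'X [l lF E]] := mono _ Xj (ops`_zj.1) (mem_nth 0 (ltn_ord zj.1 : (zj.1 < size ops)%N)).
  have iX : (index x' X < n)%N by rewrite -sX index_mem.
  have iF : (index l F < size F)%N by rewrite index_mem.
  by exists (Ordinal iX, Ordinal iF); rewrite /= !nth_index.
have [c cP] := fin_all_exists ex.
exists [ffun p => c p]; have [Q [QP PQ]] := columns_inverse sX bX.
exists (columns n (nth 0 X)), Q; split=> //.
have step (z : 'I_4) (d : D) : opM M d = ops`_z ->
    mact M d *m columns n (nth 0 X) = columns n (nth 0 X) *m monomial_matrix [ffun p => c p] z.
  move=> dz; rewrite mul_columns; apply/matrixP => i j; rewrite !mxE dz (cP (z, j)).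
  rewrite (bigD1 (c (z, j)).1) //= big1 => [|l lc]; rewrite !mxE ffunE ?eqxx ?addr0 1?mulrC //.
  by rewrite (negbTE lc) ?mul0r ?mulr0.
by split; apply: step.
Qed.

Lemma finitely_many_monomial : exists (p : nat) (E : 'I_p -> fdmod D),
  forall M, mdim M = n ->
    (exists X, monomial_basis xi (opM M a) (opM M g) (opM M u) (opM M y) X) ->
    exists i, fdmod_iso M (E i).
Proof.
have [|p [E EP]] := @finitely_many_codes monomial_code (fun c M =>
    presented M (monomial_matrix c 0) (monomial_matrix c 1)
    (monomial_matrix c 2%R) (monomial_matrix c 3%R)).
  by move=> c M M'; apply: presented_iso.
by exists p, E => M Mn [X /(monomial_presented Mn)[c /EP]].
Qed.

End Monomial.

Section Bands.
Variables (b : nat) (l : k).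
Hypothesis l4 : l ^+ 4 = 1.

Lemma band_presented M m e f s r :
  band_basis xi (opM M a) (opM M g) (opM M u) (opM M y) b l m e f s r ->
  presented M (band_a b xi l) (band_a b xi l * band_a b xi l) (band_u b m) (band_y k b).
Proof.
move=> [bX [_ rb] gE ops].
set X := (_ ++ _) in bX.
have sX : size X = (b + b + (b + b))%N by rewrite !size_cat !size_map size_iota addnA.
have [Q [QP PQ]] := columns_inverse sX bX.
set P := columns _ _ in QP PQ.
have nthX c (j : nat) : (j < b)%N ->
    nth 0 [seq c i | i <- iota 0 b] j = c j :> 'cV[k]_(mdim M).
  by move=> jb; rewrite (nth_map 0%N) ?size_iota // nth_iota.
have sz c : size [seq c i | i <- iota 0 b] = b :> nat by rewrite size_map size_iota.
have PE : P = row_mx (row_mx (columns b e) (columns b f)) (row_mx (columns b s) (columns b r)).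
  apply/matrixP => i j; rewrite !mxE /X catA nth_cat size_cat !sz.
  case: (splitP j) => j' ->; rewrite !mxE.
    by rewrite nth_cat sz; case: (splitP j') => j'' ->; rewrite !mxE ?addKn nthX.
  by rewrite addKn nth_cat sz; case: (splitP j') => j'' ->; rewrite !mxE ?addKn nthX.
have colE (c c' : nat -> 'cV[k]_(mdim M)) : (forall j, (j < b)%N -> c j = c' j) -> columns b c = columns b c'.
  by move=> E; apply/matrixP => i j; rewrite !mxE E.
have colZ t c : columns b (fun j => t *: c j) = columns b c *m t%:M :> 'M_(mdim M, b).
  by rewrite mul_mx_scalar; apply/matrixP => i j; rewrite !mxE.
have col0 c : (forall j, c j = 0) -> columns b c = 0 :> 'M_(mdim M, b).
  by move=> c0; apply/matrixP => i j; rewrite !mxE c0 mxE.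
have Pa : mact M a *m P = P *m band_a b xi l.
  rewrite PE !mul_mx_row !mul_columns /band_a mul_row_block !mul_row_block.
  rewrite !mulmx0 !addr0 !add0r -!colZ.
  by congr (row_mx (row_mx _ _) (row_mx _ _)); apply: colE => j _;
    have [[ae af as_ ar] _ _] := ops j; rewrite ?ae ?af ?as_ ?ar.
exists P, Q; split=> //; split=> //.
- rewrite -mulmxE mulmxA -Pa -mulmxA -Pa /P mul_columns !mul_columns.
  by apply/matrixP => i j; rewrite !mxE gE.
- rewrite PE !mul_mx_row !mul_columns /band_u mul_row_block !mul_row_block.
  rewrite !mulmx0 !addr0 !add0r mulmx1.
  congr (row_mx (row_mx _ _) _).
  + by apply: colE => j _; case: (ops j) => [_ [-> _ _ _] _].
  + apply/matrixP => i j; rewrite !mxE; case: (ops j) => [_ [_ -> _ _] _].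
    rewrite !mxE; under eq_bigr do rewrite !mxE mulrDr.
    rewrite big_split /=; congr (_ + _).
      rewrite (bigD1 j) //= eqxx big1 ?addr0 ?mulr1n 1?mulrC // => i' ij.
      by rewrite (negbTE ij) mulr0n mulr0.
    have [jb|jb] := ltnP j.+1 b.
      rewrite (bigD1 (Ordinal jb)) //= eqxx mulr1 big1 ?addr0 // => i' ij.
      by rewrite -[_ == _]/(i' == Ordinal jb) (negbTE ij) mulr0.
    have -> : j.+1 = b by apply/eqP; rewrite eqn_leq jb ltn_ord.
    rewrite rb mxE big1 // => i' _.
    by rewrite ltn_eqF ?mulr0 // (leq_trans (ltn_ord i')).
  + rewrite (col0 (fun j => opM M u (s j))) ?(col0 (fun j => opM M u (r j))) ?row_mx0 // => j;
      by have [_ [_ _ hs hr] _] := ops j.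
- rewrite PE !mul_mx_row !mul_columns /band_y mul_row_block !mul_row_block.
  rewrite !mulmx0 !addr0 !add0r !mulmx1.
  congr (row_mx (row_mx _ _) _).
  + by apply: colE => j _; case: (ops j) => [_ _ [-> _ _ _]].
  + by apply: colE => j _; case: (ops j) => [_ _ [_ -> _ _]].
  + rewrite (col0 (fun j => opM M y (s j))) ?(col0 (fun j => opM M y (r j))) ?row_mx0 // => j;
      by have [_ _ [_ _ hs hr]] := ops j.
Qed.

(** The band matrices with the variable of k[t] as eigenvalue satisfy the
    relations over k[t], and evaluation at z gives the band matrices for z. *)
Lemma band_family : exists T : Defs.family D, forall z,
  presented (family_member T z) (band_a b xi l) (band_a b xi l * band_a b xi l)
    (band_u b z) (band_y k b).
Proof.
have q2 : (xi%:P * xi%:P = -1 :> {poly k}) by rewrite -polyCM xi2 polyCN.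
have l4' : (l%:P ^+ 4 = 1 :> {poly k}) by rewrite -polyC_exp l4.
have [rho [rhoP [ra rg ru ry]]] := double_presentation xi2 rel dimD gen
  (nu := @polyC k) (band_rel b 'X q2 l4').
exists (Family rhoP) => z; exists 1%:M, 1%:M; rewrite !mulmx1; split=> //.
rewrite ?mulmx1 ?mul1mx /= ra rg ru ry -mulmxE map_mxM !map_band_a map_band_u map_band_y /=.
by rewrite !horner_evalE !hornerC hornerX.
Qed.

End Bands.

(** Monomial modules are determined by finitely many codes; band modules of
    dimension n have n = 4b and belong to one of four families, one for each
    fourth root of unity. *)
Lemma tame_families n : exists (p q : nat) (E : 'I_p -> fdmod D) (T : 'I_q -> Defs.family D),
  forall M : fdmod D, indecomposable M -> mdim M = n ->
    (exists i : 'I_p, fdmod_iso M (E i)) \/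
    (exists (i : 'I_q) (z : k), fdmod_iso M (family_member (T i) z)).
Proof.
have [p [E EP]] := finitely_many_monomial n.
have R4 (i : 'I_4) : (roots4 xi)`_i ^+ 4 = 1.
  have : (roots4 xi)`_i \in roots4 xi by rewrite mem_nth.
  by rewrite !inE => /or4P[]/eqP->; ring: xi2.
have [T TP] := fin_all_exists (fun i => band_family (n %/ 4) (R4 i)).
exists p, 4%N, E, T => M ind Mn.
have [mono|[b [l [m [e [f [s [r band]]]]]]]] :=
    indecomposable_shape xi2 two_neq0 (opM_ops M) (indecomposable_indec ind).
  by left; apply: EP.
right; have [bX [l4 _] _ _] := band.
have bE : b = (n %/ 4)%N.
  have := @size_basis _ _ _ _ (in_tuple _) bX; rewrite dimvf dim_matrix !size_cat !size_map size_iota.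
  rewrite -[_ * _]/(mdim M * 1)%N muln1 Mn => ->; lia.
have lR := root4P xi2 l4; rewrite bE in band.
have iR : (index l (roots4 xi) < 4)%N by rewrite index_mem.
exists (Ordinal iR), m; apply: presented_iso (TP _ m).
have := band_presented band; by rewrite /= nth_index.
Qed.

End Modules.

(** * Infinitely many indecomposable modules of dimension four *)

Section ShortBands.
Variables (k : closedFieldType) (xi : k).
Hypothesis xi2 : xi * xi = -1.
Hypothesis two_neq0 : 2 != 0 :> k.
Variables (V : vectType k) (a g u y : 'End(V)).
Hypothesis a4 : forall v, a (a (a (a v))) = v.
Local Notation short_band := (band_basis xi a g u y 1 1).

Lemma roots4_distinct : [/\ 1 != -1 :> k, 1 != xi, 1 != - xi &
  [/\ -1 != xi :> k, -1 != - xi :> k & xi != - xi]].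
Proof.
have n (x z : k) : x * x != z * z -> x != z by apply: contra => /eqP->.
have two : 1 != -1 :> k by rewrite -addr_eq0.
have xin : xi != - xi.
  rewrite -addr_eq0 -mulr2n -mulr_natl mulf_neq0 //; apply/eqP => x0.
  by move/eqP: xi2; rewrite x0 mul0r eq_sym oppr_eq0 oner_eq0.
split=> //; try by apply: n; rewrite ?mulrNN xi2 ?mulr1.
by split=> //; apply: n; rewrite ?mulrNN xi2 ?mulr1.
Qed.

(** The four basis vectors have the distinct weights 1, -1, xi and - xi, so every
    weight space is a line. *)
Lemma short_band_weights z e f s r : short_band z e f s r -> forall v,
  exists c, [/\ wproj a 1 v = c.1.1.1 *: e 0%N, wproj a (-1) v = c.1.1.2 *: f 0%N,
    wproj a xi v = c.1.2 *: s 0%N & wproj a (- xi) v = c.2 *: r 0%N].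
Proof.
move=> [bX _ _ /(_ 0%N)[[ae af as_ ar] _ _]] v; rewrite mulr1 in as_ ar.
have [n1 n2 n3 [n4 n5 n6]] := roots4_distinct.
have x4 := xi4 xi2; have mx4 := mxi4 xi2.
have o4 : 1 ^+ 4 = 1 :> k by rewrite expr1n.
have mo4 : (-1) ^+ 4 = 1 :> k by rewrite -signr_odd.
have := memvf v; rewrite -(span_basis bX) /=.
move=> /(@coord_span _ _ _ (in_tuple [:: e 0%N; f 0%N; s 0%N; r 0%N])).
rewrite 3!big_ord_recl big_ord1 /=; set c1 := coord _ _ v; set c2 := coord _ _ v.
set c3 := coord _ _ v; set c4 := coord _ _ v => vE.
have W l c x : l ^+ 4 = 1 -> a x = c *: x -> c ^+ 4 = 1 -> wproj a l x = if l == c then x else 0.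
  move=> l4 ax c4'; case: eqP => [lc|/eqP lc]; first by apply: wproj_id => //; rewrite lc.
  exact: (wproj_other a4 l4 c4' lc ax).
have d (x t : k) : x != t -> (x == t) = false /\ (t == x) = false.
  by move=> xt; rewrite (eq_sym t) (negbTE xt).
exists (c1, c2, c3, c4); rewrite vE; move: (d _ _ n1) (d _ _ n2) (d _ _ n3) (d _ _ n4) (d _ _ n5) (d _ _ n6) => {d}.
move=> [d1 d1'] [d2 d2'] [d3 d3'] [d4 d4'] [d5 d5'] [d6 d6'].
have S l : l ^+ 4 = 1 -> wproj a l (c1 *: e 0%N + (c2 *: f 0%N + (c3 *: s 0%N + c4 *: r 0%N))) =
    c1 *: (if l == 1 then e 0%N else 0) + (c2 *: (if l == -1 then f 0%N else 0)
    + (c3 *: (if l == xi then s 0%N else 0) + c4 *: (if l == - xi then r 0%N else 0))).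
  move=> l4; rewrite !linearD !linearZ /=.
  by rewrite (W _ _ _ l4 ae) // (W _ _ _ l4 af) // (W _ _ _ l4 as_) // (W _ _ _ l4 ar).
by split; rewrite S // eqxx ?(d1, d1', d2, d2', d3, d3', d4, d4', d5, d5', d6, d6')
  !scaler0 ?addr0 ?add0r.
Qed.

(** Each weight space is a line, so it lies in one of two complementary submodules.
    The one that contains e contains s = u e and r = y e, and also f, because
    y f = s is not zero. *)
Lemma short_band_indec z e f s r : short_band z e f s r -> indec a g u y.
Proof.
move=> band U W; have wt := short_band_weights band.
have [bX _ _ /(_ 0%N)[[ae af as_ ar] [ue _ _ _] [ye yf _ _]]] := band.
have o4 : 1 ^+ 4 = 1 :> k by rewrite expr1n.
have mo4 : (-1) ^+ 4 = 1 :> k by rewrite -signr_odd.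
rewrite /= in bX.
have s0 : s 0%N != 0 by apply: (free_not0 (basis_free bX)); rewrite !inE eqxx ?orbT.
have dich l x (A B : {vspace V}) : l ^+ 4 = 1 -> a x = l *: x ->
    (forall v, exists c, wproj a l v = c *: x) -> submod a g u y A -> submod a g u y B ->
    (A + B)%VS = fullv -> x \in A \/ x \in B.
  move=> l4 ax lin sA sB AB; have := memvf x; rewrite -AB => /memv_addP[x1 x1A [x2 x2B xE]].
  have stA : stable a A by move=> v /sA[].
  have stB : stable a B by move=> v /sB[].
  have [c cE] := lin x1; have [c' cE'] := lin x2.
  have x0 : x = c *: x + c' *: x.
    by rewrite -cE -cE' -linearD /= -xE wproj_id.
  have mem (Q : {vspace V}) t : t *: x \in Q -> t != 0 -> x \in Q.
    by move=> /(rpredZ t^-1) tx t0; move: tx; rewrite scalerA mulVf // scale1r.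
  have [c0|c0] := eqVneq c 0.
    right; have [c'0|c'0] := eqVneq c' 0; first by rewrite x0 c0 c'0 !scale0r addr0 mem0v.
    by apply: mem c'0; rewrite -cE' wproj_stable.
  by left; apply: mem c0; rewrite -cE wproj_stable.
have half A B : submod a g u y A -> submod a g u y B -> (A + B)%VS = fullv ->
    (A :&: B)%VS = 0%VS -> e 0%N \in A -> B = 0%VS.
  move=> sA sB AB /capv0P AB0 eA.
  have [_ _ sA' rA] := sA _ eA; rewrite ue ye in sA' rA.
  have fA : f 0%N \in A.
    have [||//|fB] := dich (-1) (f 0%N) A B mo4 _ _ sA sB AB.
    - by rewrite af.
    - by move=> v; have [c [_ ? _ _]] := wt v; exists c.1.1.2.
    move: s0; rewrite (AB0 (s 0%N)) ?eqxx //.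
    by have [_ _ _] := sB _ fB; rewrite yf.
  apply/eqP; rewrite -subv0; apply/subvP => v vB; rewrite (AB0 v) ?mem0v //.
  have := memvf v; rewrite -(span_basis bX); apply: subvP; apply/span_subvP => x.
  by rewrite !inE => /or4P[]/eqP->.
move=> sU sW UW UW0; have [||eU|eW] := dich 1 (e 0%N) U W o4 _ _ sU sW UW.
- by rewrite ae.
- by move=> v; have [c [? _ _ _]] := wt v; exists c.1.1.1.
- by right; apply: half UW UW0 eU.
- by left; apply: half eW => //; rewrite 1?addvC 1?capvC.
Qed.

(** Two short band bases of the same module are proportional vector by vector,
    and u e = s = y f, y e = r force all four ratios to be equal; so the scalar
    in u f = z r is the same. *)
Lemma short_band_parameter z e f s r z' e' f' s' r' :
  short_band z e f s r -> short_band z' e' f' s' r' -> z = z'.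
Proof.
move=> band band'; have wt := short_band_weights band.
have [bX [_ r1] _ /(_ 0%N)[_ [ue uf _ _] [ye yf _ _]]] := band.
have [bX' [_ r1'] _ /(_ 0%N)[[ae af as_ ar] [ue' uf' _ _] [ye' yf' _ _]]] := band'.
rewrite /= in bX bX'; rewrite mulr1 in as_ ar.
have ne0 x : x \in [:: e 0%N; f 0%N; s 0%N; r 0%N] -> x != 0.
  by move=> xX; apply: (free_not0 (basis_free bX)).
have e0' : e' 0%N != 0 by apply: (free_not0 (basis_free bX')); rewrite inE eqxx.
have o4 : 1 ^+ 4 = 1 :> k by rewrite expr1n.
have mo4 : (-1) ^+ 4 = 1 :> k by rewrite -signr_odd.
have [c1 [E1 _ _ _]] := wt (e' 0%N); have [c2 [_ E2 _ _]] := wt (f' 0%N).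
have [c3 [_ _ E3 _]] := wt (s' 0%N); have [c4 [_ _ _ E4]] := wt (r' 0%N).
rewrite (wproj_id two_neq0 o4 ae) in E1; rewrite (wproj_id two_neq0 mo4 af) in E2.
rewrite (wproj_id two_neq0 (xi4 xi2) as_) in E3; rewrite (wproj_id two_neq0 (mxi4 xi2) ar) in E4.
move: E1 E2 E3 E4; move: (c1.1.1.1) (c2.1.1.2) (c3.1.2) (c4.2) => p q t w E1 E2 E3 E4.
have cancel c c' x : x \in [:: e 0%N; f 0%N; s 0%N; r 0%N] -> c *: x = c' *: x -> c = c'.
  move=> /ne0 x0 /eqP; rewrite -subr_eq0 -scalerBl scaler_eq0 (negbTE x0) orbF subr_eq0.
  by move/eqP.
have pt : p = t.
  apply: (cancel _ _ (s 0%N)); first by rewrite !inE eqxx ?orbT.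
  by rewrite -E3 -ue' E1 linearZ /= ue.
have qt : q = t.
  apply: (cancel _ _ (s 0%N)); first by rewrite !inE eqxx ?orbT.
  by rewrite -E3 -yf' E2 linearZ /= yf.
have pw : p = w.
  apply: (cancel _ _ (r 0%N)); first by rewrite !inE eqxx ?orbT.
  by rewrite -E4 -ye' E1 linearZ /= ye.
have : q * z = z' * w.
  apply: (cancel _ _ (r 0%N)); first by rewrite !inE eqxx ?orbT.
  have := uf'; rewrite r1' addr0 E2 linearZ /= uf r1 addr0 E4 !scalerA.
  by [].
rewrite qt -pt -pw mulrC => /mulIf; apply.
by apply: contra e0' => /eqP p0; rewrite E1 p0 scale0r.
Qed.

End ShortBands.

Section InfinitelyMany.
Variables (k : closedFieldType) (xi : k).
Hypothesis xi2 : xi * xi = -1.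
Hypothesis two_neq0 : 2 != 0 :> k.
Variables (D : falgType k) (a g u y : D).
Hypothesis rel : double_rel xi%:A a g u y.
Hypothesis dimD : \dim {:D} = 64%N.
Hypothesis gen : forall L : {vspace D}, 1 \in L ->
  (forall v, v \in L -> [/\ a * v \in L, g * v \in L, u * v \in L & y * v \in L]) ->
  L = fullv.
Local Notation short_band M := (band_basis xi (opM M a) (opM M g) (opM M u) (opM M y) 1 1).

(** The band matrices of size 4 satisfy the relations, hence define a module, for
    which the standard basis is a band basis. *)
Lemma short_band_exists z : exists M : fdmod D, (0 < mdim M)%N /\
  exists e f s r, short_band M z e f s r.
Proof.
have [rho [rhoP [ra rg ru ry]]] := double_presentation xi2 rel dimD gen
  (nu := (idfun : {rmorphism k -> k})) (band_rel 1 z xi2 (expr1n _ 4)).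
exists (FdMod rhoP); split=> //.
pose vec c1 c2 c3 c4 : 'cV[k]_(1 + 1 + (1 + 1)) :=
  col_mx (col_mx c1%:M c2%:M) (col_mx c3%:M c4%:M).
have vecZ t c1 c2 c3 c4 : t *: vec c1 c2 c3 c4 = vec (t * c1) (t * c2) (t * c3) (t * c4).
  by rewrite /vec !scale_col_mx !scale_scalar_mx.
have vecD c1 c2 c3 c4 d1 d2 d3 d4 : vec c1 c2 c3 c4 + vec d1 d2 d3 d4 =
    vec (c1 + d1) (c2 + d2) (c3 + d3) (c4 + d4).
  by rewrite /vec !add_col_mx -!raddfD.
have vec0 : 0 = vec 0 0 0 0 by rewrite -(scale0r (vec 0 0 0 0)) vecZ !mul0r.
have aE c1 c2 c3 c4 : band_a 1 xi 1 *m vec c1 c2 c3 c4 = vec c1 (- c2) (xi * c3) (- (xi * c4)).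
  rewrite /band_a /vec !mul_block_col !mul0mx !addr0 !add0r.
  by rewrite -!scalar_mxM mulr1 mul1r mulN1r mulNr.
have uE c1 c2 c3 c4 : band_u 1 z *m vec c1 c2 c3 c4 = vec 0 0 c1 (z * c2).
  have zz : jordan 1 z = z%:M by apply/matrixP => i j; rewrite !mxE !ord1 addr0.
  rewrite /band_u zz /vec !mul_block_col !mul0mx !addr0 -(col_mx0 k 1 1 1) ?addr0 ?add0r.
  by rewrite -!scalar_mxM mul1r raddf0.
have yE c1 c2 c3 c4 : band_y k 1 *m vec c1 c2 c3 c4 = vec 0 0 c2 c1.
  rewrite /band_y /vec !mul_block_col !mul0mx !addr0 -(col_mx0 k 1 1 1) ?addr0 ?add0r.
  by rewrite !mul1mx raddf0.
have vecE v : exists c1 c2 c3 c4, v = vec c1 c2 c3 c4.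
  rewrite -(vsubmxK v) -(vsubmxK (usubmx v)) -(vsubmxK (dsubmx v)).
  move: (usubmx (usubmx v)) (dsubmx (usubmx v)) (usubmx (dsubmx v)) (dsubmx (dsubmx v)).
  move=> c1 c2 c3 c4.
  by rewrite [c1]mx11_scalar [c2]mx11_scalar [c3]mx11_scalar [c4]mx11_scalar; do 4!eexists.
pose one i (v : 'cV[k]_(1 + 1 + (1 + 1))) := if i == 0%N then v else 0.
exists (fun i => one i (vec 1 0 0 0)), (fun i => one i (vec 0 1 0 0)),
  (fun i => one i (vec 0 0 1 0)), (fun i => one i (vec 0 0 0 1)).
split.
- rewrite /one /= basisEdim dimvf dim_matrix /= andbT; apply/subvP => v _.
  set X := (X in _ \in <<X>>%VS).
  have in_span c x : x \in X -> c *: x \in <<X>>%VS by move=> xX; rewrite rpredZ ?memv_span.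
  have [c1 [c2 [c3 [c4 ->]]]] := vecE v.
  have -> : vec c1 c2 c3 c4 = c1 *: vec 1 0 0 0 + c2 *: vec 0 1 0 0 + c3 *: vec 0 0 1 0 + c4 *: vec 0 0 0 1.
    by rewrite !vecZ !vecD !mulr0 !mulr1 !addr0 !add0r.
  by rewrite !rpredD // in_span // !inE eqxx ?orbT.
- by rewrite expr1n.
- by move=> v; rewrite !opME /= rg ra -mulmxA.
move=> i; rewrite !opME /= ra ru ry.
case: i => [|i]; last by rewrite /one /= !mulmx0 !scaler0 addr0.
rewrite /one /= !(aE, uE, yE) !vecZ addr0 vec0 !mulr0 !mulr1 !oppr0; split=> //.
Qed.

Lemma short_band_iso M M' z e f s r : fdmod_iso M M' -> short_band M z e f s r ->
  exists e' f' s' r', short_band M' z e' f' s' r'.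
Proof.
move=> [P [Q [QP PQ PM]]] [bX [l4 r1] ga ops].
pose h : 'Hom('cV[k]_(mdim M), 'cV[k]_(mdim M')) := linfun (mulmx P).
have hE v : h v = P *m v by rewrite lfunE.
have hM w v : h (opM M w v) = opM M' w (h v).
  by rewrite !opME !hE !mulmxA PM.
have hQ v : h (Q *m v) = v by rewrite hE mulmxA PQ mul1mx.
exists (h \o e), (h \o f), (h \o s), (h \o r); split.
- have h0 : lker h = 0%VS.
    apply/eqP; rewrite -subv0; apply/subvP => v; rewrite memv_ker memv0 hE => /eqP Pv.
    by rewrite -[v]mul1mx -QP -mulmxA Pv mulmx0.
  have hI : (fullv :&: lker h)%VS = 0%VS by rewrite h0 capv0.
  have := limg_basis_of hI bX; rewrite !map_cat -!map_comp.
  rewrite (_ : (h @: fullv)%VS = fullv) //; apply/eqP; rewrite eqEsubv subvf.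
  by apply/subvP => v _; rewrite -(hQ v) memv_img ?memvf.
- by rewrite /= r1 linear0.
- by move=> v; rewrite -(hQ v) -!hM ga.
by move=> i; have [[ae af as_ ar] [ue uf us ur] [ye yf ys yr]] := ops i;
  rewrite /= -!hM ae af as_ ar ue uf us ur ye yf ys yr !linearZ /= linearD linearZ !linear0.
Qed.

(** The short bands for the parameters 0, ..., p are p + 1 indecomposable modules;
    if two of them were isomorphic to the same module, their parameters would
    agree, but these are distinct in characteristic zero. *)
Lemma infinite_repr_type : [pchar k] =i pred0 -> ~ finite_repr_type D.
Proof.
move=> hchar [p [E EP]].
have ex (z : 'I_p.+1) : exists i : 'I_p, exists e f s r, short_band (E i) z%:R e f s r.
  have [M [M0 [e [f [s [r band]]]]]] := short_band_exists z%:R.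
  have [i iso] := EP M (indec_indecomposable xi2 rel dimD gen M0 (short_band_indec xi2 two_neq0 (do_a4 (opM_ops rel M)) band)).
  by exists i; apply: short_band_iso iso band.
have [i iP] := fin_all_exists ex.
suff /leq_card : injective i by rewrite !card_ord ltnn.
move=> z z' ii; have [e [f [s [r band]]]] := iP z; have := iP z'; rewrite -ii.
move=> [e' [f' [s' [r' band']]]].
have := short_band_parameter xi2 two_neq0 (do_a4 (opM_ops rel _)) band band'.
have inj (m n : nat) : (m <= n)%N -> m%:R = n%:R :> k -> m = n.
  move=> mn /eqP; rewrite eq_sym -subr_eq0 -natrB // ((pcharf0P k).1 hchar) subn_eq0 => nm.
  by apply/eqP; rewrite eqn_leq mn.
by move=> zz; apply/val_inj; case: (leqP z z') => [/inj/(_ zz)|/ltnW/inj/(_ (esym zz))/esym].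
Qed.

End InfinitelyMany.

Theorem corollary2p20 (k : closedFieldType) (hchar : [pchar k] =i pred0)
    (xi : k) (hxi : 4.-primitive_root xi)
    (K : falgType k) (hK : hopf_data K) (a b c d : K)
    (hKP : is_hopf_K xi hK a b c d)
    (D : falgType k) (hD : is_drinfeld_double (cop hK) D) :
  tame D.
Proof.
have two_neq0 : 2 != 0 :> k by rewrite ((pcharf0P k).1 hchar).
have xi2 := primitive4_sqr hxi.
have [A [g [u [y [rel dimD gen]]]]] := double_generators xi2 two_neq0 hKP hD.
split; first exact: (infinite_repr_type xi2 two_neq0 rel dimD gen hchar).
exact: (tame_families xi2 two_neq0 rel dimD gen).
Qed.
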